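(* Let $n\ge 1$, let $f,g,u,v\in \mathrm{Sym}(\mathbb{C}^n)\cap H(\mathbb{C}^n)$, and write $\varphi=f+\overline{g}$ and $\psi=u+\overline{v}$. (a) If $T_\varphi T_\psi=T_h$ on $F^2$ for some $h\in L^2(\mathbb{C}^n,d\mu)$, then $$h(z)=u(z)\overline{g(z)}+f(z)u(z)+\overline{g(z)}\,\overline{v(z)}+v^*(\overline{z}-\partial_z)f(z)$$ for (almost every) $z\in\mathbb{C}^n$. (b) If $T_\varphi T_\psi=0$ on $F^2$, then $$u(z)\overline{g(z)}+f(z)u(z)+\overline{g(z)}\,\overline{v(z)}+v^*(\overline{z}-\partial_z)f(z)=0\qquad(z\in\mathbb{C}^n).$$
   Context: $dV$ is Lebesgue measure on $\mathbb{C}^n$ and $d\mu(z)=\pi^{-n}e^{-|z|^2}dV(z)$. For $z,w\in\mathbb{C}^n$, $z\cdot w=\sum_k z_kw_k$ (bilinear) and $|z|^2=z\cdot\overline{z}$. $H(\mathbb{C}^n)$ is the space of entire functions and $F^2=L^2(\mathbb{C}^n,d\mu)\cap H(\mathbb{C}^n)$ is the Fock space, with reproducing kernel $K_z(w)=K(w,z)=e^{w\cdot\overline{z}}$. $\mathrm{Sym}(\mathbb{C}^n)$ is the set of complex measurable functions $u$ such that for every $c>0$ the function $u(z)e^{-c|z|^2}$ is essentially bounded. Toeplitz operators: $T_\varphi=PM_\varphi$, where $M_\varphi$ is multiplication by $\varphi$ and $P$ is the orthogonal projection of $L^2(\mathbb{C}^n,d\mu)$ onto $F^2$; explicitly $T_\varphi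 F(z)=\int_{\mathbb{C}^n}\varphi(w)F(w)e^{z\cdot\overline{w}}\,d\mu(w)$. Such operators may be unbounded; identities between Toeplitz operators and their products are understood as identities on the (dense) linear span of the kernels $K_z$, $z\in\mathbb{C}^n$, where all the integrals involved converge. Notation $v^*(\overline{z}-\partial_z)f(z)$: for entire $v(z)=\sum_i a_iz^i$ (multi-indices $i$), $v^*(z)=\overline{v(\overline{z})}=\sum_i\overline{a_i}z^i$, and $$v^*(\overline{z}-\partial_z)f(z)=\sum_i\overline{a_i}\,(\overline{z}-\partial_z)^if(z),\qquad (\overline{z}-\partial_z)^if(z)=\sum_{l\le i}\binom{i}{l}(-1)^{|i-l|}\,\overline{z}^{\,l}\,\partial^{i-l}f(z),$$ where $\binom{i}{l}=\prod_k\binom{i_k}{l_k}$, $l\le i$ componentwise, $|i-l|=\sum_k(i_k-l_k)$, $\partial^j=\partial_1^{j_1}\cdots\partial_n^{j_n}$, $\partial_k=\partial/\partial z_k$. *)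

(* Defs.v *)
From HB Require Import structures.
From mathcomp Require Import all_boot all_order all_algebra.
From mathcomp Require Import complex.
From mathcomp Require Import all_classical all_reals all_analysis
  measurable_realfun ess_sup_inf.
From mathcomp.analysis.showcase Require summability.

Set Implicit Arguments.
Unset Strict Implicit.
Unset Printing Implicit Defensive.

Import Order.TTheory GRing.Theory Num.Theory.
Import numFieldNormedType.Exports.

Local Open Scope classical_set_scope.
Local Open Scope ring_scope.
Local Open Scope complex_scope.

(* restated because the canonical sigma-finite structure of [m1 \x m2] is not
   inferred: the subprobability instance on products shadows it *)
Lemma product_sigma_finite d1 d2 (T1 : measurableType d1)
    (T2 : measurableType d2) (R : realType)
    (m1 : {sigma_finite_measure set T1 -> \bar R})
    (m2 : {sigma_finite_measure set T2 -> \bar R}) :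
  sigma_finite setT (m1 \x m2)%E.
Proof.
have /sigma_finiteP[F [TF ndF Foo]] := sigma_finiteT m1.
have /sigma_finiteP[G [TG ndG Goo]] := sigma_finiteT m2.
exists (fun k => F k `*` G k).
  rewrite -setXTT TF TG predeqE => -[x y]; split; last first.
    by move=> [k _ []/= ? ?]; split; exists k.
  move=> [/= [k _ Fkx] [l _ Gly]]; exists (maxn k l) => //; split.
  - by move: x Fkx; exact/subsetPset/ndF/leq_maxl.
  - by move: y Gly; exact/subsetPset/ndG/leq_maxr.
move=> k; have [? ?] := Foo k; have [? ?] := Goo k.
split; first exact: measurableX.
by rewrite product_measure1E// lte_mul_pinfty// ge0_fin_numE.
Qed.

Section product_power.
Context d (T : measurableType d) (R : realType).
Variable m : {sigma_finite_measure set T -> \bar R}.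

Definition tcons n (p : T * n.-tuple T) : n.+1.-tuple T :=
  [the n.+1.-tuple T of p.1 :: p.2].

Lemma measurable_tcons n : measurable_fun setT (@tcons n).
Proof. exact: measurable_cons. Qed.

Definition power_step n (mn : {sigma_finite_measure set (n.-tuple T) -> \bar R})
    : set (n.+1.-tuple T) -> \bar R :=
  pushforward (m \x mn)%E (@tcons n).

Section power_step_measure.
Variables (n : nat) (mn : {sigma_finite_measure set (n.-tuple T) -> \bar R}).

Let pushm : {measure set _ -> \bar R} :=
  measure_function_pushforward__canonical__measure_function_Measure
    (m \x mn)%E (@measurable_tcons n).

Let step0 : power_step mn set0 = 0%E.
Proof. exact: (measure0 pushm). Qed.

Let step_ge0 A : (0 <= power_step mn A)%E.
Proof. exact: (measure_ge0 pushm). Qed.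

Let step_sigma_additive : semi_sigma_additive (power_step mn).
Proof. exact: (@measure_semi_sigma_additive _ _ _ pushm). Qed.

HB.instance Definition _ :=
  isMeasure.Build _ _ _ (power_step mn) step0 step_ge0 step_sigma_additive.

Let step_sigma_finite : sigma_finite setT (power_step mn).
Proof.
have [F TF Foo] := product_sigma_finite m mn.
pose un (t : n.+1.-tuple T) : T * n.-tuple T := (thead t, [tuple of behead t]).
have mun : measurable_fun setT un.
  apply/measurable_fun_pairP; split; first exact: measurable_tnth.
  exact: measurable_behead.
have unK p : un (tcons p) = p.
  by case: p => x t; congr (_, _); apply/val_inj.
exists (fun i => un @^-1` F i).
  by rewrite -preimage_bigcup -TF preimage_setT.
move=> i; have [mF Fi] := Foo i; split.
  by rewrite -[X in measurable X]setTI; exact: mun.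
rewrite /power_step /pushforward (_ : _ @^-1` _ = F i)//.
by apply/seteqP; split=> p /=; rewrite unK.
Qed.

HB.instance Definition _ :=
  Measure_isSigmaFinite.Build _ _ _ (power_step mn) step_sigma_finite.

End power_step_measure.

Fixpoint measure_power n : {sigma_finite_measure set (n.-tuple T) -> \bar R} :=
  match n return {sigma_finite_measure set (n.-tuple T) -> \bar R} with
  | 0 => dirac [tuple]
  | k.+1 => power_step (measure_power k)
  end.

End product_power.

Definition plane (R : realType) : Type :=
  (measurableTypeR R * measurableTypeR R)%type.

HB.instance Definition _ R := Measurable.on (plane R).

Definition lebesgue_plane (R : realType) : set (plane R) -> \bar R :=
  (lebesgue_measure \x lebesgue_measure)%E.

HB.instance Definition _ R := Measure.on (@lebesgue_plane R).

HB.instance Definition _ R :=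
  Measure_isSigmaFinite.Build _ _ _ (@lebesgue_plane R)
    (product_sigma_finite lebesgue_measure lebesgue_measure).

(* [R[i]] seen through the number field interface, from which the topology,
   the norm and the normed module structures are inherited *)
Definition Cplx (R : realType) : numFieldType := R[i].

Definition Cn (R : realType) (n : nat) : Type := 'rV[Cplx R]_n.

HB.instance Definition _ R n := NormedModule.on (Cn R n).

Section lebesgue_Cn.
Context (R : realType) (n : nat).

Definition Cn_coords (z : Cn R n) : n.-tuple (plane R) :=
  [tuple (complex.Re (z ord0 k), complex.Im (z ord0 k)) | k < n].

Definition coords_Cn (t : n.-tuple (plane R)) : Cn R n :=
  \row_k ((tnth t k).1 +i* (tnth t k).2).

Lemma coords_CnK : cancel coords_Cn Cn_coords.
Proof.
move=> t; apply: eq_from_tnth => k.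
by rewrite tnth_mktuple mxE /=; case: (tnth t k).
Qed.

(* the Borel sigma-algebra of C^n, generated by the 2n real coordinates *)
HB.instance Definition _ :=
  Measurable.copy (Cn R n) (g_sigma_algebra_preimageType Cn_coords).

Lemma measurable_coords_Cn : measurable_fun setT coords_Cn.
Proof.
move=> _ _ [B mB <-]; rewrite !setTI.
by rewrite -comp_preimage (_ : _ \o _ = id)//; apply/funext/coords_CnK.
Qed.

Lemma measurable_Cn_coords : measurable_fun setT Cn_coords.
Proof. by move=> _ B mB; exists B. Qed.

Definition lebesgue_Cn : set (Cn R n) -> \bar R :=
  pushforward (measure_power (@lebesgue_plane R) n) coords_Cn.

Let push : {measure set (Cn R n) -> \bar R} :=
  measure_function_pushforward__canonical__measure_function_Measure
    (measure_power (@lebesgue_plane R) n) measurable_coords_Cn.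

Let leb0 : lebesgue_Cn set0 = 0%E.
Proof. exact: (measure0 push). Qed.

Let leb_ge0 A : (0 <= lebesgue_Cn A)%E.
Proof. exact: (measure_ge0 push). Qed.

Let leb_sigma_additive : semi_sigma_additive lebesgue_Cn.
Proof. exact: (@measure_semi_sigma_additive _ _ _ push). Qed.

HB.instance Definition _ :=
  isMeasure.Build _ _ _ lebesgue_Cn leb0 leb_ge0 leb_sigma_additive.

Definition conjv (z : Cn R n) : Cn R n := \row_k conjc (z ord0 k).

Definition dotc (z w : Cn R n) : Cplx R := \sum_k z ord0 k * w ord0 k.

Definition sqnorm (z : Cn R n) : R := complex.Re (dotc z (conjv z)).

Definition gauss_density (z : Cn R n) : R :=
  (pi ^+ n)^-1 * expR (- sqnorm z).

Definition gauss (A : set (Cn R n)) : \bar R :=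
  (\int[lebesgue_Cn]_(z in A) (gauss_density z)%:E)%E.

Lemma gauss_density_ge0 z : 0 <= gauss_density z.
Proof. by rewrite mulr_ge0 ?expR_ge0// invr_ge0 exprn_ge0// pi_ge0. Qed.

Lemma sqnormE z :
  sqnorm z = \sum_k ((tnth (Cn_coords z) k).1 ^+ 2 + (tnth (Cn_coords z) k).2 ^+ 2).
Proof.
rewrite /sqnorm /dotc raddf_sum; apply: eq_bigr => k _.
rewrite tnth_mktuple mxE; case: (z ord0 k) => a b /=.
by rewrite mulrN opprK -!expr2.
Qed.

Lemma measurable_sqnorm : measurable_fun setT sqnorm.
Proof.
rewrite (funext sqnormE); apply: measurable_sum => k.
have mk : measurable_fun setT (fun z : Cn R n => tnth (Cn_coords z) k).
  apply: (measurableT_comp (measurable_tnth k)).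
  exact: measurable_Cn_coords.
by apply: measurable_funD; apply: measurable_funX; exact: measurableT_comp.
Qed.

Lemma measurable_gauss_density : measurable_fun setT gauss_density.
Proof.
apply: measurable_funM => //.
apply: (measurableT_comp (@measurable_expR R)).
by apply: measurableT_comp => //; exact: measurable_sqnorm.
Qed.

Let gauss0 : gauss set0 = 0%E.
Proof. exact: integral_set0. Qed.

Let gauss_ge0 A : (0 <= gauss A)%E.
Proof. by apply: integral_ge0 => z _; rewrite lee_fin gauss_density_ge0. Qed.

Let gauss_sigma_additive : semi_sigma_additive gauss.
Proof.
move=> F mF tF mUF; rewrite /gauss ge0_integral_bigcup//=.
- by apply: is_cvg_ereal_nneg_natsum_cond => k _ _; exact: gauss_ge0.
- apply/measurable_EFinP; apply: measurable_funTS.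
  exact: measurable_gauss_density.
- by move=> z _; rewrite lee_fin gauss_density_ge0.
Qed.

HB.instance Definition _ :=
  isMeasure.Build _ _ _ gauss gauss0 gauss_ge0 gauss_sigma_additive.

End lebesgue_Cn.

Section complex_functions.
Context (R : realType) (n : nat).
Implicit Types (f g u v h F : Cn R n -> Cplx R) (z w : Cn R n).

Definition cmeasurable u :=
  measurable_fun setT (fun z => complex.Re (u z)) /\
  measurable_fun setT (fun z => complex.Im (u z)).

(* the integral of a function that is not integrable has no meaning here: the
   real integrals are then default values *)
Definition cintegral (mu : {measure set (Cn R n) -> \bar R}) F : Cplx R :=
  (\int[mu]_z complex.Re (F z)) +i* (\int[mu]_z complex.Im (F z)).

Definition cexp (x : Cplx R) : Cplx R :=
  (expR (complex.Re x))%:C * (cos (complex.Im x) +i* sin (complex.Im x)).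

(* complex Frechet differentiability, the scalars being [Cplx R] *)
Definition entire u := forall z, differentiable u z.

Definition Sym u := cmeasurable u /\
  forall c : R, 0 < c ->
    (ess_sup (@lebesgue_Cn R n)
       (fun z => (Normc.normc (u z) * expR (- (c * sqnorm z)))%:E) < +oo)%E.

Definition L2gauss h := cmeasurable h /\
  (\int[@gauss R n]_z ((Normc.normc (h z)) ^+ 2)%:E < +oo)%E.

Definition fock_kernel z w : Cplx R := cexp (dotc w (conjv z)).

(* linear span of the reproducing kernels, the common domain on which identities
   between Toeplitz operators and their products are understood *)
Definition kernel_span F := exists m (c : 'I_m -> Cplx R) (a : 'I_m -> Cn R n),
  forall w, F w = \sum_j c j * fock_kernel (a j) w.

(* [u w * F w] is integrated against e^{z . conj w}, which is the conjugate of
   the reproducing kernel [fock_kernel z w] *)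
Definition toeplitz u F z : Cplx R :=
  cintegral (@gauss R n) (fun w => u w * F w * cexp (dotc z (conjv w))).

Definition multiindex := {ffun 'I_n -> nat}.

Definition mdegree (i : multiindex) : nat := (\sum_k i k)%N.

Definition monomial (i : multiindex) z : Cplx R := \prod_k z ord0 k ^+ i k.

(* ['D_v f z] is a limit of difference quotients with increments in [Cplx R], so
   this is the complex derivative d/dz_k *)
Definition partial (k : 'I_n) f : Cn R n -> Cplx R :=
  fun z => 'D_(delta_mx ord0 k : Cn R n) f z.

Definition mpartial (j : multiindex) f : Cn R n -> Cplx R :=
  foldr (fun k => iter (j k) (partial k)) f (enum 'I_n).

(* unordered sum: convergence along the net of finite sets of multi-indices *)
Definition has_msum (x : multiindex -> Cplx R) (s : Cplx R) :=
  summability.partial_sum x @ summability.totally --> s.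

Definition power_expansion (a : multiindex -> Cplx R) v :=
  forall z, has_msum (fun i => a i * monomial i z) (v z).

(* (conj z - d)^i f (z), where conj z and d are kept in the order of the
   binomial formula; multi-indices l <= i have all entries at most |i|, whence
   the finite index type *)
Definition conj_sub_partial (i : multiindex) f z : Cplx R :=
  \sum_(l : {ffun 'I_n -> 'I_(mdegree i).+1} | [forall k, (l k <= i k)%N])
    (\prod_k 'C(i k, l k))%:R * (-1) ^+ (\sum_k (i k - l k))%N *
    monomial [ffun k => l k : nat] (conjv z) *
    mpartial [ffun k => (i k - l k)%N] f z.

(* [s] is the value of v^*(conj z - d) f (z). This is a relation, which holds only
   if the series converges; it is functional since the coefficients of an
   everywhere convergent power series are unique. *)
Definition star_op_value v f z (s : Cplx R) :=
  exists2 a, power_expansion a v &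
    has_msum (fun i => conjc (a i) * conj_sub_partial i f z) s.

End complex_functions.

(* Main.v *)
Require Import Defs.
From HB Require Import structures.
From mathcomp Require Import all_boot all_order all_algebra.
From mathcomp Require Import complex finmap.
From mathcomp Require Import all_classical all_reals all_analysis.
From mathcomp Require Import measurable_realfun ess_sup_inf.
From mathcomp Require Import ring lra.

Import Order.TTheory GRing.Theory Num.Theory.
Import numFieldNormedType.Exports.

Local Open Scope classical_set_scope.
Local Open Scope ring_scope.
Local Open Scope complex_scope.

(* On entire functions F of subgaussian growth the Gaussian integral of
   F(w) e^{z . conj w} is F(z): by translation this is the mean value property
   at the origin, which follows from rotation invariance of the measure and
   from Goursat's theorem applied to F(e^zeta w). Expanding e^{z . conj w} in the
   reproducing formula gives the power series of v, and differentiating it gives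
     v^*(conj w - d) f (w) = int f(a) conj(v(w - a)) e^{w . conj a} dmu(a) =: S(w);
   by Fubini and the reproducing formula, T_S K_b(z) = f(z) conj(v(b)) K_b(z).
   Reproducing the remaining terms shows that T_phi T_psi and T_W agree on the
   kernels, where W = u conj g + f u + conj g conj v + S is in L^2. Hence all
   the integrals of h - W against K_a(w) e^{- a . conj w}, which are characters of
   C^n, vanish, so that h = W almost everywhere. In the case h = 0, W is
   continuous and thus zero everywhere. *)

Set Implicit Arguments.
Unset Strict Implicit.
Unset Printing Implicit Defensive.

(** The growth of the kernel governs all constants. The functions f, g, u, v are below e^{c |z|^2}
    for every c > 0, but e^{z . conj w} can only be split, by Young's inequality with a weight t,
    into e^{t |z|^2 / 2} and e^{|w|^2 / (2 t)}. Integrability in w against the Gaussian measure asks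
    for a coefficient below 1, and square integrability in z for one below 1/2. The choice t = 2/3
    gives 1/3 and 3/4, with room left for the symbols; the fractions 5/12, 7/8 and 19/24 result from
    it. That a function orthogonal to all characters vanishes is shown by enlarging the characters:
    the bounded real functions that may be inserted into these integrals are closed under products
    and bounded pointwise limits, and thereby reach the indicator of every Borel set. Complex
    integrals are handled through real and imaginary parts, at the price of a factor 2 in norm
    estimates that only feed limits and integrability. *)

Notation Re := complex.Re.
Notation Im := complex.Im.
Notation nm := Normc.normc.

#[global] Arguments Normc.normc : simpl never.

(** * Complex-valued functions and their integrals *)

Section cplx.
Context {R : realType}.
Implicit Types (x y : Cplx R) (a b : R).

Lemma cplx_eq x y : Re x = Re y -> Im x = Im y -> x = y.
Proof. by case: x y => a b [c d] /= -> ->. Qed.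

Lemma ReD x y : Re (x + y) = Re x + Re y. Proof. by case: x y => a b []. Qed.
Lemma ImD x y : Im (x + y) = Im x + Im y. Proof. by case: x y => a b []. Qed.
Lemma ReN x : Re (- x) = - Re x. Proof. by case: x. Qed.
Lemma ImN x : Im (- x) = - Im x. Proof. by case: x. Qed.
Lemma ReB x y : Re (x - y) = Re x - Re y. Proof. by rewrite ReD ReN. Qed.
Lemma ImB x y : Im (x - y) = Im x - Im y. Proof. by rewrite ImD ImN. Qed.
Lemma ReM x y : Re (x * y) = Re x * Re y - Im x * Im y.
Proof. by case: x y => a b []. Qed.
Lemma ImM x y : Im (x * y) = Re x * Im y + Im x * Re y.
Proof. by case: x y => a b []. Qed.
Lemma Re0 : Re (0 : Cplx R) = 0. Proof. by []. Qed.
Lemma Im0 : Im (0 : Cplx R) = 0. Proof. by []. Qed.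
Lemma Re1 : Re (1 : Cplx R) = 1. Proof. by []. Qed.
Lemma Im1 : Im (1 : Cplx R) = 0. Proof. by []. Qed.
Lemma Re_conjc x : Re (conjc x) = Re x. Proof. by case: x. Qed.
Lemma Im_conjc x : Im (conjc x) = - Im x. Proof. by case: x. Qed.

Definition cplxE := (ReD, ImD, ReN, ImN, ReM, ImM, Re0, Im0, Re1, Im1, Re_conjc, Im_conjc).

Lemma conjD x y : conjc (x + y) = conjc x + conjc y :> Cplx R.
Proof. by apply: cplx_eq; rewrite !cplxE ?opprD. Qed.
Lemma conjM x y : conjc (x * y) = conjc x * conjc y :> Cplx R.
Proof. by apply: cplx_eq; rewrite !cplxE; ring. Qed.
Lemma conjN x : conjc (- x) = - conjc x :> Cplx R.
Proof. by apply: cplx_eq; rewrite !cplxE. Qed.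
Lemma conj0 : conjc (0 : Cplx R) = 0 :> Cplx R.
Proof. by apply: cplx_eq; rewrite !cplxE ?oppr0. Qed.
Lemma conj1 : conjc (1 : Cplx R) = 1 :> Cplx R.
Proof. by apply: cplx_eq; rewrite !cplxE ?oppr0. Qed.
Lemma conjK x : conjc (conjc x) = x.
Proof. by case: x => a b /=; rewrite opprK. Qed.
Lemma conjX x m : conjc (x ^+ m) = (conjc x : Cplx R) ^+ m :> Cplx R.
Proof. by elim: m => [|m IH]; rewrite ?expr0 ?conj1// !exprS conjM IH. Qed.
Lemma conj_sum I (r : seq I) (P : pred I) (F : I -> Cplx R) :
  conjc (\sum_(i <- r | P i) F i) = \sum_(i <- r | P i) (conjc (F i) : Cplx R) :> Cplx R.
Proof. exact: (big_morph (fun x : Cplx R => conjc x : Cplx R) conjD conj0). Qed.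
Lemma conj_prod I (r : seq I) (P : pred I) (F : I -> Cplx R) :
  conjc (\prod_(i <- r | P i) F i) = \prod_(i <- r | P i) (conjc (F i) : Cplx R) :> Cplx R.
Proof. exact: (big_morph (fun x : Cplx R => conjc x : Cplx R) conjM conj1). Qed.

Lemma nmE x : nm x = Num.sqrt (Re x ^+ 2 + Im x ^+ 2). Proof. by case: x. Qed.
Lemma nm_sq x : nm x ^+ 2 = Re x ^+ 2 + Im x ^+ 2.
Proof. by rewrite nmE sqr_sqrtr// addr_ge0 ?sqr_ge0. Qed.
Lemma nm_ge0 x : 0 <= nm x. Proof. by rewrite nmE sqrtr_ge0. Qed.
Lemma nm0 : nm (0 : Cplx R) = 0. Proof. exact: Normc.normc0. Qed.
Lemma nm1 : nm (1 : Cplx R) = 1. Proof. exact: Normc.normc1. Qed.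
Lemma nm0_eq0 x : nm x = 0 -> x = 0. Proof. exact: Normc.eq0_normc. Qed.
Lemma nmM x y : nm (x * y) = nm x * nm y. Proof. exact: Normc.normcM. Qed.
Lemma nmN x : nm (- x) = nm x. Proof. exact: normcN. Qed.
Lemma nmD x y : nm (x + y) <= nm x + nm y. Proof. exact: le_normcD. Qed.
Lemma nmB x y : nm (x - y) = nm (y - x). Proof. by rewrite -nmN opprB. Qed.
Lemma nmJ x : nm (conjc x) = nm x.
Proof. by rewrite !nmE !cplxE sqrrN. Qed.
Lemma nmX x m : nm (x ^+ m) = nm x ^+ m.
Proof. by elim: m => [|m IH]; rewrite ?expr0 ?nm1// !exprS nmM IH. Qed.
Lemma nmV x : nm x^-1 = (nm x)^-1. Proof. exact: Normc.normcV. Qed.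
Lemma nm_sum I (r : seq I) (P : pred I) (F : I -> Cplx R) :
  nm (\sum_(i <- r | P i) F i) <= \sum_(i <- r | P i) nm (F i).
Proof.
elim/big_ind2: _ => [|u a v b ua vb|//]; first by rewrite nm0.
by rewrite (le_trans (nmD _ _))// lerD.
Qed.
Lemma nm_prod I (r : seq I) (P : pred I) (F : I -> Cplx R) :
  nm (\prod_(i <- r | P i) F i) = \prod_(i <- r | P i) nm (F i).
Proof. exact: (big_morph (fun x : Cplx R => nm x) nmM nm1). Qed.
Lemma nmR a : nm (a%:C : Cplx R) = `|a|.
Proof. by rewrite nmE /= expr0n addr0 sqrtr_sqr. Qed.
Lemma nm_nat m : nm (m%:R : Cplx R) = m%:R.
Proof.
rewrite (_ : m%:R = (m%:R)%:C :> Cplx R); first by rewrite nmR ger0_norm.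
by rewrite raddfMn.
Qed.

Lemma le_Re x : `|Re x| <= nm x.
Proof. by rewrite nmE -sqrtr_sqr ler_wsqrtr// lerDl sqr_ge0. Qed.
Lemma le_Im x : `|Im x| <= nm x.
Proof. by rewrite nmE -sqrtr_sqr ler_wsqrtr// lerDr sqr_ge0. Qed.
Lemma nm_le x : nm x <= `|Re x| + `|Im x|.
Proof.
rewrite -(@ler_pXn2r _ 2)// ?nnegrE ?nm_ge0 ?addr_ge0// nm_sq.
rewrite sqrrD !real_normK ?num_real//.
have : 0 <= `|Re x| * `|Im x| by rewrite mulr_ge0.
by lra.
Qed.

Lemma norm_nm x : `|x| = (nm x)%:C :> Cplx R.
Proof. by rewrite nmE normc_def. Qed.

Lemma realcM a b : (a * b)%:C = a%:C * b%:C :> Cplx R.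
Proof. by rewrite rmorphM. Qed.
Lemma realcD a b : (a + b)%:C = a%:C + b%:C :> Cplx R.
Proof. by rewrite rmorphD. Qed.
Lemma conj_realc a : conjc (a%:C) = a%:C :> Cplx R.
Proof. by apply: cplx_eq; rewrite /= ?oppr0. Qed.

Lemma Re_sum I (r : seq I) (P : pred I) (F : I -> Cplx R) :
  Re (\sum_(i <- r | P i) F i) = \sum_(i <- r | P i) Re (F i).
Proof. exact: (big_morph (fun x : Cplx R => Re x) ReD Re0). Qed.
Lemma Im_sum I (r : seq I) (P : pred I) (F : I -> Cplx R) :
  Im (\sum_(i <- r | P i) F i) = \sum_(i <- r | P i) Im (F i).
Proof. exact: (big_morph (fun x : Cplx R => Im x) ImD Im0). Qed.

Lemma cexpD x y : cexp (x + y) = cexp x * cexp y.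
Proof.
rewrite /cexp; apply: cplx_eq; rewrite !cplxE /= expRD cosD sinD; ring.
Qed.
Lemma cexp0 : cexp (0 : Cplx R) = 1.
Proof. by apply: cplx_eq; rewrite /cexp !cplxE /= expR0 cos0 sin0; ring. Qed.
Lemma conj_cexp x : conjc (cexp x) = cexp (conjc x).
Proof. by rewrite /cexp; apply: cplx_eq; rewrite !cplxE /= cosN sinN; ring. Qed.
Lemma nm_cexp x : nm (cexp x) = expR (Re x).
Proof.
rewrite /cexp nmM nmR ger0_norm ?expR_ge0// nmE /= cos2Dsin2 sqrtr1 mulr1//.
Qed.
Lemma cexp_sum I (r : seq I) (P : pred I) (F : I -> Cplx R) :
  cexp (\sum_(i <- r | P i) F i) = \prod_(i <- r | P i) cexp (F i).
Proof. exact: (big_morph (@cexp R) cexpD cexp0). Qed.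
Lemma cexp_real a : cexp (a%:C) = (expR a)%:C :> Cplx R.
Proof. by apply: cplx_eq; rewrite /cexp !cplxE /= cos0 sin0; ring. Qed.

End cplx.

Section ccvg.
Context {R : realType}.
(** Expressed by a real sequence, so that squeezing and dominated convergence for real functions
    apply directly. *)
Definition ccvg (u : nat -> Cplx R) (l : Cplx R) := (fun k => nm (u k - l)) @ \oo --> (0 : R).

Lemma ccvg_squeeze (u : nat -> Cplx R) l (b : nat -> R) :
  (forall k, nm (u k - l) <= b k) -> b @ \oo --> (0 : R) -> ccvg u l.
Proof.
move=> ub b0; apply: (@squeeze_cvgr _ _ _ _ (cst 0) b) => //; last exact: cvg_cst.
by apply: nearW => k; rewrite nm_ge0 ub.
Qed.

Lemma ccvg_uniq u l l' : ccvg u l -> ccvg u l' -> l = l'.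
Proof.
move=> ul ul'; apply/eqP; rewrite -subr_eq0; apply/eqP/nm0_eq0.
apply/eqP; rewrite eq_le nm_ge0 andbT.
have H : (fun k => nm (u k - l) + nm (u k - l')) @ \oo --> (0 + 0 : R) by exact: cvgD.
rewrite -(addr0 0); apply: (ler_cvg_to (cvg_cst _) H).
apply: nearW => k; rewrite (nmB (u k)) (le_trans _ (nmD _ _))//.
by rewrite addrA subrK.
Qed.

Lemma ccvg_nm_le u l b : ccvg u l -> (forall k, nm (u k) <= b) -> nm l <= b.
Proof.
move=> ul ub.
have H : (fun k => nm (u k - l) + b) @ \oo --> (0 + b : R).
  by apply: cvgD => //; exact: cvg_cst.
rewrite -(add0r b); apply: (ler_cvg_to (cvg_cst _) H).
apply: nearW => k; rewrite (nmB (u k)) (le_trans (y := nm (l - u k) + nm (u k)))//.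
  by rewrite (le_trans _ (nmD _ _))// subrK.
by rewrite lerD2l.
Qed.
End ccvg.

Section cint.
Context {R : realType} d {T : measurableType d}.
Implicit Types (F G : T -> Cplx R) (mu : {measure set T -> \bar R}) (g : T -> R).

(** [cmeasurable] over an arbitrary measurable type: Fubini's theorem is applied on products and on
    the real line. Likewise [cint] below is convertible with [cintegral] at [gauss]. *)
Definition cmeas F := measurable_fun setT (fun z => Re (F z)) /\
  measurable_fun setT (fun z => Im (F z)).

Lemma cmeasD F G : cmeas F -> cmeas G -> cmeas (fun z => F z + G z).
Proof.
move=> [a b] [c e]; split.
  by under eq_fun do rewrite ReD; exact: measurable_funD.
by under eq_fun do rewrite ImD; exact: measurable_funD.
Qed.
Lemma cmeasN F : cmeas F -> cmeas (fun z => - F z).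
Proof.
move=> [a b]; split.
  by under eq_fun do rewrite ReN; exact: measurableT_comp.
by under eq_fun do rewrite ImN; exact: measurableT_comp.
Qed.
Lemma cmeasB F G : cmeas F -> cmeas G -> cmeas (fun z => F z - G z).
Proof. by move=> a b; apply: cmeasD => //; exact: cmeasN. Qed.
Lemma cmeasM F G : cmeas F -> cmeas G -> cmeas (fun z => F z * G z).
Proof.
move=> [a b] [c e]; split.
  under eq_fun do rewrite ReM.
  by apply: measurable_funB; exact: measurable_funM.
under eq_fun do rewrite ImM.
by apply: measurable_funD; exact: measurable_funM.
Qed.
Lemma cmeas_conj F : cmeas F -> cmeas (fun z => conjc (F z)).
Proof.
move=> [a b]; split.
  by under eq_fun do rewrite Re_conjc.
by under eq_fun do rewrite Im_conjc; exact: measurableT_comp.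
Qed.
Lemma cmeas_cst c : cmeas (fun=> c).
Proof. by split; exact: measurable_cst. Qed.
Lemma cmeas_sum I (r : seq I) (F : I -> T -> Cplx R) :
  (forall i, cmeas (F i)) -> cmeas (fun z => \sum_(i <- r) F i z).
Proof.
move=> mF; elim: r => [|i r IH].
  by under eq_fun do rewrite big_nil; exact: cmeas_cst.
by under eq_fun do rewrite big_cons; exact: cmeasD.
Qed.
Lemma cmeas_real g : measurable_fun setT g -> cmeas (fun z => (g z)%:C).
Proof. by move=> mg; split=> //; exact: measurable_cst. Qed.
Lemma cmeas_nm F : cmeas F -> measurable_fun setT (fun z => nm (F z)).
Proof.
move=> [a b]; under eq_fun do rewrite nmE.
apply: (measurableT_comp (f := @Num.sqrt R)).
  by apply: continuous_measurable_fun; exact: sqrt_continuous.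
by apply: measurable_funD; exact: measurable_funX.
Qed.
Lemma cmeas_cexp F : cmeas F -> cmeas (fun z => cexp (F z)).
Proof.
move=> [a b]; apply: cmeasM.
  by apply: cmeas_real; exact: measurableT_comp.
split=> /=.
  apply: (measurableT_comp (f := @cos R)) => //.
  by apply: continuous_measurable_fun; exact: continuous_cos.
apply: (measurableT_comp (f := @sin R)) => //.
by apply: continuous_measurable_fun; exact: continuous_sin.
Qed.

Definition intR mu g := mu.-integrable setT (EFin \o g).
Definition cintble mu F := intR mu (fun x => Re (F x)) /\ intR mu (fun x => Im (F x)).
Definition cint mu F : Cplx R :=
  (\int[mu]_x Re (F x)) +i* (\int[mu]_x Im (F x)).

Lemma intR_le mu g g' : measurable_fun setT g -> (forall x, `|g x| <= g' x) ->
  intR mu g' -> intR mu g.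
Proof.
move=> mg gg' ig'; apply: le_integrable ig' => //.
  exact/measurable_EFinP.
by move=> x _ /=; rewrite lee_fin (le_trans (gg' x))// ler_norm.
Qed.
Lemma intR_D mu g g' : intR mu g -> intR mu g' -> intR mu (fun x => g x + g' x).
Proof. by move=> a b; have := integrableD measurableT a b. Qed.
Lemma intR_Z mu c g : intR mu g -> intR mu (fun x => c * g x).
Proof. by move=> a; have := integrableZl measurableT c a. Qed.
Lemma intR_meas mu g : intR mu g -> measurable_fun setT g.
Proof. by move=> /integrableP[/measurable_EFinP]. Qed.

Lemma cintble_meas mu F : cintble mu F -> cmeas F.
Proof. by case=> /intR_meas ? /intR_meas. Qed.

Lemma cintble_dom mu F g : cmeas F -> (forall x, nm (F x) <= g x) ->
  intR mu g -> cintble mu F.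
Proof.
move=> [mr mi] Fg ig; split; apply: intR_le ig => // x.
  exact: le_trans (le_Re _) (Fg x).
exact: le_trans (le_Im _) (Fg x).
Qed.

Lemma cintble_nm mu F : cintble mu F -> intR mu (fun x => nm (F x)).
Proof.
move=> iF; have mF := cintble_meas iF; case: iF => a b.
apply: (@intR_le _ _ (fun x => `|Re (F x)| + `|Im (F x)|)).
- exact: cmeas_nm.
- by move=> x; rewrite ger0_norm ?nm_ge0 ?nm_le.
- by apply: intR_D; exact: integrable_norm.
Qed.

Lemma cintbleD mu F G : cintble mu F -> cintble mu G -> cintble mu (fun x => F x + G x).
Proof.
move=> iF iG; apply: (@cintble_dom _ _ (fun x => nm (F x) + nm (G x))).
- by apply: cmeasD; [exact: cintble_meas iF|exact: cintble_meas iG].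
- by move=> x; exact: nmD.
- by apply: intR_D; exact: cintble_nm.
Qed.
Lemma cintbleZ mu c F : cintble mu F -> cintble mu (fun x => c * F x).
Proof.
move=> iF; apply: (@cintble_dom _ _ (fun x => nm c * nm (F x))).
- by apply: cmeasM; [exact: cmeas_cst|exact: cintble_meas iF].
- by move=> x; rewrite nmM.
- by apply: intR_Z; exact: cintble_nm.
Qed.
Lemma cintbleN mu F : cintble mu F -> cintble mu (fun x => - F x).
Proof. by move=> /(cintbleZ (-1)); under eq_fun do rewrite mulN1r. Qed.
Lemma cintbleB mu F G : cintble mu F -> cintble mu G -> cintble mu (fun x => F x - G x).
Proof. by move=> iF iG; apply: cintbleD => //; exact: cintbleN. Qed.

Lemma eq_cint mu F G : F =1 G -> cint mu F = cint mu G.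
Proof. by move=> /funext ->. Qed.

Lemma cint_conj mu F : cintble mu F -> cint mu (fun x => conjc (F x)) = conjc (cint mu F).
Proof.
move=> [a b]; apply: cplx_eq => /=.
  by under eq_Rintegral do rewrite Re_conjc.
under eq_Rintegral do rewrite Im_conjc -mulN1r.
by rewrite RintegralZl// mulN1r.
Qed.

Lemma cintD mu F G : cintble mu F -> cintble mu G ->
  cint mu (fun x => F x + G x) = cint mu F + cint mu G.
Proof.
move=> [a b] [c e]; apply: cplx_eq; rewrite ?cplxE /=.
  by under eq_Rintegral do rewrite ReD; rewrite RintegralD.
by under eq_Rintegral do rewrite ImD; rewrite RintegralD.
Qed.

Lemma cintZ mu c F : cintble mu F -> cint mu (fun x => c * F x) = c * cint mu F.
Proof.
move=> [a b]; apply: cplx_eq; rewrite ?cplxE /=.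
  under eq_Rintegral do rewrite ReM.
  by rewrite RintegralB//; [rewrite !RintegralZl|exact: intR_Z|exact: intR_Z].
under eq_Rintegral do rewrite ImM.
by rewrite RintegralD//; [rewrite !RintegralZl|exact: intR_Z|exact: intR_Z].
Qed.

Lemma cintN mu F : cintble mu F -> cint mu (fun x => - F x) = - cint mu F.
Proof.
move=> iF; rewrite -mulN1r -cintZ//; apply: eq_cint => x; by rewrite mulN1r.
Qed.
Lemma cintB mu F G : cintble mu F -> cintble mu G ->
  cint mu (fun x => F x - G x) = cint mu F - cint mu G.
Proof. by move=> iF iG; rewrite cintD ?cintN//; exact: cintbleN. Qed.

Lemma cint0 mu : cint mu (fun=> 0) = 0.
Proof. by apply: cplx_eq; rewrite /= /Rintegral integral0. Qed.
Lemma cintble0 mu : cintble mu (fun=> 0).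
Proof. by split; rewrite /intR /=; exact: integrable0. Qed.

Lemma cintble_sum mu I (r : seq I) (F : I -> T -> Cplx R) :
  (forall i, cintble mu (F i)) -> cintble mu (fun x => \sum_(i <- r) F i x).
Proof.
move=> iF; elim: r => [|i r IH].
  by under eq_fun do rewrite big_nil; exact: cintble0.
by under eq_fun do rewrite big_cons; exact: cintbleD.
Qed.
Lemma cint_sum mu I (r : seq I) (F : I -> T -> Cplx R) :
  (forall i, cintble mu (F i)) ->
  cint mu (fun x => \sum_(i <- r) F i x) = \sum_(i <- r) cint mu (F i).
Proof.
move=> iF; elim: r => [|i r IH].
  by rewrite big_nil -[RHS](cint0 mu); apply: eq_cint => x; rewrite big_nil.
rewrite big_cons -IH -cintD//; last exact: cintble_sum.
by apply: eq_cint => x; rewrite big_cons.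
Qed.

(** The factor 2 comes from estimating the real and the imaginary part separately, each by the
    integral of the modulus. *)
Lemma nm_cint mu F : cintble mu F -> nm (cint mu F) <= 2 * \int[mu]_x nm (F x).
Proof.
move=> iF; have inF := cintble_nm iF; case: iF => a b.
rewrite (le_trans (nm_le _))// mulr_natl mulr2n lerD//=.
  rewrite (le_trans (le_normr_Rintegral _ a))// le_Rintegral//.
    exact: (integrable_norm a).
  by move=> x _; exact: le_Re.
rewrite (le_trans (le_normr_Rintegral _ b))// le_Rintegral//.
  exact: (integrable_norm b).
by move=> x _; exact: le_Im.
Qed.

Lemma Rint_dct mu (f : nat -> T -> R) g : (forall k, measurable_fun setT (f k)) ->
  (forall x, (fun k => f k x) @ \oo --> (0 : R)) -> (forall k x, `|f k x| <= g x) ->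
  intR mu g -> (fun k => \int[mu]_x f k x) @ \oo --> (0 : R).
Proof.
move=> mf f0 fg ig.
have [] := @dominated_convergence _ _ _ mu setT measurableT (fun k => EFin \o f k)
  (cst 0%E) (EFin \o g).
- by move=> k; exact/measurable_EFinP.
- exact: measurable_cst.
- by apply: aeW => x _; apply: cvg_EFin; [exact: nearW|exact: f0].
- exact: ig.
- by apply: aeW => x k _ /=; rewrite lee_fin.
move=> _ _; rewrite integral0 => /fine_cvg; exact.
Qed.

Lemma cint_dct mu (F : nat -> T -> Cplx R) G g : (forall k, cmeas (F k)) -> cmeas G ->
  (forall x, ccvg (fun k => F k x) (G x)) -> (forall k x, nm (F k x) <= g x) ->
  intR mu g -> ccvg (fun k => cint mu (F k)) (cint mu G).
Proof.
move=> mF mG FG Fg ig.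
have Gg x : nm (G x) <= g x by apply: (ccvg_nm_le (FG x)) => k; exact: Fg.
have iF k := cintble_dom (mF k) (Fg k) ig.
have iG := cintble_dom mG Gg ig.
have H : (fun k => \int[mu]_x nm (F k x - G x)) @ \oo --> (0 : R).
  apply: (@Rint_dct mu (fun k x => nm (F k x - G x)) (fun x => 2 * g x)) => //.
  - by move=> k; apply: cmeas_nm; exact: cmeasB.
  - move=> k x; rewrite ger0_norm ?nm_ge0// (le_trans (nmD _ _))// nmN mulr_natl mulr2n.
    by rewrite lerD.
  - exact: intR_Z.
apply: (@ccvg_squeeze _ _ _ (fun k => 2 * \int[mu]_x nm (F k x - G x))).
  by move=> k; rewrite -cintB// nm_cint//; exact: cintbleB.
by rewrite -(mulr0 2); apply: cvgM => //; exact: cvg_cst.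
Qed.

Lemma cint_cst mu c : mu setT = 1%E -> cint mu (fun=> c) = c.
Proof.
by move=> m1; apply: cplx_eq => /=; rewrite Rintegral_cst// m1 mulr1.
Qed.
End cint.

Section cint2.
Context {R : realType} d1 d2 {T1 : measurableType d1} {T2 : measurableType d2}.

Lemma cmeas_comp (F : T2 -> Cplx R) (h : T1 -> T2) : cmeas F -> measurable_fun setT h ->
  cmeas (fun x => F (h x)).
Proof. by move=> [a b] mh; split; [exact: (measurableT_comp a mh)|exact: (measurableT_comp b mh)]. Qed.

Lemma cint_pushforward (mu : {measure set T1 -> \bar R}) (nu : {measure set T2 -> \bar R})
  (h : T1 -> T2) (F : T2 -> Cplx R) : measurable_fun setT h ->
  (forall A, measurable A -> nu A = mu (h @^-1` A)) -> cmeas F -> cintble mu (fun x => F (h x)) ->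
  cint nu F = cint mu (fun x => F (h x)).
Proof.
move=> mh hnu [mr mi] [a b].
have E (f : T2 -> R) : measurable_fun setT f -> intR mu (fun x => f (h x)) ->
    \int[nu]_x f x = \int[mu]_x f (h x).
  move=> mf iff; rewrite /Rintegral; congr fine.
  rewrite (eq_measure_integral (pushforward mu h)); last by move=> A mA _; exact: hnu.
  rewrite integral_pushforward//; exact/measurable_EFinP.
by apply: cplx_eq => /=; rewrite E.
Qed.

Lemma cintble_pushforward (mu : {measure set T1 -> \bar R}) (nu : {measure set T2 -> \bar R})
  (h : T1 -> T2) (F : T2 -> Cplx R) : measurable_fun setT h ->
  (forall A, measurable A -> nu A = mu (h @^-1` A)) -> cintble nu F ->
  cintble mu (fun x => F (h x)).
Proof.
move=> mh hnu iF; have mF := cintble_meas iF; case: (iF) => a b.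
have E (f : T2 -> R) : intR nu f -> intR mu (fun x => f (h x)).
  move=> iff; have mf := intR_meas iff; apply/integrableP; split.
    by apply/measurable_EFinP; exact: (measurableT_comp mf mh).
  case/integrableP : iff => _.
  rewrite (eq_measure_integral (pushforward mu h)); last by move=> A mA _; exact: hnu.
  rewrite ge0_integral_pushforward//.
  by apply: measurableT_comp => //; exact/measurable_EFinP.
by split; [exact: (E _ a)|exact: (E _ b)].
Qed.

End cint2.

Section cfubini.
Context {R : realType} d1 d2 {T1 : measurableType d1} {T2 : measurableType d2}.
Variables (m1 : {sigma_finite_measure set T1 -> \bar R})
          (m2 : {sigma_finite_measure set T2 -> \bar R}).

Lemma intR_prod (g1 : T1 -> R) (g2 : T2 -> R) : (forall x, 0 <= g1 x) -> (forall x, 0 <= g2 x) ->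
  intR m1 g1 -> intR m2 g2 -> intR (m1 \x m2)%E (fun p => g1 p.1 * g2 p.2).
Proof.
move=> p1 p2 i1 i2.
have mg1 := intR_meas i1; have mg2 := intR_meas i2.
have mg : measurable_fun setT (fun p : T1 * T2 => g1 p.1 * g2 p.2).
  by apply: measurable_funM; [exact: (measurableT_comp mg1 measurable_fst)|
    exact: (measurableT_comp mg2 measurable_snd)].
apply/integrableP; split; first exact/measurable_EFinP.
under eq_integral do rewrite /= ger0_norm ?mulr_ge0//.
rewrite fubini_tonelli1//=; last 2 first.
- by apply/measurable_EFinP.
- by move=> x; rewrite lee_fin mulr_ge0.
rewrite /fubini_F /=.
case/integrableP : i2 => _ /=; under eq_integral do rewrite ger0_norm//.
case/integrableP : i1 => _ /=; under eq_integral do rewrite ger0_norm//.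
move=> l1 l2.
under eq_integral do under eq_integral do rewrite EFinM.
under eq_integral => x _.
  rewrite ge0_integralZl//; [|exact/measurable_EFinP|by move=> y _; rewrite lee_fin|by rewrite lee_fin].
  over.
rewrite ge0_integralZr//; [|exact/measurable_EFinP|by move=> y _; rewrite lee_fin|]; last first.
  by apply: integral_ge0 => y _; rewrite lee_fin.
apply: lte_mul_pinfty => //.
  by apply: integral_ge0 => y _; rewrite lee_fin.
by rewrite ge0_fin_numE//; apply: integral_ge0 => y _; rewrite lee_fin.
Qed.

(** The sections are assumed integrable at every point, so that each inner [Rintegral] is a true
    integral and never the default value of [fine]; no exceptional null set has to be carried
    along. *)
Lemma Rfubini (f : T1 * T2 -> R) : intR (m1 \x m2)%E f ->
  (forall x, intR m2 (fun y => f (x, y))) -> (forall y, intR m1 (fun x => f (x, y))) ->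
  [/\ intR m1 (fun x => \int[m2]_y f (x, y)),
      \int[m1]_x \int[m2]_y f (x, y) = \int[(m1 \x m2)%E]_p f p &
      \int[m1]_x \int[m2]_y f (x, y) = \int[m2]_y \int[m1]_x f (x, y)].
Proof.
move=> iF i1 i2.
have E1 x : (\int[m2]_y f (x, y))%:E = (\int[m2]_y (f (x, y))%:E)%E.
  by rewrite /Rintegral fineK//; apply: integrable_fin_num => //; exact: i1.
have E2 y : (\int[m1]_x f (x, y))%:E = (\int[m1]_x (f (x, y))%:E)%E.
  by rewrite /Rintegral fineK//; apply: integrable_fin_num => //; exact: i2.
split.
- rewrite /intR /comp/=; under eq_fun do rewrite E1.
  exact: (integrable_fubini_F iF).
- rewrite [LHS]/Rintegral; under eq_integral do rewrite E1.
  by rewrite (integral12_prod_meas1 iF).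
- rewrite [LHS]/Rintegral [RHS]/Rintegral.
  under eq_integral do rewrite E1.
  under [in RHS]eq_integral do rewrite E2.
  by congr fine; exact: (Fubini iF).
Qed.

Lemma cfubini (F : T1 * T2 -> Cplx R) (g : T1 * T2 -> R) : cmeas F ->
  (forall p, nm (F p) <= g p) -> intR (m1 \x m2)%E g ->
  (forall x, intR m2 (fun y => g (x, y))) -> (forall y, intR m1 (fun x => g (x, y))) ->
  cintble m1 (fun x => cint m2 (fun y => F (x, y))) /\
  cint m1 (fun x => cint m2 (fun y => F (x, y))) =
  cint m2 (fun y => cint m1 (fun x => F (x, y))).
Proof.
move=> mF Fg ig i1 i2.
have [a b] := cintble_dom mF Fg ig.
have I1 x : cintble m2 (fun y => F (x, y)).
  by apply: (cintble_dom _ _ (i1 x)) => //; exact: (cmeas_comp mF (pair1_measurable x)).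
have I2 y : cintble m1 (fun x => F (x, y)).
  by apply: (cintble_dom _ _ (i2 y)) => //; exact: (cmeas_comp mF (pair2_measurable y)).
have [p1 p2 p3] := Rfubini a (fun x => (I1 x).1) (fun x => (I2 x).1).
have [q1 q2 q3] := Rfubini b (fun x => (I1 x).2) (fun x => (I2 x).2).
by split; [split|apply: cplx_eq].
Qed.
End cfubini.

(** * Densities and measure preserving maps *)

Section density.
Local Open Scope ereal_scope.
Context d (T : measurableType d) (R : realType).
Variables (mu nu : {measure set T -> \bar R}) (rho : T -> R).
Hypotheses (mrho : measurable_fun setT rho) (rho0 : forall x, (0 <= rho x)%R)
  (nuE : forall A, measurable A -> nu A = \int[mu]_(x in A) (rho x)%:E).

Let density_indic E : measurable E ->
  \int[nu]_x (\1_E x)%:E = \int[mu]_x ((\1_E x)%:E * (rho x)%:E).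
Proof.
move=> mE; rewrite integral_indic// setIT nuE// integral_mkcond.
apply: eq_integral => x _; rewrite patchE indicE.
by case: ifPn => _; rewrite ?mul1e ?mul0e.
Qed.

Import HBNNSimple.

Let density_nnsfun (f : {nnsfun T >-> R}) :
  \int[nu]_x (f x)%:E = \int[mu]_x ((f x)%:E * (rho x)%:E).
Proof.
under [LHS]eq_integral do rewrite fimfunE -fsumEFin//.
rewrite [LHS]ge0_integral_fsum//; last 2 first.
  - by move=> r; exact/measurable_EFinP/measurableT_comp.
  - by move=> n x _; rewrite EFinM nnfun_muleindic_ge0.
under [RHS]eq_integral.
  move=> x xD; rewrite fimfunE -fsumEFin// ge0_mule_fsuml; last first.
    by move=> r; rewrite EFinM nnfun_muleindic_ge0.
  over.
rewrite [RHS]ge0_integral_fsum//; last 2 first.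
  - move=> r; apply: emeasurable_funM; last exact/measurable_EFinP.
    exact/measurable_EFinP/measurableT_comp.
  - move=> n x _; rewrite EFinM mule_ge0//; last by rewrite lee_fin.
    by rewrite nnfun_muleindic_ge0.
apply: eq_fsbigr => r _.
under eq_integral do rewrite EFinM.
under [RHS]eq_integral do rewrite EFinM -muleA.
rewrite integralZl_indic_nnsfun//= density_indic//.
have [r0|r0] := leP 0%R r.
  rewrite ge0_integralZl//.
  - apply: emeasurable_funM; last exact/measurable_EFinP.
    exact/measurable_EFinP.
  - by move=> x _; rewrite -EFinM lee_fin mulr_ge0.
(* A negative [r] is not a value of the nonnegative [f], so its level set is empty. *)
have -> : \1_(f @^-1` [set r]) = (cst 0%R : T -> R).
  rewrite (_ : f @^-1` [set r] = set0) ?indic0//.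
  apply/seteqP; split=> // x /= fxr.
  by move: r0; rewrite -fxr ltNge fun_ge0.
rewrite /=; under eq_integral do rewrite mul0e.
by under [RHS]eq_integral do rewrite mul0e mule0; rewrite integral0 mule0.
Qed.

(** Indicators are the hypothesis [nuE], simple functions follow by linearity, and nonnegative
    functions by monotone convergence. *)
Lemma ge0_integral_density (f : T -> \bar R) : measurable_fun setT f ->
  (forall x, 0 <= f x) -> \int[nu]_x f x = \int[mu]_x (f x * (rho x)%:E).
Proof.
move=> mf f0.
pose f_ := nnsfun_approx measurableT mf.
transitivity (lim (\int[nu]_x (f_ n x)%:E @[n --> \oo])).
  rewrite -monotone_convergence//=.
  - apply: eq_integral => ? /[!inE] xD; apply/esym/cvg_lim => //=.
    exact: cvg_nnsfun_approx.
  - by move=> n; exact/measurable_EFinP/measurable_funTS.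
  - by move=> n ? _; rewrite lee_fin.
  - by move=> ? _ ? ? mn; rewrite lee_fin; exact/lefP/nd_nnsfun_approx.
under eq_fun do rewrite density_nnsfun.
rewrite -monotone_convergence//=.
- apply: eq_integral => x /[!inE] xD; apply/cvg_lim => //=.
  by apply: cvgeZr => //; exact: cvg_nnsfun_approx.
- move=> n; apply: emeasurable_funM; exact/measurable_EFinP.
- by move=> n x _; rewrite -EFinM lee_fin mulr_ge0.
- move=> x _ ? ? mn; rewrite lee_wpmul2r ?lee_fin//; exact/lefP/nd_nnsfun_approx.
Qed.

Lemma intR_density (f : T -> R) : measurable_fun setT f ->
  intR nu f <-> intR mu (fun x => f x * rho x)%R.
Proof.
move=> mf.
have mfr : measurable_fun setT (fun x => f x * rho x)%R by exact: measurable_funM.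
have E : \int[nu]_x `|(f x)%:E| = \int[mu]_x `|(f x * rho x)%:E|.
  rewrite ge0_integral_density//; last first.
    by apply/measurable_EFinP; exact: measurableT_comp.
  by apply: eq_integral => x _; rewrite EFinM abseM (gee0_abs (x := (rho x)%:E))// lee_fin.
split=> /integrableP[_ H]; apply/integrableP; split.
- exact/measurable_EFinP.
- by rewrite -E.
- exact/measurable_EFinP.
- by rewrite /comp E.
Qed.

Lemma Rint_density (f : T -> R) : intR nu f ->
  (\int[nu]_x f x = \int[mu]_x (f x * rho x))%R.
Proof.
move=> iff; have mf := intR_meas iff; rewrite /Rintegral; congr fine.
rewrite integralE [RHS]integralE; congr (_ - _).
  rewrite ge0_integral_density//; last first.
    by apply: measurable_funepos; exact/measurable_EFinP.
  apply: eq_integral => x _; rewrite !funeposE EFinM.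
  by rewrite maxe_pMl ?lee_fin// mul0e.
rewrite ge0_integral_density//; last first.
  by apply: measurable_funeneg; exact/measurable_EFinP.
apply: eq_integral => x _; rewrite !funenegE EFinM.
by rewrite maxe_pMl ?lee_fin// mul0e mulNe.
Qed.
End density.

(** * Maps preserving Lebesgue measure on the line and the plane *)

Section mpres.
Context (R : realType).

Definition mpres d (T : measurableType d) (mu : {measure set T -> \bar R}) (h : T -> T) :=
  measurable_fun setT h /\ forall A, measurable A -> mu (h @^-1` A) = mu A.

Lemma mpres_comp d (T : measurableType d) (mu : {measure set T -> \bar R}) g h :
  mpres mu g -> mpres mu h -> mpres mu (g \o h).
Proof.
move=> [mg g1] [mh h1]; split; first exact: (measurableT_comp mg mh).
move=> A mA; rewrite comp_preimage h1 ?g1//.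
by rewrite -[X in measurable X]setTI; exact: mg.
Qed.

(** The section at x of the preimage is the preimage under [h] of the section at [g x]; the
    invariance of [m2] removes [h], and that of [m1] then removes [g]. *)
Lemma mpres_prod d1 d2 (T1 : measurableType d1) (T2 : measurableType d2)
  (m1 : {sigma_finite_measure set T1 -> \bar R}) (m2 : {sigma_finite_measure set T2 -> \bar R})
  g h : mpres m1 g -> mpres m2 h -> mpres (m1 \x m2)%E (fun p => (g p.1, h p.2)).
Proof.
move=> [mg g1] [mh h1].
have mgh : measurable_fun setT (fun p : T1 * T2 => (g p.1, h p.2)).
  apply: measurable_fun_pair.
    exact: (measurableT_comp mg measurable_fst).
  exact: (measurableT_comp mh measurable_snd).
split=> // A mA; rewrite /product_measure1 /=.
transitivity (\int[m1]_x (m2 \o xsection A) (g x))%E.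
  apply: eq_integral => x _ /=; rewrite -[RHS]h1; last exact: measurable_xsection.
  by congr (m2 _); apply/seteqP; split=> y /=; rewrite !xsectionE.
have mA' := @measurable_fun_xsection _ _ _ _ _ m2 _ mA.
rewrite -[LHS](@ge0_integral_pushforward _ _ _ _ _ g mg m1 setT (m2 \o xsection A))//.
by apply: eq_measure_integral => B mB _; exact: g1.
Qed.

(** The image measure has the right values on half-open intervals, which characterise Lebesgue
    measure. *)
Lemma mpres_shift (c : R) : mpres (@lebesgue_measure R) (fun x => x + c).
Proof.
have mc : measurable_fun setT (fun x : measurableTypeR R => (x + c : measurableTypeR R)).
  by apply: measurable_funD.
split=> // A mA.
pose mu' : {measure set (measurableTypeR R) -> \bar R} :=
  measure_function_pushforward__canonical__measure_function_Measure
    (@lebesgue_measure R) mc.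
rewrite -[LHS]/(mu' A); apply/esym/lebesgue_measure_unique => //.
move=> _ [[a b]] _ <-; rewrite /mu' /= /pushforward.
rewrite (_ : _ @^-1` _ = [set` `]a - c, b - c]]); last first.
  by apply/seteqP; split=> x /=; rewrite !in_itv/= ltrBlDr lerBrDr.
rewrite !lebesgue_measure_itv/= !lte_fin ltrD2r; case: ifPn => // _.
by rewrite -!EFinD; congr EFin; lra.
Qed.

(** On each vertical line the shear is a translation. *)
Lemma mpres_sheary (s : R) :
  mpres (@lebesgue_plane R) (fun p : plane R => (p.1, p.2 + s * p.1) : plane R).
Proof.
have ms : measurable_fun setT (fun p : plane R => (p.1, p.2 + s * p.1) : plane R).
  apply: measurable_fun_pair; first exact: measurable_fst.
  apply: measurable_funD; first exact: measurable_snd.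
  by apply: measurable_funM => //; exact: measurable_fst.
split=> // A mA; rewrite /lebesgue_plane /product_measure1 /=.
apply: eq_integral => x _ /=.
rewrite -[RHS](mpres_shift (s * x)).2; last exact: measurable_xsection.
by congr (lebesgue_measure _); apply/seteqP; split=> y /=; rewrite !xsectionE.
Qed.

Lemma mpres_shearx (s : R) :
  mpres (@lebesgue_plane R) (fun p : plane R => (p.1 + s * p.2, p.2) : plane R).
Proof.
have ms : measurable_fun setT (fun p : plane R => (p.1 + s * p.2, p.2) : plane R).
  apply: measurable_fun_pair; last exact: measurable_snd.
  apply: measurable_funD; first exact: measurable_fst.
  by apply: measurable_funM => //; exact: measurable_snd.
(* This shear translates horizontal lines, so the product measure is computed from horizontal
   sections. *)
have E A : measurable A -> @lebesgue_plane R A =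
    (lebesgue_measure \x^ lebesgue_measure)%E A.
  move=> mA; rewrite /lebesgue_plane.
  by apply: product_measure_unique => // B C mB mC; exact: product_measure2E.
split=> // A mA; apply: (eq_trans (E _ _)).
  by rewrite -[X in measurable X]setTI; exact: ms.
apply: (eq_trans _ (esym (E _ mA))).
rewrite /product_measure2 /=.
apply: eq_integral => y _ /=.
rewrite -[RHS](mpres_shift (s * y)).2; last exact: measurable_ysection.
by congr (lebesgue_measure _); apply/seteqP; split=> x /=; rewrite !ysectionE.
Qed.

(* a rotation other than the half turn is a product of three shears *)
Lemma mpres_rot (c s : R) : c ^+ 2 + s ^+ 2 = 1 ->
  mpres (@lebesgue_plane R)
    (fun p : plane R => (c * p.1 - s * p.2, s * p.1 + c * p.2) : plane R).
Proof.
have rot c' s' : c' ^+ 2 + s' ^+ 2 = 1 -> 1 + c' != 0 -> mpres (@lebesgue_plane R)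
    (fun p : plane R => (c' * p.1 - s' * p.2, s' * p.1 + c' * p.2) : plane R).
  (* [t] is the tangent of half the angle; the shears along x, y, x have the parameters [- t], [s'],
     [- t]. *)
  move=> cs c1; pose t := s' / (1 + c').
  have h := mpres_comp (mpres_shearx (- t)) (mpres_comp (mpres_sheary s') (mpres_shearx (- t))).
  rewrite [X in mpres _ X](_ : _ = (fun p : plane R => (p.1 + - t * p.2, p.2) : plane R) \o
    ((fun p : plane R => (p.1, p.2 + s' * p.1) : plane R) \o
     (fun p : plane R => (p.1 + - t * p.2, p.2) : plane R)))//.
  apply/funext => -[x y] /=.
  have ts : t * s' = 1 - c'.
    rewrite /t mulrAC -expr2 (_ : s' ^+ 2 = (1 - c') * (1 + c')); last first.
      by rewrite -(addKr (c' ^+ 2) (s' ^+ 2)) cs; ring.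
    by rewrite mulfK.
  have tc : t + t * c' = s' by rewrite -{1}[t]mulr1 -mulrDr /t mulfVK.
  have E2 : y + s' * (x + - t * y) = s' * x + c' * y.
    rewrite (_ : y + s' * (x + - t * y) = s' * x + y - (t * s') * y); last by ring.
    by rewrite ts; ring.
  rewrite E2; congr (_, _).
  rewrite (_ : x + - t * y + - t * (s' * x + c' * y) = x - (t * s') * x - (t + t * c') * y);
    last by ring.
  by rewrite ts tc; ring.
move=> cs; have [c1|c1] := eqVneq (1 + c) 0; last exact: rot.
(* The half turn is the square of the quarter turn, to which [rot] applies. *)
have r1 : mpres (@lebesgue_plane R)
    (fun p : plane R => (0 * p.1 - 1 * p.2, 1 * p.1 + 0 * p.2) : plane R).
  by apply: rot; rewrite ?addr0 ?oner_neq0//; ring.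
have h := mpres_comp r1 r1.
have cE : c = -1 by lra.
have s0 : s = 0.
  by apply/eqP; rewrite -sqrf_eq0; apply/eqP; move: cs; rewrite cE; lra.
set f := (X in mpres _ X); rewrite (_ : f = (fun p : plane R => (0 * p.1 - 1 * p.2, 1 * p.1 + 0 * p.2) : plane R) \o
   (fun p : plane R => (0 * p.1 - 1 * p.2, 1 * p.1 + 0 * p.2) : plane R))//.
by apply/funext => -[x y]; rewrite /f cE s0 /=; congr (_, _); ring.
Qed.

Lemma mpres_translate (a b : R) :
  mpres (@lebesgue_plane R) (fun p : plane R => (p.1 + a, p.2 + b) : plane R).
Proof. exact: (mpres_prod (mpres_shift a) (mpres_shift b)). Qed.

End mpres.

Section Cn_measure.
Context {R : realType} {n : nat}.
Implicit Types (z w : Cn R n).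

Lemma measurable_Cn d (T : measurableType d) (H : T -> Cn R n) :
  (forall k, cmeas (fun x => H x ord0 k)) -> measurable_fun setT H.
Proof.
move=> mH _ A [B mB <-]; rewrite setTI.
have mc : measurable_fun setT (fun x => Cn_coords (H x)).
  apply/measurable_fun_tnthP => k.
  rewrite (_ : _ \o _ = (fun x => (Re (H x ord0 k), Im (H x ord0 k)) : plane R)); last first.
    by apply/funext => x /=; rewrite tnth_mktuple.
  by apply: measurable_fun_pair; have [] := mH k.
have := mc measurableT B mB; rewrite setTI.
by congr (measurable _); rewrite setTI.
Qed.

Lemma cmeas_coord (k : 'I_n) : cmeas (fun w : Cn R n => w ord0 k).
Proof.
have mk : measurable_fun setT (fun z : Cn R n => tnth (Cn_coords z) k).
  apply: (measurableT_comp (measurable_tnth k)).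
  exact: measurable_Cn_coords.
split.
  have := measurableT_comp measurable_fst mk.
  by congr measurable_fun; apply/funext => z /=; rewrite tnth_mktuple.
have := measurableT_comp measurable_snd mk.
by congr measurable_fun; apply/funext => z /=; rewrite tnth_mktuple.
Qed.

Lemma leb_CnE A : @lebesgue_Cn R n A =
  measure_power (@lebesgue_plane R) n (@coords_Cn R n @^-1` A).
Proof. by []. Qed.

End Cn_measure.

Section power_maps.
Context d (T : measurableType d) (R : realType).
Variable m : {sigma_finite_measure set T -> \bar R}.

Lemma mpres_power n (h : 'I_n -> T -> T) : (forall i, mpres m (h i)) ->
  mpres (measure_power m n) (fun t => [tuple h i (tnth t i) | i < n]).
Proof.
elim: n h => [|n IH] h mh.
  split.
    by apply/measurable_fun_tnthP => -[].
  move=> A mA; congr (measure_power m 0 _); apply/seteqP.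
  by split=> t /=; rewrite (tuple0 t) (tuple0 [tuple h i _ | i < 0]).
split.
  apply/measurable_fun_tnthP => i.
  rewrite (_ : _ \o _ = (fun t => h i (tnth t i))); last first.
    by apply/funext => t /=; rewrite tnth_mktuple.
  exact: (measurableT_comp (mh i).1 (measurable_tnth i)).
move=> A mA.
have mA' : measurable (@tcons _ T n @^-1` A).
  by rewrite -[X in measurable X]setTI; exact: measurable_tcons.
rewrite -[RHS](mpres_prod (mh ord0) (IH _ (fun i => mh (lift ord0 i)))).2//.
congr ((m \x measure_power m n)%E _).
apply/seteqP; split=> -[x t] /=; congr (A _); apply: eq_from_tnth => i; rewrite tnth_mktuple.
  by case: (unliftP ord0 i) => [j ->|->]; rewrite ?tnthS ?tnth0 ?tnth_mktuple.
by case: (unliftP ord0 i) => [j ->|->]; rewrite ?tnthS ?tnth0 ?tnth_mktuple.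
Qed.

Lemma measure_power_box n (B : 'I_n -> set T) : (forall i, measurable (B i)) ->
  measure_power m n [set t | forall i, B i (tnth t i)] = (\prod_(i < n) m (B i))%E.
Proof.
elim: n B => [|n IH] B mB.
  by rewrite big_ord0 /= diracE mem_set//= => -[].
rewrite big_ord_recl -(IH (fun i => B (lift ord0 i)))//.
rewrite -[RHS](@product_measure1E _ _ _ _ _ m (measure_power m n))//; last first.
  rewrite [X in measurable X](_ : _ = \bigcap_(i in [set: 'I_n])
     (setT `&` (@tnth n T ^~ i @^-1` B (lift ord0 i)))); last first.
    apply/seteqP; split=> [t /= H i _|t H i]; first by split=> //; exact: H.
    by have [] := H i I.
  apply: fin_bigcap_measurable => [|i _]; first exact: finite_finset.
  exact: measurable_tnth.
congr ((m \x measure_power m n)%E _).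
apply/seteqP; split=> -[x t] /=.
  move=> H; split; first by have := H ord0; rewrite tnth0.
  by move=> i; have := H (lift ord0 i); rewrite tnthS.
by move=> [H0 H] i; case: (unliftP ord0 i) => [j ->|->]; rewrite ?tnthS ?tnth0//.
Qed.

Lemma integral_power_prod n (r : T -> R) : measurable_fun setT r -> (forall x, 0 <= r x) ->
  (\int[measure_power m n]_t (\prod_(i < n) r (tnth t i))%:E =
   (\int[m]_x (r x)%:E) ^+ n)%E.
Proof.
move=> mr r0; elim: n => [|n IH].
  rewrite expe0 /=; under eq_integral do rewrite big_ord0.
  by rewrite integral_dirac// diracT mul1e.
have mp k : measurable_fun setT (fun t : k.-tuple T => \prod_(i < k) r (tnth t i)).
  apply: measurable_prod => i _; exact: (measurableT_comp mr (measurable_tnth i)).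
rewrite [RHS]expeS.
rewrite -[LHS]/((\int[pushforward (m \x measure_power m n)%E (@tcons _ T n)]_t
  (\prod_(i < n.+1) r (tnth t i))%:E)%E).
rewrite ge0_integral_pushforward//; first last.
- by move=> t _; rewrite lee_fin prodr_ge0.
- by apply/measurable_EFinP; exact: mp.
- exact: (@measurable_tcons _ T n).
rewrite preimage_setT.
under eq_integral => p _.
  rewrite /= big_ord_recl tnth0.
  under eq_bigr do rewrite tnthS.
  over.
rewrite fubini_tonelli1/=; first last.
- by move=> p; rewrite lee_fin mulr_ge0// prodr_ge0.
- apply/measurable_EFinP; apply: measurable_funM.
    exact: (measurableT_comp mr measurable_fst).
  exact: (measurableT_comp (mp n) measurable_snd).
rewrite /fubini_F /=.
under eq_integral => x _.
  under eq_integral do rewrite EFinM.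
  rewrite ge0_integralZl//; first last.
  - by rewrite lee_fin.
  - by move=> t _; rewrite lee_fin prodr_ge0.
  - by apply/measurable_EFinP; exact: mp.
  over.
rewrite /= IH ge0_integralZr//; first last.
- by rewrite expe_ge0// integral_ge0// => x _; rewrite lee_fin.
- by move=> t _; rewrite lee_fin.
- exact/measurable_EFinP.
Qed.

End power_maps.

(** * The Gaussian measure *)

Section dotc_algebra.
Context {R : realType} {n : nat}.
Implicit Types (z w a b : Cn R n) (x : Cplx R).

Lemma conjvE z k : conjv z ord0 k = conjc (z ord0 k).
Proof. by rewrite mxE. Qed.
Lemma conjvK z : conjv (conjv z) = z.
Proof. by apply/rowP => k; rewrite !conjvE conjK. Qed.
Lemma conjvD z w : conjv (z + w) = conjv z + conjv w.
Proof. by apply/rowP => k; rewrite !mxE conjD. Qed.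
Lemma conjvN z : conjv (- z) = - conjv z.
Proof. by apply/rowP => k; rewrite !mxE conjN. Qed.
Lemma conjvZ x z : conjv (x *: z) = (conjc x : Cplx R) *: conjv z.
Proof. by apply/rowP => k; rewrite !mxE conjM. Qed.
Lemma dotcC z w : dotc z w = dotc w z.
Proof. by apply: eq_bigr => k _; rewrite mulrC. Qed.
Lemma dotcDl z w a : dotc (z + w) a = dotc z a + dotc w a.
Proof. by rewrite /dotc -big_split; apply: eq_bigr => k _; rewrite /= mxE mulrDl. Qed.
Lemma dotcDr z w a : dotc a (z + w) = dotc a z + dotc a w.
Proof. by rewrite dotcC dotcDl !(dotcC a). Qed.
Lemma dotcZl x z a : dotc (x *: z) a = x * dotc z a.
Proof. by rewrite /dotc mulr_sumr; apply: eq_bigr => k _; rewrite mxE mulrA. Qed.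
Lemma dotcZr x z a : dotc a (x *: z) = x * dotc a z.
Proof. by rewrite dotcC dotcZl (dotcC a). Qed.
Lemma dotcNl z a : dotc (- z) a = - dotc z a.
Proof. by rewrite -scaleN1r dotcZl mulN1r. Qed.
Lemma dotcNr z a : dotc a (- z) = - dotc a z.
Proof. by rewrite dotcC dotcNl (dotcC a). Qed.
Lemma dotc0r a : dotc a 0 = 0.
Proof. by rewrite /dotc big1// => k _; rewrite mxE mulr0. Qed.
Lemma dotc0l a : dotc 0 a = 0.
Proof. by rewrite dotcC dotc0r. Qed.
Lemma conj_dotc z w : conjc (dotc z w) = dotc (conjv z) (conjv w).
Proof. by rewrite /dotc conj_sum; apply: eq_bigr => k _; rewrite conjM !conjvE. Qed.

Lemma sqnorm_sum z : sqnorm z = \sum_k nm (z ord0 k) ^+ 2.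
Proof.
rewrite /sqnorm /dotc Re_sum; apply: eq_bigr => k _.
by rewrite conjvE nm_sq !cplxE; ring.
Qed.
Lemma sqnorm_ge0 z : 0 <= sqnorm z.
Proof. by rewrite sqnorm_sum sumr_ge0// => k _; rewrite sqr_ge0. Qed.
Lemma dotcJ z : dotc z (conjv z) = (sqnorm z)%:C :> Cplx R.
Proof.
apply: cplx_eq => //=; rewrite /dotc Im_sum big1// => k _.
by rewrite conjvE !cplxE; ring.
Qed.
Lemma Re_dotcC z w : Re (dotc z (conjv w)) = Re (dotc w (conjv z)).
Proof. by rewrite -Re_conjc conj_dotc conjvK dotcC. Qed.
Lemma sqnormD z w : sqnorm (z + w) = sqnorm z + sqnorm w + 2 * Re (dotc z (conjv w)).
Proof.
rewrite /sqnorm conjvD !dotcDl !dotcDr !ReD (Re_dotcC w z); ring.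
Qed.
Lemma sqnormZ x z : sqnorm (x *: z) = nm x ^+ 2 * sqnorm z.
Proof.
by rewrite !sqnorm_sum mulr_sumr; apply: eq_bigr => k _; rewrite mxE nmM exprMn.
Qed.
Lemma sqnormN z : sqnorm (- z) = sqnorm z.
Proof. by rewrite -scaleN1r sqnormZ nmN nm1 expr1n mul1r. Qed.
Lemma sqnormJ z : sqnorm (conjv z) = sqnorm z.
Proof. by rewrite !sqnorm_sum; apply: eq_bigr => k _; rewrite conjvE nmJ. Qed.

(** Young's inequality, from expanding the square norm of - t z + conj w. The weight [t] decides how
    the growth of the kernel is shared between its two variables. *)
Lemma Re_dotc_le (t : R) z w : 0 < t -> 2 * Re (dotc z w) <= t * sqnorm z + t^-1 * sqnorm w.
Proof.
move=> t0; have := sqnorm_ge0 (((- t)%:C : Cplx R) *: z + conjv w).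
rewrite sqnormD sqnormZ nmR normrN gtr0_norm// conjvK sqnormJ dotcZl ReM /=.
rewrite mul0r subr0 => H.
rewrite -(ler_pM2l t0) (mulrDr t) !mulrA divff ?gt_eqF// mul1r -expr2.
have -> : t * 2 * Re (dotc z w) = - (2 * (- t * Re (dotc z w))) by ring.
lra.
Qed.

Lemma sqnormD_le z w : sqnorm (z + w) <= 2 * sqnorm z + 2 * sqnorm w.
Proof.
rewrite sqnormD; have := @Re_dotc_le 1 z (conjv w) ltr01.
by rewrite invr1 !mul1r sqnormJ; lra.
Qed.
Lemma sqnormB_le z w : sqnorm (z - w) <= 2 * sqnorm z + 2 * sqnorm w.
Proof. by rewrite -(sqnormN w) sqnormD_le. Qed.
End dotc_algebra.

Section measurable_dotc.
Context {R : realType} {n : nat} d (T : measurableType d).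

Lemma cmeas_dotc (a b : T -> Cn R n) : (forall k, cmeas (fun x => a x ord0 k)) ->
  (forall k, cmeas (fun x => b x ord0 k)) -> cmeas (fun x => dotc (a x) (b x)).
Proof. by move=> ma mb; apply: cmeas_sum => k; exact: cmeasM. Qed.

Lemma cmeas_conjv (a : T -> Cn R n) k : cmeas (fun x => a x ord0 k) ->
  cmeas (fun x => conjv (a x) ord0 k).
Proof. by move=> ma; under eq_fun do rewrite conjvE; exact: cmeas_conj. Qed.
End measurable_dotc.

Section gauss_measure.
Context {R : realType} {n : nat}.
Implicit Types (z w : Cn R n).

Lemma mpres_Cn (H : Cn R n -> Cn R n) (h : 'I_n -> plane R -> plane R) :
  measurable_fun setT H ->
  (forall k, mpres (@lebesgue_plane R) (h k)) ->
  (forall t, H (coords_Cn t) = coords_Cn [tuple h i (tnth t i) | i < n]) ->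
  mpres (@lebesgue_Cn R n) H.
Proof.
move=> mH mh Hh; split=> // A mA.
apply: (eq_trans (leb_CnE _)); apply: (eq_trans _ (esym (leb_CnE _))).
rewrite -[RHS](mpres_power mh).2; last first.
  by rewrite -[X in measurable X]setTI; exact: measurable_coords_Cn.
by congr (measure_power _ _ _); apply/seteqP; split=> t /=; rewrite Hh.
Qed.

Lemma measurable_scale (e : Cplx R) : measurable_fun setT (fun w : Cn R n => e *: w).
Proof.
apply: measurable_Cn => k; under eq_fun do rewrite mxE.
by apply: cmeasM; [exact: cmeas_cst|exact: cmeas_coord].
Qed.

Lemma measurable_shift (z : Cn R n) : measurable_fun setT (fun w : Cn R n => w + z).
Proof.
apply: measurable_Cn => k; under eq_fun do rewrite mxE.
by apply: cmeasD; [exact: cmeas_coord|exact: cmeas_cst].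
Qed.

Lemma mpres_leb_scale (e : Cplx R) : nm e = 1 ->
  mpres (@lebesgue_Cn R n) (fun w => e *: w).
Proof.
move=> e1.
have cs : Re e ^+ 2 + Im e ^+ 2 = 1 by rewrite -nm_sq e1 expr1n.
apply: (@mpres_Cn _ (fun _ p => (Re e * p.1 - Im e * p.2, Im e * p.1 + Re e * p.2))).
- exact: measurable_scale.
- by move=> k; exact: mpres_rot.
- move=> t; apply/rowP => k; rewrite !mxE tnth_mktuple.
  by apply: cplx_eq; rewrite !cplxE //=; ring.
Qed.

Lemma mpres_leb_shift (z : Cn R n) : mpres (@lebesgue_Cn R n) (fun w => w + z).
Proof.
apply: (@mpres_Cn _ (fun k p => (p.1 + Re (z ord0 k), p.2 + Im (z ord0 k)))).
- exact: measurable_shift.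
- by move=> k; exact: mpres_translate.
- move=> t; apply/rowP => k; rewrite !mxE tnth_mktuple.
  by apply: cplx_eq; rewrite !cplxE.
Qed.

Lemma int_gauss1 (t : R) : 0 < t ->
  (\int[@lebesgue_measure R]_x (expR (- (t * x ^+ 2)))%:E = (Num.sqrt (pi / t))%:E)%E.
Proof.
(* The standard deviation of the centred normal law whose density is proportional to exp (- t
   x^2). *)
move=> t0; pose s := (Num.sqrt (2 * t))^-1.
have t20 : 0 < 2 * t by rewrite mulr_gt0.
have s0 : s != 0 by rewrite invr_eq0 gt_eqF// sqrtr_gt0.
have s2 : s ^+ 2 = (2 * t)^-1 by rewrite /s exprVn sqr_sqrtr// ltW.
have H := @integral_normal_pdf R 0 s.
rewrite normal_pdfE// /normal_peak /normal_fun in H.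
have E : Num.sqrt (s ^+ 2 * pi *+ 2) = Num.sqrt (pi / t).
  rewrite s2; congr Num.sqrt; rewrite -mulr_natl; field.
  by rewrite gt_eqF.
rewrite E s2 in H.
have : 0 < Num.sqrt (pi / t) by rewrite sqrtr_gt0 divr_gt0// pi_gt0.
move: (Num.sqrt (pi / t)) H => c H c0 {E}.
have me : measurable_fun setT (fun x : R => expR (- (t * x ^+ 2))).
  by apply: (measurableT_comp (@measurable_expR R)); apply: measurableT_comp => //;
    apply: measurable_funM => //; exact: measurable_funX.
have H2 : (c^-1%:E * \int[@lebesgue_measure R]_x (expR (- (t * x ^+ 2)))%:E = 1)%E.
  rewrite -ge0_integralZl//; first last.
  - by rewrite lee_fin invr_ge0 ltW.
  - exact/measurable_EFinP.
  rewrite -[RHS]H; apply: eq_integral => x _; rewrite -EFinM; congr EFin.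
  congr (_ * expR _); rewrite subr0 -mulr_natl; field.
  by rewrite gt_eqF.
rewrite -[LHS]mul1e -[X in (X * _)%E](_ : c%:E * c^-1%:E = 1)%E; last first.
  by rewrite -EFinM divff// gt_eqF.
by rewrite -muleA H2 mule1.
Qed.

Lemma int_gauss_plane (t : R) : 0 < t ->
  (\int[@lebesgue_plane R]_p (expR (- (t * (p.1 ^+ 2 + p.2 ^+ 2))))%:E = (pi / t)%:E)%E.
Proof.
move=> t0.
have me : measurable_fun setT (fun x : R => expR (- (t * x ^+ 2))).
  by apply: (measurableT_comp (@measurable_expR R)); apply: measurableT_comp => //;
    apply: measurable_funM => //; exact: measurable_funX.
transitivity (\int[(@lebesgue_measure R \x @lebesgue_measure R)%E]_p
   (expR (- (t * p.1 ^+ 2)) * expR (- (t * p.2 ^+ 2)))%:E)%E.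
  by apply: eq_integral => p _; rewrite -expRD; congr (expR _)%:E; ring.
rewrite fubini_tonelli1/=; first last.
- by move=> p; rewrite lee_fin mulr_ge0 ?expR_ge0.
- apply/measurable_EFinP; apply: measurable_funM.
    exact: (measurableT_comp me measurable_fst).
  exact: (measurableT_comp me measurable_snd).
rewrite /fubini_F /=.
under eq_integral => x _.
  under eq_integral do rewrite EFinM.
  rewrite ge0_integralZl//; first last.
  - by apply/measurable_EFinP; exact: me.
  rewrite int_gauss1//.
  over.
rewrite /= ge0_integralZr//; first last.
- by apply/measurable_EFinP; exact: me.
rewrite int_gauss1// -EFinM -expr2 sqr_sqrtr//.
by rewrite divr_ge0 ?pi_ge0// ltW.
Qed.

Lemma measurable_expsq (c : R) : measurable_fun setT (fun w : Cn R n => expR (c * sqnorm w)).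
Proof.
apply: (measurableT_comp (@measurable_expR R)); apply: measurable_funM => //.
exact: measurable_sqnorm.
Qed.

Lemma int_gauss_leb (t : R) : 0 < t ->
  (\int[@lebesgue_Cn R n]_w (expR (- t * sqnorm w))%:E = ((pi / t) ^+ n)%:E)%E.
Proof.
move=> t0.
rewrite -[LHS]/((\int[pushforward (measure_power (@lebesgue_plane R) n) (@coords_Cn R n)]_w
  (expR (- t * sqnorm w))%:E)%E).
have me : measurable_fun setT (fun w : Cn R n => (expR (- t * sqnorm w))%:E).
  by apply/measurable_EFinP; exact: measurable_expsq.
apply: (eq_trans (ge0_integral_pushforward (@measurable_coords_Cn R n) _ measurableT me _)).
  by move=> w _; rewrite lee_fin expR_ge0.
rewrite preimage_setT.
under eq_integral => s _.
  rewrite /= sqnormE coords_CnK mulr_sumr expR_sum.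
  over.
have mr : measurable_fun setT (fun p : plane R => expR (- t * (p.1 ^+ 2 + p.2 ^+ 2))).
  apply: (measurableT_comp (@measurable_expR R)); apply: measurable_funM => //.
  apply: measurable_funD; apply: measurable_funX; [exact: measurable_fst|exact: measurable_snd].
rewrite /= (integral_power_prod (@lebesgue_plane R) n mr) => [|p]; last exact: expR_ge0.
rewrite (_ : (\int[_]_x _)%E = (pi / t)%:E); last first.
  rewrite -int_gauss_plane//; apply: eq_integral => p _; congr (expR _)%:E.
  by rewrite mulNr.
by elim: (n) => [|m IH]; rewrite ?expe0// expeS IH exprS EFinM.
Qed.

Lemma gauss_E A : @gauss R n A = (\int[@lebesgue_Cn R n]_(z in A) (gauss_density z)%:E)%E.
Proof. by []. Qed.

Lemma gauss_setT : @gauss R n setT = 1%E.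
Proof.
rewrite /gauss /gauss_density; under eq_integral do rewrite EFinM -mulN1r.
rewrite ge0_integralZl//; first last.
- by rewrite lee_fin invr_ge0 exprn_ge0// pi_ge0.
- by apply/measurable_EFinP; exact: measurable_expsq.
rewrite (int_gauss_leb ltr01) divr1 -EFinM mulVf//.
by rewrite expf_neq0// gt_eqF// pi_gt0.
Qed.

(** Declaring [gauss] a probability makes it sigma-finite, as [cfubini] requires. *)
HB.instance Definition _ :=
  @Measure_isProbability.Build _ _ R (@gauss R n) gauss_setT.

(** The estimates below are arranged to leave a coefficient of |w|^2 smaller than 1, so that they
    can end here. *)
Lemma intR_exp (c : R) : c < 1 -> intR (@gauss R n) (fun w => expR (c * sqnorm w)).
Proof.
move=> c1; apply/(intR_density (@measurable_gauss_density R n) (@gauss_density_ge0 R n) (fun A _ => gauss_E A)).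
  exact: measurable_expsq.
rewrite (_ : (fun _ => _) = (fun w => (pi ^+ n)^-1 * expR (- (1 - c) * sqnorm w))).
  apply: intR_Z; apply/integrableP; split.
    by apply/measurable_EFinP; exact: measurable_expsq.
  under eq_integral do rewrite /= ger0_norm ?expR_ge0//.
  by rewrite int_gauss_leb ?ltry// subr_gt0.
apply/funext => w; rewrite /gauss_density mulrCA; congr (_ * _).
by rewrite -expRD; congr expR; ring.
Qed.

Lemma cint_density F : cintble (@gauss R n) F ->
  cint (@gauss R n) F = cint (@lebesgue_Cn R n) (fun w => F w * (gauss_density w)%:C).
Proof.
move=> [a b]; apply: cplx_eq => /=.
  rewrite (Rint_density (@measurable_gauss_density R n) (@gauss_density_ge0 R n) (fun A _ => gauss_E A))//.
  by apply: eq_Rintegral => w _; rewrite ReM /= mulr0 subr0.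
rewrite (Rint_density (@measurable_gauss_density R n) (@gauss_density_ge0 R n) (fun A _ => gauss_E A))//.
by apply: eq_Rintegral => w _; rewrite ImM /= mulr0 add0r.
Qed.

Lemma cintble_density F : cmeas F -> cintble (@gauss R n) F <->
  cintble (@lebesgue_Cn R n) (fun w => F w * (gauss_density w)%:C).
Proof.
move=> [mr mi]; rewrite /cintble.
have E1 : (fun w => Re (F w * (gauss_density w)%:C)) = (fun w => Re (F w) * gauss_density w).
  by apply/funext => w; rewrite ReM /= mulr0 subr0.
have E2 : (fun w => Im (F w * (gauss_density w)%:C)) = (fun w => Im (F w) * gauss_density w).
  by apply/funext => w; rewrite ImM /= mulr0 add0r.
rewrite E1 E2.
have dE := intR_density (@measurable_gauss_density R n) (@gauss_density_ge0 R n) (fun A _ => gauss_E A).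
by split=> -[/dE h1 /dE h2]; split; [apply: h1|apply: h2|apply: h1|apply: h2].
Qed.

Lemma mpres_gauss_scale (e : Cplx R) : nm e = 1 ->
  mpres (@gauss R n) (fun w => e *: w).
Proof.
move=> e1; have [mH pH] := mpres_leb_scale e1; split=> // A mA.
rewrite /gauss -[RHS](@eq_measure_integral _ _ _ _ _ (pushforward (@lebesgue_Cn R n) (fun w => e *: w))); last first.
  by move=> B mB _; rewrite /= /pushforward; exact: pH.
have md : measurable_fun A (fun w : Cn R n => (gauss_density w)%:E).
  by apply/measurable_EFinP; apply: measurable_funTS; exact: measurable_gauss_density.
apply: esym; apply: (eq_trans (ge0_integral_pushforward mH _ mA md _)).
  by move=> w _; rewrite lee_fin gauss_density_ge0.
apply: eq_integral => w _ /=; congr (_ * expR _)%:E.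
by rewrite sqnormZ e1 expr1n mul1r.
Qed.

Lemma cint_gauss_scale (e : Cplx R) F : nm e = 1 -> cintble (@gauss R n) F ->
  cint (@gauss R n) F = cint (@gauss R n) (fun w => F (e *: w)).
Proof.
move=> e1 iF; have [mH pH] := mpres_gauss_scale e1.
apply: cint_pushforward => //.
- by move=> A mA; rewrite pH.
- exact: cintble_meas iF.
- by apply: (cintble_pushforward mH _ iF) => A mA; rewrite pH.
Qed.

Lemma gauss_density_shift z w :
  gauss_density (w + z) = gauss_density w * expR (- sqnorm z - 2 * Re (dotc w (conjv z))).
Proof.
rewrite /gauss_density -mulrA -expRD sqnormD; congr (_ * expR _); ring.
Qed.

(** The Cameron-Martin formula: Lebesgue measure is translation invariant, and the extra factor is
    the quotient of the Gaussian densities at w + z and w. *)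
Lemma cint_gauss_shift z F : cintble (@gauss R n) F ->
  cint (@gauss R n) F = cint (@gauss R n)
   (fun w => F (w + z) * (expR (- sqnorm z - 2 * Re (dotc w (conjv z))))%:C).
Proof.
move=> iF; have [mH pH] := mpres_leb_shift z.
have mF := cintble_meas iF.
have iL := (cintble_density mF).1 iF.
have E w : F (w + z) * (expR (- sqnorm z - 2 * Re (dotc w (conjv z))))%:C * (gauss_density w)%:C
    = F (w + z) * (gauss_density (w + z))%:C.
  by rewrite gauss_density_shift realcM -!mulrA; congr (_ * _); rewrite mulrC.
have iS : cintble (@lebesgue_Cn R n) (fun w => F (w + z) * (gauss_density (w + z))%:C).
  by apply: (cintble_pushforward mH _ iL) => A mA; rewrite pH.
rewrite !cint_density//; last first.
  apply/cintble_density; last by under eq_fun do rewrite E.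
  apply: cmeasM; first exact: (cmeas_comp mF mH).
  apply: cmeas_real; apply: (measurableT_comp (@measurable_expR R)).
  apply: measurable_funB => //; apply: measurable_funM => //.
  apply: (cmeas_dotc (a := fun w => w) (b := fun=> conjv z) _ _).1 => k.
    exact: cmeas_coord.
  exact: cmeas_cst.
under [RHS]eq_cint do rewrite E.
apply: cint_pushforward => //.
- by move=> A mA; rewrite pH.
- exact: cintble_meas iL.
Qed.

(** The Gaussian density vanishes nowhere, so a null set of [gauss] is a null set of Lebesgue
    measure. *)
Lemma ae_gauss_leb (P : set (Cn R n)) :
  (\forall w \ae (@gauss R n), P w) -> (\forall w \ae (@lebesgue_Cn R n), P w).
Proof.
move=> [N [mN N0 sN]].
have : ae_eq (@lebesgue_Cn R n) N (fun w => (gauss_density w)%:E) (cst 0%E).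
  apply/ae_eq_integral_abs => //.
    by apply/measurable_EFinP; apply: measurable_funTS; exact: measurable_gauss_density.
  rewrite -[RHS]N0 /gauss; apply: eq_integral => w _.
  by rewrite gee0_abs// lee_fin gauss_density_ge0.
apply: filterS => w /= H; apply: contrapT => nP.
have /H [] : N w by exact: sN.
move=> /eqP; apply/negP; rewrite gt_eqF// mulr_gt0 ?expR_gt0//.
by rewrite invr_gt0 exprn_gt0// pi_gt0.
Qed.

(** A box around [w0] has positive measure and is therefore not contained in the exceptional set.
    This turns almost everywhere statements about continuous functions into statements at every
    point. *)
Lemma ae_dense (P : set (Cn R n)) (w0 : Cn R n) (r : R) : 0 < r ->
  (\forall w \ae (@lebesgue_Cn R n), P w) ->
  exists2 w, P w & forall k, nm (w ord0 k - w0 ord0 k) < r.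
Proof.
move=> r0 [N [mN N0 sN]]; apply: contrapT => H.
(* Real and imaginary parts get half of [r] each, since the modulus is bounded by the sum of their
   absolute values. *)
pose J (c : R) := [set` `]c - r / 2, c + r / 2[].
pose B k := J (Re (w0 ord0 k)) `*` J (Im (w0 ord0 k)).
have mB k : measurable (B k) by apply: measurableX; exact: measurable_itv.
have : (measure_power (@lebesgue_plane R) n [set t | forall i, B i (tnth t i)] <=
    @lebesgue_Cn R n N)%E.
  rewrite leb_CnE; apply: le_measure; rewrite ?inE.
  - rewrite [X in measurable X](_ : _ = \bigcap_(i in [set: 'I_n])
      (setT `&` (@tnth n (plane R) ^~ i @^-1` B i))); last first.
      apply/seteqP; split=> [t /= K i _|t K i]; first by split=> //; exact: K.
      by have [] := K i I.
    apply: fin_bigcap_measurable => [|i _]; first exact: finite_finset.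
    exact: (measurable_tnth i measurableT (mB i)).
  - by rewrite -[X in measurable X]setTI; exact: measurable_coords_Cn.
  - move=> t Bt /=; apply: sN => Pt; apply: H; exists (coords_Cn t) => // k.
    have [] := Bt k; rewrite /J /= !in_itv/= => /andP[h1 h2] /andP[h3 h4].
    rewrite (le_lt_trans (nm_le _))// !cplxE mxE /=.
    have : `|(tnth t k).1 - Re (w0 ord0 k)| < r / 2 by rewrite ltr_norml; lra.
    have : `|(tnth t k).2 - Im (w0 ord0 k)| < r / 2 by rewrite ltr_norml; lra.
    by lra.
rewrite (measure_power_box (@lebesgue_plane R) mB) N0 leNgt => /negP; apply.
rewrite (_ : (\prod_(i < n) _)%E = (\prod_(i < n) (r * r)%:E)%E); last first.
  apply: eq_bigr => k _; rewrite /lebesgue_plane.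
  apply: (eq_trans (product_measure1E _ _ _ _)); try exact: measurable_itv.
  have L c : lebesgue_measure (J c) = r%:E.
    rewrite /J lebesgue_measure_itv/= lte_fin ifT; last by lra.
    by rewrite -EFinD; congr EFin; lra.
  by rewrite EFinM; congr (_ * _)%E; exact: L.
by rewrite prodEFin lte_fin prodr_gt0// => k _; rewrite mulr_gt0.
Qed.
End gauss_measure.

(** * Goursat's theorem and circle means *)

Section cexp_series.
Context {R : realType}.
Implicit Types (x : Cplx R) (s : R).

Lemma ge0_of_derive (f df : R -> R) : (forall t : R, is_derive t (1 : R) f (df t)) ->
  (forall t, 0 <= t -> t <= 1 -> 0 <= df t) -> f 0 = 0 ->
  forall s, 0 <= s -> s <= 1 -> 0 <= f s.
Proof.
move=> fd df0 f0 s; rewrite le_eqVlt => /predU1P[<-|s0] s1; first by rewrite f0.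
have [|c] := MVT s0 (fun t _ => fd t).
  apply: continuous_subspaceT => t; apply: differentiable_continuous.
  by apply/derivable1_diffP; exact: ex_derive.
rewrite in_itv/= f0 !subr0 => /andP[c0 cs] ->.
by apply: mulr_ge0 (ltW s0); apply: df0; rewrite ltW// (lt_le_trans cs).
Qed.

Lemma is_derive_pow (c : R) m s : is_derive s (1 : R) (fun t => c * t ^+ m.+1)
  (c * (m.+1%:R * s ^+ m)).
Proof.
have h : is_derive s (1 : R) (fun t : R => t ^+ m.+1) (m.+1%:R * s ^+ m).
  apply: DeriveDef; first exact: exprn_derivable.
  by rewrite exp_derive /GRing.scale /= mulr1.
exact: (is_deriveZ c h).
Qed.

Lemma is_derive_lin (c : R) s : is_derive s (1 : R) (fun t => t * c) c.
Proof.
have := is_derive_pow c 0 s; rewrite expr0 !mulr1.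
by congr is_derive; apply/funext => t; rewrite expr1 mulrC.
Qed.

Let P (u : nat -> R) N s := \sum_(k < N) s ^+ k * u k.

Let is_derive_P u N s : is_derive s (1 : R) (P u N.+1)
  (\sum_(k < N) s ^+ k * (k.+1%:R * u k.+1)).
Proof.
elim: N => [|N IH].
  rewrite big_ord0 (_ : P u 1 = cst (u 0%N)); first exact: is_derive_cst.
  by apply/funext => t; rewrite /P big_ord1 expr0 mul1r.
rewrite (_ : P u N.+2 = fun t => P u N.+1 t + u N.+1 * t ^+ N.+1); last first.
  by apply/funext => t; rewrite /P big_ord_recr /= [X in _ + X]mulrC.
rewrite big_ord_recr /=.
have := is_deriveD IH (is_derive_pow (u N.+1) N s).
by congr is_derive; congr (_ + _); ring.
Qed.

Let e x k : Cplx R := x ^+ k / k`!%:R.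

Let eS x k : k.+1%:R * e x k.+1 = x * e x k.
Proof.
rewrite /e factS natrM exprS invfM; field.
by rewrite nat1r !(pnatr_eq0 (Cplx R)) -lt0n fact_gt0.
Qed.

Let Re_cexp s x : Re (cexp (s%:C * x)) = expR (s * Re x) * cos (s * Im x).
Proof. by rewrite /cexp !cplxE /= !mul0r subr0 addr0 subr0. Qed.
Let Im_cexp s x : Im (cexp (s%:C * x)) = expR (s * Re x) * sin (s * Im x).
Proof. by rewrite /cexp !cplxE /= !mul0r subr0 !addr0. Qed.

Let is_derive_Re x s : is_derive s (1 : R) (fun t => Re (cexp (t%:C * x)))
  (Re (x * cexp (s%:C * x))).
Proof.
under eq_fun do rewrite Re_cexp.
have h1 := @is_derive1_comp _ expR (fun t => t * Re x) s _ _ (is_derive_expR _) (is_derive_lin (Re x) s).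
have h2 := @is_derive1_comp _ cos (fun t => t * Im x) s _ _ (is_derive_cos _) (is_derive_lin (Im x) s).
have := is_deriveM h1 h2.
congr is_derive; rewrite ReM Re_cexp Im_cexp /GRing.scale /=; ring.
Qed.

Let is_derive_Im x s : is_derive s (1 : R) (fun t => Im (cexp (t%:C * x)))
  (Im (x * cexp (s%:C * x))).
Proof.
under eq_fun do rewrite Im_cexp.
have h1 := @is_derive1_comp _ expR (fun t => t * Re x) s _ _ (is_derive_expR _) (is_derive_lin (Re x) s).
have h2 := @is_derive1_comp _ sin (fun t => t * Im x) s _ _ (is_derive_sin _) (is_derive_lin (Im x) s).
have := is_deriveM h1 h2.
congr is_derive; rewrite ImM Re_cexp Im_cexp /GRing.scale /=; ring.
Qed.

(** The Taylor polynomial of degree below [N] of exp (s x) in the real variable [s]. *)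
Let T x N s : Cplx R := \sum_(k < N) s%:C ^+ k * e x k.

Let Re_T x N s : Re (T x N s) = P (fun k => Re (e x k)) N s.
Proof.
rewrite /T Re_sum; apply: eq_bigr => k _.
by rewrite -rmorphXn ReM /= mul0r subr0.
Qed.
Let Im_T x N s : Im (T x N s) = P (fun k => Im (e x k)) N s.
Proof.
rewrite /T Im_sum; apply: eq_bigr => k _.
by rewrite -rmorphXn ImM /= mul0r addr0.
Qed.

Let natc m : (m%:R : Cplx R) = (m%:R)%:C. Proof. by rewrite raddfMn. Qed.

(** In [s], the remainder of order [N.+1] vanishes at 0 and has [x] times the remainder of order [N]
    as derivative. Bounding real and imaginary parts separately doubles the estimate at each step,
    whence 2 |x| in place of |x|. *)
Lemma cexp_taylor x N s : 0 <= s -> s <= 1 ->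
  nm (cexp (s%:C * x) - T x N s) <= expR (nm x) * ((2 * nm x * s) ^+ N / N`!%:R).
Proof.
elim: N s => [|N IH] s s0 s1.
  rewrite /T big_ord0 subr0 nm_cexp expr0 divr1 mulr1 ler_expR.
  rewrite !cplxE /= mul0r subr0 (le_trans (ler_norm _))// normrM ger0_norm//.
  by rewrite (le_trans _ (le_Re x))// ler_piMl.
(* The primitive of [dM] that vanishes at 0; the final bound is [2 * M s], with one [M s] for each
   of the real and imaginary parts. *)
pose M t := expR (nm x) * nm x * ((2 * nm x) ^+ N / N`!%:R) / N.+1%:R * t ^+ N.+1.
pose dM t := expR (nm x) * nm x * ((2 * nm x * t) ^+ N / N`!%:R).
have dME t : is_derive t (1 : R) M (dM t).
  have := is_derive_pow (expR (nm x) * nm x * ((2 * nm x) ^+ N / N`!%:R) / N.+1%:R) N t.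
  congr is_derive; rewrite /dM !exprMn; field.
  by rewrite ?nat1r !pnatr_eq0 -lt0n fact_gt0.
have M0 : M 0 = 0 by rewrite /M expr0n /= mulr0.
have xT t : x * (cexp (t%:C * x) - T x N t) =
   x * cexp (t%:C * x) - \sum_(k < N) t%:C ^+ k * (k.+1%:R * e x k.+1).
  rewrite mulrBr; congr (_ - _); rewrite /T mulr_sumr; apply: eq_bigr => k _.
  by rewrite eS mulrCA.
have bound t : 0 <= t -> t <= 1 -> nm (x * (cexp (t%:C * x) - T x N t)) <= dM t.
  move=> t0 t1; rewrite nmM.
  have -> : dM t = nm x * (expR (nm x) * ((2 * nm x * t) ^+ N / N`!%:R)).
    by rewrite /dM; move: (_ / _) => b; ring.
  by apply: ler_wpM2l; rewrite ?nm_ge0// IH.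
have dRe t : is_derive t (1 : R) (fun t => Re (cexp (t%:C * x) - T x N.+1 t))
    (Re (x * (cexp (t%:C * x) - T x N t))).
  under eq_fun do rewrite ReB Re_T.
  rewrite xT ReB; apply: is_deriveB; first exact: is_derive_Re.
  rewrite Re_sum; have := is_derive_P (fun k => Re (e x k)) N t.
  congr is_derive; apply: eq_bigr => k _.
  by rewrite natc -rmorphXn !cplxE /= !mul0r !subr0.
have dIm t : is_derive t (1 : R) (fun t => Im (cexp (t%:C * x) - T x N.+1 t))
    (Im (x * (cexp (t%:C * x) - T x N t))).
  under eq_fun do rewrite ImB Im_T.
  rewrite xT ImB; apply: is_deriveB; first exact: is_derive_Im.
  rewrite Im_sum; have := is_derive_P (fun k => Im (e x k)) N t.
  congr is_derive; apply: eq_bigr => k _.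
  by rewrite natc -rmorphXn !cplxE /= !mul0r !addr0.
have z0 : cexp ((0 : R)%:C * x) - T x N.+1 0 = 0.
  rewrite mul0r cexp0 /T big_ord_recl big1 => [|k _]; last by rewrite expr0n /= mul0r.
  by rewrite expr0 mul1r /e expr0 fact0 divr1 addr0 subrr.
(* A function whose derivative is bounded by that of [M] is itself bounded by [M]: [M t + f t] and
   [M t - f t] have nonnegative derivatives. *)
have B (f df : R -> R) : (forall t : R, is_derive t (1 : R) f (df t)) -> f 0 = 0 ->
    (forall t, 0 <= t -> t <= 1 -> `|df t| <= dM t) -> `|f s| <= M s.
  move=> fd f0 fb; rewrite ler_norml -subr_ge0 opprK addrC -[X in _ && X]subr_ge0.
  apply/andP; split.
    apply: (@ge0_of_derive (fun t => M t + f t) (fun t => dM t + df t)) => //.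
    - by move=> t t0 t1; have := fb t t0 t1; rewrite ler_norml => /andP[]; lra.
    - by rewrite M0 f0 addr0.
  apply: (@ge0_of_derive (fun t => M t - f t) (fun t => dM t - df t)) => //.
  - by move=> t t0 t1; have := fb t t0 t1; rewrite ler_norml => /andP[]; lra.
  - by rewrite M0 f0 subr0.
rewrite (le_trans (nm_le _))//.
have b1 := B _ _ dRe (congr1 (@complex.Re R) z0)
  (fun t t0 t1 => le_trans (le_Re _) (bound t t0 t1)).
have b2 := B _ _ dIm (congr1 (@complex.Im R) z0)
  (fun t t0 t1 => le_trans (le_Im _) (bound t t0 t1)).
rewrite (le_trans (lerD b1 b2))// le_eqVlt; apply/orP; left; apply/eqP.
rewrite /M factS natrM !exprMn !exprS; field.
by rewrite ?nat1r !pnatr_eq0 -lt0n fact_gt0.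
Qed.

Lemma cexp_taylor1 x N :
  nm (cexp x - \sum_(k < N) x ^+ k / k`!%:R) <= expR (nm x) * ((2 * nm x) ^+ N / N`!%:R).
Proof.
have := @cexp_taylor x N 1 ler01 (lexx _); rewrite mul1r mulr1.
congr (nm (_ - _) <= _); apply: eq_bigr => k _.
by rewrite expr1n mul1r.
Qed.

Lemma ccvg_cexp x : ccvg (fun N => \sum_(k < N) x ^+ k / k`!%:R) (cexp x).
Proof.
apply: (@ccvg_squeeze _ _ _ (fun N => expR (nm x) * ((2 * nm x) ^+ N / N`!%:R))).
  by move=> N; rewrite nmB; exact: cexp_taylor1.
rewrite -(mulr0 (expR (nm x))); apply: cvgM; first exact: cvg_cst.
exact: (@cvg_exp_coeff _ (2 * nm x)).
Qed.

Lemma cexp_diff2 x : nm (cexp x - 1 - x) <= 2 * expR (nm x) * nm x ^+ 2.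
Proof.
have := cexp_taylor1 x 2; rewrite !big_ord_recr big_ord0 /= add0r.
rewrite expr0 expr1 fact0 !factS fact0 !divr1 opprD addrA => /le_trans; apply.
rewrite exprMn !muln1 le_eqVlt; apply/orP; left; apply/eqP; by field.
Qed.

End cexp_series.

(** * Complex differentiability in one variable *)

Section cdiff.
Context {R : realType}.
Implicit Types (f g H : Cplx R -> Cplx R) (p z L : Cplx R).

(** Written with real epsilons and multiplied out: the estimate includes [z = p] and avoids limits
    in the topology of [Cplx R]. *)
Definition cdiff f p := exists L : Cplx R, forall e : R, 0 < e -> exists2 d : R, 0 < d &
  forall z, nm (z - p) < d -> nm (f z - f p - L * (z - p)) <= e * nm (z - p).

Definition ccont f p := forall e : R, 0 < e -> exists2 d : R, 0 < d &
  forall z, nm (z - p) < d -> nm (f z - f p) < e.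

Lemma cdiff_lip f p : cdiff f p -> exists2 K : R, 0 < K & exists2 d : R, 0 < d &
  forall z, nm (z - p) < d -> nm (f z - f p) <= K * nm (z - p).
Proof.
move=> [L hL]; have [d d0 hd] := hL 1 ltr01.
exists (nm L + 1); first by rewrite ltr_wpDl ?nm_ge0.
exists d => // z /hd; rewrite mul1r => h.
rewrite -[f z - f p](subrK (L * (z - p))) (le_trans (nmD _ _))// nmM mulrDl mul1r.
by rewrite addrC lerD2l.
Qed.

Lemma cdiff_ccont f p : cdiff f p -> ccont f p.
Proof.
move=> /cdiff_lip[K K0 [d d0 h]] e e0.
exists (Num.min d (e / K)); first by rewrite lt_min d0 divr_gt0.
move=> z; rewrite lt_min => /andP[/h zd ze]; rewrite (le_lt_trans zd)//.
by rewrite mulrC -ltr_pdivlMr.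
Qed.

Lemma cdiff_comp f g p : cdiff f p -> cdiff g (f p) -> cdiff (fun z => g (f z)) p.
Proof.
move=> df [M hM]; have [K K0 [d1 d10 h1]] := cdiff_lip df.
have [L hL] := df; exists (M * L) => e e0.
have e20 : 0 < e / (2 * K) by rewrite divr_gt0// mulr_gt0.
have [d2 d20 h2] := hM _ e20.
have M10 : 0 < 2 * (nm M + 1) by rewrite mulr_gt0// ltr_wpDl ?nm_ge0.
have [d3 d30 h3] := hL (e / (2 * (nm M + 1))) (divr_gt0 e0 M10).
exists (Num.min d1 (Num.min (d2 / K) d3)); first by rewrite !lt_min d10 d30 divr_gt0.
move=> z; rewrite !lt_min => /and3P[/h1 z1 z2 /h3 z3].
have zp : nm (f z - f p) < d2.
  by rewrite (le_lt_trans z1)// mulrC -ltr_pdivlMr.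
have := h2 _ zp => z4.
rewrite (_ : _ - _ - _ = (g (f z) - g (f p) - M * (f z - f p)) +
   M * (f z - f p - L * (z - p))); last by ring.
rewrite (le_trans (nmD _ _))// nmM.
have b1 : nm (g (f z) - g (f p) - M * (f z - f p)) <= e / 2 * nm (z - p).
  rewrite (le_trans z4)// (le_trans (ler_wpM2l (ltW e20) z1))//.
  rewrite le_eqVlt; apply/orP; left; apply/eqP; field.
  by rewrite gt_eqF.
have b2 : nm M * nm (f z - f p - L * (z - p)) <= e / 2 * nm (z - p).
  have := ler_wpM2l (nm_ge0 M) z3 => /le_trans; apply.
  rewrite mulrA; apply: ler_wpM2r; first exact: nm_ge0.
  have M1 : 0 < nm M + 1 by rewrite ltr_wpDl ?nm_ge0.
  have -> : nm M * (e / (2 * (nm M + 1))) = e / 2 * (nm M / (nm M + 1)).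
    by field; rewrite gt_eqF.
  by rewrite ler_piMr ?divr_ge0 ?ltW// ltr_pdivrMr// mul1r ltrDl.
by rewrite (le_trans (lerD b1 b2))// -mulrDl -splitr.
Qed.

Lemma cdiff_cexp p : cdiff (@cexp R) p.
Proof.
(* [K] collects the constant of [cexp_diff2] for |z - p| < 1 and the factor [cexp p]; the summand 1
   makes it positive. *)
exists (cexp p) => e e0; pose K := nm (cexp p) * (2 * expR 1) + 1.
have K0 : 0 < K by rewrite ltr_wpDl// !mulr_ge0 ?nm_ge0 ?expR_ge0.
exists (Num.min 1 (e / K)); first by rewrite lt_min ltr01 divr_gt0.
move=> z; rewrite lt_min => /andP[z1 ze].
rewrite -{1}(subrK p z) cexpD mulrC (_ : _ - _ - _ = cexp p * (cexp (z - p) - 1 - (z - p)));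
  last by ring.
rewrite nmM (le_trans (ler_wpM2l (nm_ge0 _) (cexp_diff2 _)))//.
have zK : K * nm (z - p) <= e by rewrite mulrC -ler_pdivlMr// ltW.
apply: le_trans (ler_wpM2r (nm_ge0 (z - p)) zK).
rewrite -(mulrA K) -expr2 (mulrA (nm (cexp p))); apply: ler_wpM2r; first by rewrite sqr_ge0.
rewrite /K ler_wpDr//; apply: ler_wpM2l; first exact: nm_ge0.
by apply: ler_wpM2l => //; rewrite ler_expR ltW.
Qed.

Lemma cdiff_affine (L p0 c p : Cplx R) : cdiff (fun z => c + L * (z - p0)) p.
Proof.
exists L => e e0; exists 1 => // z _.
rewrite (_ : _ - _ - _ = 0); last by ring.
by rewrite nm0 mulr_ge0 ?nm_ge0// ltW.
Qed.

End cdiff.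

(** * Integrals of continuous functions over segments *)

Section segment_integral.
Context {R : realType}.
Implicit Types (a b c : R) (h k : R -> Cplx R).
Notation leb := (@lebesgue_measure R).

Definition ccontR h := (continuous (fun x : R => Re (h x))) /\ (continuous (fun x : R => Im (h x))).

(** Half-open intervals make adjacent segments disjoint, so that additivity in [cintI_chasles] holds
    pointwise for the integrands. *)
Definition icut a b (h : R -> Cplx R) (x : measurableTypeR R) : Cplx R := (\1_(`[a, b[%classic) x : R)%:C * h x.
Definition cintI a b h : Cplx R := cint leb (icut a b h).

Lemma cintble_icut a b h : ccontR h -> cintble leb (icut a b h).
Proof.
have E (f : R -> R) : continuous f -> intR leb (fun x => \1_(`[a, b[%classic) x * f x).
  move=> cf; have : leb.-integrable `[a, b] (EFin \o f).
    apply: continuous_compact_integrable; first exact: segment_compact.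
    exact: continuous_subspaceT.
  move=> H; have : leb.-integrable `[a, b[ (EFin \o f).
    by apply: integrableS H => //; apply: subset_itvl; rewrite bnd_simp.
  move=> /integrable_mkcond => /(_ (measurable_itv _)); apply: eq_integrable => // x _.
  by rewrite patchE /= indicE; case: ifPn; rewrite ?mul1r ?mul0r.
move=> [cr ci]; rewrite /icut; split.
  under eq_fun do rewrite ReM /= mul0r subr0; exact: E.
under eq_fun do rewrite ImM /= mul0r addr0; exact: E.
Qed.

Lemma cintI_chasles a b c h : ccontR h -> a <= b -> b <= c ->
  cintI a c h = cintI a b h + cintI b c h.
Proof.
move=> ch ab bc; rewrite /cintI -cintD; [|exact: cintble_icut|exact: cintble_icut].
apply: eq_cint => x; rewrite /icut -mulrDl -realcD; congr (_%:C * _).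
rewrite !indicE !mem_setE !in_itv/=.
have [xb|xb] := ltP x b; have [xa|xa] := leP a x; rewrite /= ?addr0 ?add0r//.
- by rewrite (lt_le_trans xb bc).
- by move: (le_lt_trans (le_trans ab xb) xa); rewrite ltxx.
Qed.

Lemma cintIB a b h k : ccontR h -> ccontR k ->
  cintI a b (fun x => h x - k x) = cintI a b h - cintI a b k.
Proof.
move=> ch ck; rewrite /cintI -cintB; [|exact: cintble_icut|exact: cintble_icut].
by apply: eq_cint => x; rewrite /icut mulrBr.
Qed.

Lemma Rint_indic a b M : a <= b ->
  intR leb (fun x => M * \1_(`[a, b[%classic) x) /\
  \int[leb]_x (M * \1_(`[a, b[%classic) x) = M * (b - a).
Proof.
move=> ab; have i1 : intR leb (fun x => (\1_(`[a, b[%classic) x : R)).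
  exact: integrable_indic_itv.
split; first exact: intR_Z.
rewrite RintegralZl//; congr (M * _).
have L : leb `[a, b[%classic = (b - a)%:E.
  rewrite lebesgue_measure_itv/=.
  move: ab; rewrite le_eqVlt => /predU1P[->|ab]; first by rewrite lte_fin ltxx subrr.
  by rewrite lte_fin ab.
by rewrite /Rintegral integral_indic// setIT; rewrite [X in fine X]L.
Qed.

Lemma cintI_bound a b h M : ccontR h -> a <= b ->
  (forall x, a <= x -> x < b -> nm (h x) <= M) -> nm (cintI a b h) <= 2 * M * (b - a).
Proof.
move=> ch ab hM; have iI := cintble_icut a b ch.
rewrite (le_trans (nm_cint iI))// -mulrA ler_pM2l//.
have [i1 <-] := Rint_indic M ab.
apply: le_Rintegral => //; first exact: cintble_nm.
move=> x _; rewrite /icut nmM nmR ger0_norm// indicE mem_setE in_itv/=.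
have [ax|_] := leP a x; have [xb|_] := ltP x b; rewrite /= ?mul0r ?mulr0// mul1r mulr1.
exact: hM.
Qed.

Lemma cintI_cst a b (c : Cplx R) : a <= b -> cintI a b (fun=> c) = c * (b - a)%:C.
Proof.
move=> ab; have [i1 E] := Rint_indic 1 ab.
apply: cplx_eq; rewrite /cintI /cint /= !cplxE /= mulr0 ?subr0 ?add0r.
  rewrite -[X in _ = _ * X]mul1r -E -RintegralZl//; apply: eq_Rintegral => x _.
  by rewrite /icut ReM /= mul0r subr0 mul1r mulrC.
rewrite -[X in _ = _ * X]mul1r -E -RintegralZl//; apply: eq_Rintegral => x _.
by rewrite /icut ImM /= mul0r addr0 mul1r mulrC.
Qed.

End segment_integral.

(** * Goursat's theorem on rectangles *)

Section goursat.
Context {R : realType}.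
Variable H : Cplx R -> Cplx R.
Hypothesis dH : forall p, cdiff H p.

Lemma ccontR_hor (F : Cplx R -> Cplx R) (y : R) : (forall p, ccont F p) ->
  ccontR (fun x => F (x +i* y)).
Proof.
move=> cF; split=> x; apply/cvgrPdist_lt => e e0.
  have [d d0 h] := cF (x +i* y) _ e0; exists d => // t xt /=.
  rewrite distrC -ReB (le_lt_trans (le_Re _))// h//.
  rewrite (le_lt_trans (nm_le _))// !cplxE /= subrr normr0 addr0.
  by rewrite distrC.
have [d d0 h] := cF (x +i* y) _ e0; exists d => // t xt /=.
rewrite distrC -ImB (le_lt_trans (le_Im _))// h//.
rewrite (le_lt_trans (nm_le _))// !cplxE /= subrr normr0 addr0.
by rewrite distrC.
Qed.

Lemma ccontR_ver (F : Cplx R -> Cplx R) (x : R) : (forall p, ccont F p) ->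
  ccontR (fun y => F (x +i* y)).
Proof.
move=> cF; split=> y; apply/cvgrPdist_lt => e e0.
  have [d d0 h] := cF (x +i* y) _ e0; exists d => // t xt /=.
  rewrite distrC -ReB (le_lt_trans (le_Re _))// h//.
  rewrite (le_lt_trans (nm_le _))// !cplxE /= subrr normr0 add0r.
  by rewrite distrC.
have [d d0 h] := cF (x +i* y) _ e0; exists d => // t xt /=.
rewrite distrC -ImB (le_lt_trans (le_Im _))// h//.
rewrite (le_lt_trans (nm_le _))// !cplxE /= subrr normr0 add0r.
by rewrite distrC.
Qed.

(** The contour integral around the rectangle with lower left corner x + i y and sides [a] and [b],
    counterclockwise: bottom minus top, plus i times right minus left. *)
Definition rect_int (F : Cplx R -> Cplx R) (x y a b : R) : Cplx R :=
  cintI x (x + a) (fun t => F (t +i* y)) - cintI x (x + a) (fun t => F (t +i* (y + b)))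
  + 'i * (cintI y (y + b) (fun t => F ((x + a) +i* t)) - cintI y (y + b) (fun t => F (x +i* t))).

Let half (x a : R) : x + a / 2 + a / 2 = x + a. Proof. by rewrite -addrA -splitr. Qed.

(** Here m1, m2, k1, k2 stand for the inner sides of the four quarters: each is traversed twice, in
    opposite directions. *)
Lemma rect_sum_split (a1 a2 b1 b2 c1 c2 d1 d2 m1 m2 k1 k2 : Cplx R) :
  a1 + a2 - (b1 + b2) + 'i * (c1 + c2 - (d1 + d2)) =
  a1 - m1 + 'i * (k1 - d1) + (a2 - m2 + 'i * (c1 - k1)) +
  (m1 - b1 + 'i * (k2 - d2) + (m2 - b2 + 'i * (c2 - k2))).
Proof. ring. Qed.

Lemma rect_int_split F x y a b : (forall p, ccont F p) -> 0 <= a -> 0 <= b ->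
  rect_int F x y a b = rect_int F x y (a / 2) (b / 2) + rect_int F (x + a / 2) y (a / 2) (b / 2)
   + (rect_int F x (y + b / 2) (a / 2) (b / 2) + rect_int F (x + a / 2) (y + b / 2) (a / 2) (b / 2)).
Proof.
move=> cF a0 b0; rewrite /rect_int !half.
have a2 : x <= x + a / 2 by rewrite lerDl divr_ge0.
have a2' : x + a / 2 <= x + a by rewrite -(half x a) lerDl divr_ge0.
have b2 : y <= y + b / 2 by rewrite lerDl divr_ge0.
have b2' : y + b / 2 <= y + b by rewrite -(half y b) lerDl divr_ge0.
rewrite !(@cintI_chasles _ x (x + a / 2) (x + a))//; try exact: ccontR_hor.
rewrite !(@cintI_chasles _ y (y + b / 2) (y + b))//; try exact: ccontR_ver.
exact: rect_sum_split.
Qed.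

Let sub_alg (a b c d a' b' c' d' : Cplx R) :
  a - a' - (b - b') + 'i * (c - c' - (d - d')) = a - b + 'i * (c - d) - (a' - b' + 'i * (c' - d')).
Proof. ring. Qed.

Lemma rect_intB F G x y a b : (forall p, ccont F p) -> (forall p, ccont G p) ->
  rect_int (fun z => F z - G z) x y a b = rect_int F x y a b - rect_int G x y a b.
Proof.
move=> cF cG.
rewrite /rect_int (cintIB _ _ (ccontR_hor y cF) (ccontR_hor y cG)).
rewrite (cintIB _ _ (ccontR_hor (y + b) cF) (ccontR_hor (y + b) cG)).
rewrite (cintIB _ _ (ccontR_ver (x + a) cF) (ccontR_ver (x + a) cG)).
rewrite (cintIB _ _ (ccontR_ver x cF) (ccontR_ver x cG)).
exact: sub_alg.
Qed.

Let quarter (q q1 q2 q3 q4 : Cplx R) : q = q1 + q2 + (q3 + q4) -> 4 * nm q1 < nm q ->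
  4 * nm q2 < nm q -> 4 * nm q3 < nm q -> 4 * nm q4 < nm q -> False.
Proof.
move=> E; have := nmD (q1 + q2) (q3 + q4); rewrite -E.
by have := nmD q1 q2; have := nmD q3 q4; lra.
Qed.

(** For an affine integrand the differences between opposite sides are the constants - i L b and L
    a, whose contributions cancel. *)
Lemma rect_int_affine (c L p : Cplx R) x y a b : 0 <= a -> 0 <= b ->
  rect_int (fun z => c + L * (z - p)) x y a b = 0.
Proof.
move=> a0 b0; pose F z := c + L * (z - p).
have cF q : ccont F q by apply: cdiff_ccont; exact: cdiff_affine.
rewrite /rect_int -(cintIB _ _ (ccontR_hor y cF) (ccontR_hor (y + b) cF)).
rewrite -(cintIB _ _ (ccontR_ver (x + a) cF) (ccontR_ver x cF)).
rewrite (_ : (fun t => F (t +i* y) - _) = fun=> - (L * 'i * b%:C)); last first.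
  by apply/funext => t; apply: cplx_eq; rewrite !cplxE /=; ring.
rewrite [X in _ + _ * cintI _ _ X](_ : _ = fun=> L * a%:C); last first.
  by apply/funext => t; apply: cplx_eq; rewrite !cplxE /=; ring.
rewrite !cintI_cst ?lerDl//; rewrite ![_ + _ - _]addrAC !subrr !add0r.
ring.
Qed.

(** Subtracting the affine part leaves the contour integral unchanged by [rect_int_affine]. The rest
    is at most e (a + b) on the boundary, of length 2 (a + b), and [cintI_bound] contributes another
    2. *)
Lemma rect_int_small (F : Cplx R -> Cplx R) (L p : Cplx R) (e : R) x y a b : 0 <= a -> 0 <= b -> 0 <= e ->
  (forall q, ccont F q) ->
  x <= Re p -> Re p <= x + a -> y <= Im p -> Im p <= y + b ->
  (forall z, x <= Re z -> Re z <= x + a -> y <= Im z -> Im z <= y + b ->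
    nm (F z - F p - L * (z - p)) <= e * nm (z - p)) ->
  nm (rect_int F x y a b) <= 4 * e * (a + b) ^+ 2.
Proof.
move=> a0 b0 e0 cF p1 p2 p3 p4 hF.
pose A z := F p + L * (z - p); pose D z := F z - A z.
have cA q : ccont A q by apply: cdiff_ccont; exact: cdiff_affine.
have cD q : ccont D q.
  move=> t t0; have t2 : 0 < t / 2 by rewrite divr_gt0.
  have [d d0 h] := cF q _ t2; have [d' d'0 h'] := cA q _ t2.
  exists (Num.min d d'); first by rewrite lt_min d0 d'0.
  move=> z; rewrite lt_min => /andP[/h u /h' w].
  rewrite /D (_ : _ - _ - _ = (F z - F q) - (A z - A q)); last by ring.
  by rewrite (le_lt_trans (nmD _ _))// nmN (lt_le_trans (ltrD u w))// -splitr.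
have -> : rect_int F x y a b = rect_int D x y a b.
  by rewrite /D (rect_intB x y a b cF cA) (rect_int_affine (F p) L p x y a0 b0) subr0.
have M0 : 0 <= e * (a + b) by rewrite mulr_ge0// addr_ge0.
have bD z : x <= Re z -> Re z <= x + a -> y <= Im z -> Im z <= y + b -> nm (D z) <= e * (a + b).
  move=> z1 z2 z3 z4; rewrite /D /A opprD addrA (le_trans (hF _ z1 z2 z3 z4))//.
  rewrite ler_wpM2l// (le_trans (nm_le _))// !cplxE lerD// ler_norml; apply/andP; split; lra.
have xa : x <= x + a by rewrite lerDl.
have yb : y <= y + b by rewrite lerDl.
have h1 : nm (cintI x (x + a) (fun t => D (t +i* y))) <= 2 * (e * (a + b)) * (x + a - x).
  by apply: cintI_bound => // [|t t1 t2]; [exact: ccontR_hor|apply: bD => //=; exact: ltW].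
have h2 : nm (cintI x (x + a) (fun t => D (t +i* (y + b)))) <= 2 * (e * (a + b)) * (x + a - x).
  by apply: cintI_bound => // [|t t1 t2]; [exact: ccontR_hor|apply: bD => //=; exact: ltW].
have h3 : nm (cintI y (y + b) (fun t => D ((x + a) +i* t))) <= 2 * (e * (a + b)) * (y + b - y).
  by apply: cintI_bound => // [|t t1 t2]; [exact: ccontR_ver|apply: bD => //=; exact: ltW].
have h4 : nm (cintI y (y + b) (fun t => D (x +i* t))) <= 2 * (e * (a + b)) * (y + b - y).
  by apply: cintI_bound => // [|t t1 t2]; [exact: ccontR_ver|apply: bD => //=; exact: ltW].
rewrite /rect_int (le_trans (nmD _ _))// nmM.
have -> : nm ('i : Cplx R) = 1 by rewrite nmE /= expr0n expr1n add0r sqrtr1.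
rewrite mul1r (le_trans (lerD (nmD _ _) (nmD _ _)))// !nmN.
rewrite (le_trans (lerD (lerD h1 h2) (lerD h3 h4)))//.
rewrite le_eqVlt; apply/orP; left; apply/eqP; ring.
Qed.

Let sh (k : nat) (c : R) := c / 2 ^+ k.
Let sh0 k c : 0 <= c -> 0 <= sh k c.
Proof. by move=> c0; rewrite /sh divr_ge0// exprn_ge0. Qed.
Let shS k c : sh k.+1 c = sh k c / 2.
Proof. by rewrite /sh exprSr invfM mulrA. Qed.

(** Nested intervals: [i k] tells whether step [k] keeps the upper half. The supremum of the left
    ends lies in all of them. *)
Let nest (Z : nat -> R) (c : R) (i : nat -> bool) : 0 <= c ->
  (forall k, Z k.+1 = Z k + (i k)%:R * sh k.+1 c) ->
  exists p, forall k, Z k <= p /\ p <= Z k + sh k c.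
Proof.
move=> c0 ZS.
have mono k m : Z k <= Z (k + m)%N.
  elim: m => [|m IH]; rewrite ?addn0// addnS ZS (le_trans IH)// lerDl mulr_ge0//.
  exact: sh0.
have up k m : Z (k + m)%N + sh (k + m)%N c <= Z k + sh k c.
  elim: m => [|m IH]; rewrite ?addn0// addnS ZS (le_trans _ IH)//.
  have := shS (k + m)%N c; have := sh0 (k + m).+1 c0.
  by case: (i _); rewrite ?mul1r ?mul0r; lra.
have bnd k m : Z m <= Z k + sh k c.
  have [km|mk] := leqP k m.
    by have := up k (m - k)%N; rewrite subnKC//; have := sh0 m c0; lra.
  have := mono m (k - m)%N; rewrite subnKC; last exact: ltnW.
  by have := sh0 k c0; lra.
exists (sup (range Z)) => k; split.
  apply: sup_upper_bound; last by exists k.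
  split; first by exists (Z 0%N), 0%N.
  by exists (Z 0%N + sh 0 c) => _ [m _ <-]; exact: bnd.
apply: ge_sup; first by exists (Z 0%N), 0%N.
by move=> _ [m _ <-]; exact: bnd.
Qed.

Let dist_itv (x c p t : R) : x <= p -> p <= x + c -> x <= t -> t <= x + c -> `|t - p| <= c.
Proof. by move=> *; rewrite ler_norml; apply/andP; split; lra. Qed.

(* Bisection: one of the four quarters carries a quarter of the integral; the
   quarters shrink to a point, where differentiability contradicts this. *)
Lemma goursat x0 y0 a b : 0 <= a -> 0 <= b -> rect_int H x0 y0 a b = 0.
Proof.
move=> a0 b0; have cH q : ccont H q by exact: cdiff_ccont.
have step (s : R * R * nat) : exists ij : bool * bool,
   nm (rect_int H s.1.1 s.1.2 (sh s.2 a) (sh s.2 b)) <=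
   4 * nm (rect_int H (s.1.1 + ij.1%:R * sh s.2.+1 a) (s.1.2 + ij.2%:R * sh s.2.+1 b)
             (sh s.2.+1 a) (sh s.2.+1 b)).
  case: s => -[x y] k /=; rewrite !shS.
  apply: contrapT => /forallNP N.
  have N' i j := N (i, j); move: N' => {}N.
  have := N true true; have := N true false; have := N false true; have := N false false.
  rewrite /= !mulr1n !mulr0n !mul0r !addr0 !mul1r => /negP; rewrite -ltNge => n1 /negP; rewrite -ltNge => n2.
  move=> /negP; rewrite -ltNge => n3 /negP; rewrite -ltNge => n4.
  exact: (quarter (rect_int_split x y cH (sh0 k a0) (sh0 k b0)) n1 n3 n2 n4).
have [pick hpick] := choice step.
pose nxt (s : R * R * nat) := (s.1.1 + (pick s).1%:R * sh s.2.+1 a, s.1.2 + (pick s).2%:R * sh s.2.+1 b, s.2.+1).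
pose u k := iter k nxt (x0, y0, 0%N).
have u2 k : (u k).2 = k by elim: k => //= k ->.
pose X k := (u k).1.1; pose Y k := (u k).1.2.
have XS k : X k.+1 = X k + (pick (u k)).1%:R * sh k.+1 a by rewrite /X /= u2.
have YS k : Y k.+1 = Y k + (pick (u k)).2%:R * sh k.+1 b by rewrite /Y /= u2.
have big k : nm (rect_int H x0 y0 a b) <= 4 ^+ k * nm (rect_int H (X k) (Y k) (sh k a) (sh k b)).
  elim: k => [|k IH]; first by rewrite /sh expr0 mul1r !divr1.
  apply: (le_trans IH); rewrite exprSr -mulrA; apply: ler_wpM2l; first exact: exprn_ge0.
  by have := hpick (u k); rewrite u2 -XS -YS.
have [px hx] := nest a0 XS.
have [py hy] := nest b0 YS.
have [L hL] := dH (px +i* py).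
apply: nm0_eq0; apply/eqP; rewrite eq_le nm_ge0 andbT.
apply/ler_addgt0Pr => e e0; rewrite add0r.
(* Chosen so that 4 e' (a + b)^2 <= e; the summand 1 covers a degenerate rectangle. *)
pose e' := e / (4 * ((a + b) ^+ 2 + 1)).
have ab : 0 < 4 * ((a + b) ^+ 2 + 1) by rewrite mulr_gt0// ltr_wpDl// sqr_ge0.
have e'0 : 0 < e' by rewrite divr_gt0.
have [d d0 hd] := hL _ e'0.
have [k hk] : exists k, sh k (a + b) < d.
  have : (fun k => (a + b) * (2^-1) ^+ k) @ \oo --> ((a + b) * 0 : R).
    apply: cvgM; first exact: cvg_cst.
    by apply: cvg_expr; rewrite ger0_norm ?invr_ge0// invf_lt1// ltr1n.
  rewrite mulr0 => /cvgrPdist_lt /(_ _ d0)[k _ /(_ k (leqnn k))] /=.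
  rewrite sub0r normrN ger0_norm; last by rewrite mulr_ge0 ?addr_ge0// exprn_ge0// invr_ge0.
  by move=> h; exists k; rewrite /sh -exprVn.
have [x1 x2] := hx k; have [y1 y2] := hy k.
have small : nm (rect_int H (X k) (Y k) (sh k a) (sh k b)) <= 4 * e' * (sh k a + sh k b) ^+ 2.
  apply: (@rect_int_small _ L (px +i* py)); rewrite ?sh0// ?ltW// => z z1 z2 z3 z4.
  apply: hd; rewrite (le_lt_trans _ hk)// (le_trans (nm_le _))// !cplxE /=.
  by rewrite /sh mulrDl lerD//; [exact: dist_itv z1 z2|exact: dist_itv z3 z4].
rewrite (le_trans (big k))// (le_trans (ler_wpM2l (exprn_ge0 _ _) small))//.
rewrite /sh -mulrDl exprMn.
(* The factor 4^k lost in the bisection is exactly made up by the square of the scale 2^-k. *)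
have -> : 4 ^+ k * (4 * e' * ((a + b) ^+ 2 * (2 ^+ k)^-1 ^+ 2)) = 4 * e' * (a + b) ^+ 2 :> R.
  have -> : (4 : R) ^+ k = (2 ^+ k) ^+ 2 by rewrite exprAC expr2 -natrM.
  field; by rewrite expf_neq0.
rewrite /e' (_ : 4 * (e / _) * _ = e * ((a + b) ^+ 2 / ((a + b) ^+ 2 + 1))); last first.
  by field; rewrite gt_eqF// ltr_wpDl// sqr_ge0.
apply: ler_piMr; first exact: ltW.
by rewrite ler_pdivrMr ?mul1r ?lerDl// ltr_wpDl// sqr_ge0.
Qed.
End goursat.

Section circle_mean.
Context {R : realType}.

(* Goursat on rectangles of height 2 pi, with the left side going to -oo, for the 2 pi i-periodic function G \o exp *)
Lemma circle_mean (G : Cplx R -> Cplx R) : (forall p, cdiff G p) ->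
  cintI (- pi) pi (fun t => G (cexp (0 +i* t))) = G 0 * (pi + pi)%:C.
Proof.
move=> dG; pose H z := G (cexp z).
have dH p : cdiff H p by apply: cdiff_comp => //; exact: cdiff_cexp.
have cH p : ccont H p by exact: cdiff_ccont.
have pi0 : 0 <= pi :> R by exact: pi_ge0.
have pp : - pi <= pi :> R by lra.
have i0 : ('i : Cplx R) != 0 by rewrite eq_complex /= oner_eq0 andbF.
have same s : s <= 0 -> cintI (- pi) pi (fun t => H (0 +i* t)) = cintI (- pi) pi (fun t => H (s +i* t)).
  move=> s0; have s0' : 0 <= - s by rewrite oppr_ge0.
  have := goursat dH s (- pi) s0' (addr_ge0 pi0 pi0).
  rewrite /rect_int subrr addrA addNr add0r.
  (* By periodicity the bottom and top sides carry the same integral, so that only the vertical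
     sides remain. *)
  have -> : (fun t => H (t +i* - pi)) = (fun t => H (t +i* pi)).
    apply/funext => t; congr G; rewrite /cexp /=; congr (_ * (_ +i* _)).
      by rewrite cosN.
    by rewrite sinN sinpi oppr0.
  rewrite subrr add0r => /eqP; rewrite mulf_eq0 (negbTE i0) orFb subr_eq0 => /eqP; exact.
rewrite -[fun t => _]/(fun t => H (0 +i* t)).
apply/eqP; rewrite -subr_eq0; apply/eqP/nm0_eq0.
apply/eqP; rewrite eq_le nm_ge0 andbT.
apply/ler_addgt0Pr => e e0; rewrite add0r.
have P0 : 0 < 2 * (pi + pi) :> R by have := pi_gt0 R; lra.
have [d d0 h] := cdiff_ccont (dG 0) (divr_gt0 e0 P0).
(* The left side lies at abscissa [s], which is nonpositive for [same] and so far left that the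
   circle of radius exp s is within [d] of 0. *)
pose s : R := Num.min 0 (ln (d / 2)).
have s0 : s <= 0 by rewrite ge_min lexx.
rewrite (same _ s0).
have es : expR s < d.
  rewrite (le_lt_trans (y := d / 2))//; last by lra.
  rewrite -[leRHS]lnK ?posrE ?divr_gt0// ler_expR /s ge_min lexx orbT//.
have -> : G 0 * (pi + pi)%:C = cintI (- pi) pi (fun=> G 0) by rewrite cintI_cst// opprK.
rewrite -cintIB; first last.
- by split; exact: cst_continuous.
- exact: (ccontR_ver s cH).
have cK p : ccont (fun z => H z - G 0) p.
  move=> q q0; have [r r0 hr] := cH p _ q0; exists r => // z /hr.
  by rewrite (_ : H z - G 0 - (H p - G 0) = H z - H p)//; ring.
have B : forall t, - pi <= t -> t < pi -> nm (H (s +i* t) - G 0) <= e / (2 * (pi + pi)).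
  by move=> t _ _; apply/ltW; apply: h; rewrite subr0 nm_cexp.
apply: (le_trans (cintI_bound (ccontR_ver s cK) pp B)).
rewrite opprK le_eqVlt; apply/orP; left; apply/eqP; field.
by apply/lt0r_neq0; have := pi_gt0 R; lra.
Qed.
End circle_mean.

(** * The reproducing formula *)

Section lholo.
Context {R : realType} {n : nat}.
Implicit Types (F G : Cn R n -> Cplx R) (z w a b : Cn R n).

Lemma cdiffM (f g : Cplx R -> Cplx R) p : cdiff f p -> cdiff g p -> cdiff (fun x => f x * g x) p.
Proof.
move=> df dg; have [K K0 [d1 d10 h1]] := cdiff_lip df.
have [K' K'0 [d2 d20 h2]] := cdiff_lip dg.
have [L hL] := df; have [M hM] := dg.
exists (L * g p + f p * M) => e e0.
have e30 (c : R) : 0 <= c -> 0 < e / (3 * (c + 1)).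
  by move=> c0; rewrite divr_gt0// mulr_gt0// ltr_wpDl.
have [d3 d30 h3] := hL _ (e30 _ (nm_ge0 (g p))).
have [d4 d40 h4] := hM _ (e30 _ (nm_ge0 (f p))).
have KK : 0 < 3 * (K * K') by rewrite !mulr_gt0.
exists (Num.min (Num.min d1 d2) (Num.min (Num.min d3 d4) (e / (3 * (K * K'))))).
  by rewrite !lt_min d10 d20 d30 d40 divr_gt0.
move=> z; rewrite !lt_min => /andP[/andP[/h1 a1 /h2 a2] /andP[/andP[/h3 a3 /h4 a4] a5]].
rewrite (_ : _ - _ - _ = (f z - f p) * (g z - g p) + (f z - f p - L * (z - p)) * g p
   + f p * (g z - g p - M * (z - p))); last by ring.
have q0 := nm_ge0 (z - p); move: (nm (z - p)) a1 a2 a3 a4 a5 q0 => q a1 a2 a3 a4 a5 q0.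
have b1 : nm (f z - f p) * nm (g z - g p) <= e / 3 * q.
  apply: (le_trans (ler_pM (nm_ge0 _) (nm_ge0 _) a1 a2)).
  rewrite (_ : K * q * (K' * q) = (q * (K * K')) * q); last by ring.
  apply: ler_wpM2r => //.
  by rewrite -ler_pdivlMr ?mulr_gt0// -mulrA -invfM ltW.
have aux (c : R) : 0 <= c -> e / (3 * (c + 1)) * q * c <= e / 3 * q.
  move=> c0; have c1 : 0 < c + 1 by rewrite ltr_wpDl.
  rewrite (_ : _ * c = e / 3 * q * (c / (c + 1))); last by field; rewrite gt_eqF.
  apply: ler_piMr; first by rewrite !mulr_ge0// ltW.
  by rewrite ler_pdivrMr// mul1r lerDl.
have b2 : nm (f z - f p - L * (z - p)) * nm (g p) <= e / 3 * q.
  exact: (le_trans (ler_wpM2r (nm_ge0 _) a3) (aux _ (nm_ge0 _))).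
have b3 : nm (f p) * nm (g z - g p - M * (z - p)) <= e / 3 * q.
  by rewrite mulrC; apply: (le_trans (ler_wpM2r (nm_ge0 _) a4) (aux _ (nm_ge0 _))).
rewrite (le_trans (nmD _ _))// (le_trans (lerD (nmD _ _) (lexx _)))// !nmM.
by rewrite (le_trans (lerD (lerD b1 b2) b3))// le_eqVlt; apply/orP; left; apply/eqP; field.
Qed.

(* the part of holomorphy that is used: differentiability along complex lines *)
Definition lholo F := forall z w (p : Cplx R), cdiff (fun x => F (z + x *: w)) p.

Lemma cdiff_derivable (f : Cplx R -> Cplx R) p : derivable f p 1 -> cdiff f p.
Proof.
move=> /cvg_ex[L /cvgrPdist_lt H]; exists L => e e0.
have e0' : 0 < e%:C :> Cplx R by rewrite ltcR.
have [d /= d0 h] := H _ e0'.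
(* The radius given by the topology is a positive element of [Cplx R], hence real. *)
have d0' : 0 < Re d by move: d0; rewrite ltcE => /andP[].
have dE : d = (Re d)%:C by move: d0; rewrite ltcE => /andP[/eqP d1 _]; apply: cplx_eq.
exists (Re d) => // z zd.
have [->|zp] := eqVneq z p; first by rewrite !subrr mulr0 subr0 nm0 mulr0.
have zp0 : z - p != 0 by rewrite subr_eq0.
have := h (z - p); rewrite /ball_ /= sub0r normrN norm_nm dE ltcR => /(_ zd zp0).
rewrite norm_nm ltcR /GRing.scale /= mulr1 subrK => /ltW H1.
rewrite (_ : f z - f p - L * (z - p) = (z - p) * - (L - (z - p)^-1 * (f z - f p))).
  by rewrite nmM nmN mulrC ler_wpM2r// nm_ge0.
by field.
Qed.

Lemma entire_lholo F : entire F -> lholo F.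
Proof.
move=> eF z w p; apply: cdiff_derivable; apply/derivable1_diffP.
apply: (@differentiable_comp _ _ _ _ (fun x : Cplx R => z + x *: w) F) => //.
Qed.

(** Balls of row vectors are polydiscs, the norm being the maximum of the moduli of the entries. *)
Lemma entire_poly_cont F z0 : entire F -> forall e : R, 0 < e -> exists2 r : R, 0 < r &
  forall w, (forall k, nm (w ord0 k - z0 ord0 k) < r) -> nm (F w - F z0) < e.
Proof.
move=> eF e e0; have := differentiable_continuous (eF z0) => /cvgrPdist_lt.
have e0' : 0 < e%:C :> Cplx R by rewrite ltcR.
move=> /(_ _ e0') /nbhs_ballP[d /= d0 h].
have d0' : 0 < Re d by move: d0; rewrite ltcE => /andP[].
have dE : d = (Re d)%:C by move: d0; rewrite ltcE => /andP[/eqP d1 _]; apply: cplx_eq.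
exists (Re d) => // w hw.
have := h w; rewrite norm_nm ltcR nmB; apply.
split=> // i k; rewrite /ball /= ord1 norm_nm dE ltcR nmB; exact: hw.
Qed.

Lemma lholoM F G : lholo F -> lholo G -> lholo (fun w => F w * G w).
Proof. by move=> hF hG z w p; apply: cdiffM; [exact: hF|exact: hG]. Qed.

Lemma lholo_shift F a : lholo F -> lholo (fun w => F (w + a)).
Proof.
move=> hF z w p; have := hF (z + a) w p.
by congr cdiff; apply/funext => x; congr F; rewrite addrAC.
Qed.

Lemma lholo_cexp b : lholo (fun w => cexp (dotc w b)).
Proof.
move=> z w p; apply: cdiff_comp; last exact: cdiff_cexp.
have := cdiff_affine (dotc w b) 0 (dotc z b) p.
by congr cdiff; apply/funext => x; rewrite dotcDl dotcZl subr0 mulrC.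
Qed.
End lholo.

(** * Functions of subgaussian growth and the reproducing formula *)

Section symp.
Context {R : realType} {n : nat}.
Implicit Types (F G : Cn R n -> Cplx R) (z w a b : Cn R n).

(** [Sym] with bounds at every point. Leaving holomorphy to [lholo] makes the class stable under
    conjugation, so that it contains integrands mixing holomorphic and antiholomorphic factors. *)
Definition Symp F := cmeas F /\
  forall c : R, 0 < c -> exists2 K : R, 0 <= K & forall z, nm (F z) <= K * expR (c * sqnorm z).

(** By continuity the essential bound is carried from a nearby point of the set of full measure to
    any given point; the weights at the two points are compared by starting from the exponent c /
    2. *)
Lemma Sym_Symp F : Sym F -> entire F -> Symp F.
Proof.
move=> [mF sF] eF; split=> // c c0.
have c20 : 0 < c / 2 by rewrite divr_gt0.
have := sF _ c20; set s := ess_sup _ _ => soo.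
have H := ess_sup_ge (@lebesgue_Cn R n) (fun z => (nm (F z) * expR (- (c / 2 * sqnorm z)))%:E).
rewrite -/s in H.
have [M M0 HM] : exists2 M : R, 0 <= M & \forall w \ae (@lebesgue_Cn R n),
    nm (F w) <= M * expR (c / 2 * sqnorm w).
  (* The value +oo is excluded, and at -oo the default 0 of [fine] is still an upper bound. *)
  exists (Num.max 0 (fine s)); first by rewrite le_max lexx.
  apply: filterS H => w Hw.
  rewrite -ler_pdivrMr ?expR_gt0// -expRN.
  have : ((nm (F w) * expR (- (c / 2 * sqnorm w)))%:E <= (Num.max 0 (fine s))%:E)%E.
    apply: (le_trans Hw); move: soo; case: (s) => [r _||]//=.
      by rewrite lee_fin le_max lexx orbT.
    by rewrite leNye.
  by rewrite lee_fin.
(* For w in the unit polydisc around z one has |w|^2 <= 2 n + 2 |z|^2; half of [c] times this is the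
   exponent. *)
exists (M * expR (c * n%:R)); first by rewrite mulr_ge0// expR_ge0.
move=> z; apply/ler_addgt0Pr => e e0.
have [r r0 hr] := entire_poly_cont z eF e0.
have r10 : 0 < Num.min r 1 by rewrite lt_min r0 ltr01.
have [w Pw hw] := ae_dense z r10 HM.
have wz : nm (F w - F z) < e by apply: hr => k; have := hw k; rewrite lt_min => /andP[].
have := nmD (F z - F w) (F w); rewrite subrK nmB => /le_trans; apply.
rewrite [leRHS]addrC; apply: lerD; first exact: ltW.
apply: (le_trans Pw); rewrite -(mulrA M) -expRD ler_wpM2l// ler_expR.
have h1 : sqnorm (w - z) <= n%:R.
  rewrite sqnorm_sum (le_trans (y := \sum_(k < n) 1))//; last by rewrite sumr_const card_ord.
  apply: ler_sum => k _; rewrite exprn_ile1 ?nm_ge0// !mxE.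
  by have := hw k; rewrite lt_min => /andP[_ /ltW].
have h2 : sqnorm w <= 2 * n%:R + 2 * sqnorm z.
  by have := sqnormD_le (w - z) z; rewrite subrK; lra.
rewrite (_ : c * n%:R + c * sqnorm z = c / 2 * (2 * n%:R + 2 * sqnorm z)); last by field.
by apply: ler_wpM2l => //; exact: ltW.
Qed.

Lemma Symp_cst x : Symp (fun=> x).
Proof.
split; first exact: cmeas_cst.
move=> c c0; exists (nm x); first exact: nm_ge0.
move=> z; rewrite ler_peMr ?nm_ge0// -expR0 ler_expR mulr_ge0 ?sqnorm_ge0//.
exact: ltW.
Qed.

Lemma SympM F G : Symp F -> Symp G -> Symp (fun w => F w * G w).
Proof.
move=> [mF hF] [mG hG]; split; first exact: cmeasM.
move=> c c0; have c2 : 0 < c / 2 by rewrite divr_gt0.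
have [K K0 hK] := hF _ c2; have [L L0 hL] := hG _ c2.
exists (K * L); first exact: mulr_ge0.
move=> z; rewrite nmM.
rewrite (_ : c * sqnorm z = c / 2 * sqnorm z + c / 2 * sqnorm z); last by field.
rewrite expRD mulrACA; apply: ler_pM => //; exact: nm_ge0.
Qed.

Lemma SympD F G : Symp F -> Symp G -> Symp (fun w => F w + G w).
Proof.
move=> [mF hF] [mG hG]; split; first exact: cmeasD.
move=> c c0; have [K K0 hK] := hF _ c0; have [L L0 hL] := hG _ c0.
exists (K + L); first exact: addr_ge0.
by move=> z; rewrite mulrDl (le_trans (nmD _ _))// lerD.
Qed.

Lemma SympN F : Symp F -> Symp (fun w => - F w).
Proof.
move=> [mF hF]; split; first exact: cmeasN.
by move=> c c0; have [K K0 hK] := hF _ c0; exists K => // z; rewrite nmN.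
Qed.

Lemma Symp_conj F : Symp F -> Symp (fun w => conjc (F w)).
Proof.
move=> [mF hF]; split; first exact: cmeas_conj.
by move=> c c0; have [K K0 hK] := hF _ c0; exists K => // z; rewrite nmJ.
Qed.

Lemma Symp_shift F a : Symp F -> Symp (fun w => F (w + a)).
Proof.
move=> [mF hF]; split; first exact: (cmeas_comp mF (measurable_shift a)).
move=> c c0; have c2 : 0 < c / 2 by rewrite divr_gt0.
have [K K0 hK] := hF _ c2.
exists (K * expR (c * sqnorm a)); first by rewrite mulr_ge0// expR_ge0.
move=> z; rewrite -(mulrA K) -expRD; apply: (le_trans (hK _)).
apply: ler_wpM2l => //; rewrite ler_expR.
rewrite (_ : _ + _ = c / 2 * (2 * sqnorm z + 2 * sqnorm a)); last by field.
by apply: ler_wpM2l; [exact: ltW|exact: sqnormD_le].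
Qed.

Lemma Symp_opp F : Symp F -> Symp (fun w => F (- w)).
Proof.
move=> [mF hF]; split.
  have mo := measurable_scale (R := R) (n := n) (-1).
  by have := cmeas_comp mF mo; under eq_fun do rewrite scaleN1r.
by move=> c c0; have [K K0 hK] := hF _ c0; exists K => // z; rewrite -(sqnormN z).
Qed.

Lemma Symp_cexp b : Symp (fun w => cexp (dotc w b)).
Proof.
split; first by apply: cmeas_cexp; apply: cmeas_dotc => k; [exact: cmeas_coord|exact: cmeas_cst].
move=> c c0; exists (expR (c^-1 / 2 * sqnorm b)); first exact: expR_ge0.
move=> z; rewrite nm_cexp -expRD ler_expR.
have := @Re_dotc_le _ _ c z b c0 => h.
have : 0 <= c * sqnorm z by rewrite mulr_ge0 ?sqnorm_ge0// ltW.
lra.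
Qed.

Lemma Symp_coord k : Symp (fun w : Cn R n => w ord0 k).
Proof.
split; first exact: cmeas_coord.
(* From r <= 1 + r^2 together with 1 + c s <= exp (c s). *)
move=> c c0; exists (1 + c^-1); first by rewrite addr_ge0// invr_ge0 ltW.
move=> z; set s := sqnorm z.
have h1 : nm (z ord0 k) ^+ 2 <= s.
  by rewrite /s sqnorm_sum (bigD1 k)//= lerDl sumr_ge0// => i _; rewrite sqr_ge0.
have h2 := expR_ge1Dx (c * s).
have ci : 0 < c^-1 by rewrite invr_gt0.
have h3 : c^-1 * (1 + c * s) <= c^-1 * expR (c * s) by apply: ler_wpM2l => //; exact: ltW.
have h5 : 1 <= expR (c * s).
  by rewrite -expR0 ler_expR; apply: mulr_ge0; [exact: ltW|exact: sqnorm_ge0].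
have h4 : c^-1 * (1 + c * s) = c^-1 + s by rewrite mulrDr mulr1 mulrA mulVf ?mul1r// gt_eqF.
have h6 : nm (z ord0 k) <= 1 + s.
  have : 0 <= (nm (z ord0 k) - 1) ^+ 2 by rewrite sqr_ge0.
  have : 0 <= nm (z ord0 k) ^+ 2 by rewrite sqr_ge0.
  rewrite sqrrB1; lra.
rewrite mulrDl mul1r; lra.
Qed.

Lemma Symp_prod I (r : seq I) (F : I -> Cn R n -> Cplx R) : (forall i, Symp (F i)) ->
  Symp (fun w => \prod_(i <- r) F i w).
Proof.
move=> hF; elim: r => [|i r IH].
  by under eq_fun do rewrite big_nil; exact: Symp_cst.
by under eq_fun do rewrite big_cons; exact: SympM.
Qed.

Lemma SympX F m : Symp F -> Symp (fun w => F w ^+ m).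
Proof.
move=> hF; elim: m => [|m IH].
  by under eq_fun do rewrite expr0; exact: Symp_cst.
by under eq_fun do rewrite exprS; exact: SympM.
Qed.

Lemma Symp_monomial (i : multiindex n) : Symp (monomial i).
Proof. by apply: Symp_prod => k; apply: SympX; exact: Symp_coord. Qed.

Lemma Symp_conj_cexp b : Symp (fun w => cexp (dotc b (conjv w))).
Proof.
have := Symp_conj (Symp_cexp (conjv b)).
by under eq_fun do rewrite conj_cexp conj_dotc conjvK dotcC.
Qed.

Lemma Symp_cintble F : Symp F -> cintble (@gauss R n) F.
Proof.
move=> [mF hF]; have h2 : 0 < 2^-1 :> R by rewrite invr_gt0.
have [K K0 hK] := hF _ h2.
apply: (cintble_dom mF hK); apply: intR_Z; apply: intR_exp.
by rewrite invf_lt1// ltr1n.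
Qed.

(* Rotation invariance turns the Gaussian mean into an average of circle means *)
Lemma gauss_mean F : Symp F -> lholo F -> cint (@gauss R n) F = F 0.
Proof.
move=> sF hF; have [mF gF] := sF.
have mean w : cintI (- pi) pi (fun t => F (cexp (0 +i* t) *: w)) = F 0 * (pi + pi)%:C.
  have dG p : cdiff (fun x : Cplx R => F (x *: w)) p.
    by have := hF 0 w p; congr cdiff; apply/funext => x; rewrite add0r.
  by have := circle_mean dG; rewrite scale0r.
have pp : - pi <= pi :> R by have := pi_gt0 R; lra.
have h2 : 0 < 2^-1 :> R by rewrite invr_gt0.
have [K K0 hK] := gF _ h2.
have e1 (t : R) : nm (cexp (0 +i* t)) = 1 by rewrite nm_cexp expR0.
pose g (p : measurableTypeR R * Cn R n) := \1_(`[- pi, pi[%classic) p.1 * (K * expR (2^-1 * sqnorm p.2)).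
pose Q (p : measurableTypeR R * Cn R n) := icut (- pi) pi (fun t => F (cexp (0 +i* t) *: p.2)) p.1.
have i1 : intR (@lebesgue_measure R) (fun t => \1_(`[- pi, pi[%classic) t : R).
  exact: integrable_indic_itv.
have i2 : intR (@gauss R n) (fun w => K * expR (2^-1 * sqnorm w)).
  by apply: intR_Z; apply: intR_exp; rewrite invf_lt1// ltr1n.
have [|||t|w|_] := @cfubini _ _ _ _ _ (@lebesgue_measure R) (@gauss R n) Q g.
- apply: cmeasM.
    apply: cmeas_real; exact: (measurableT_comp (intR_meas i1) measurable_fst).
  apply: (cmeas_comp mF); apply: measurable_Cn => k.
  under eq_fun do rewrite mxE.
  apply: cmeasM; last exact: (cmeas_comp (cmeas_coord k) measurable_snd).
  apply: cmeas_cexp; split => //=; exact: measurable_fst.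
- move=> [t w]; rewrite /Q /icut /g /= nmM nmR ger0_norm//.
  apply: ler_wpM2l => //; apply: (le_trans (hK _)).
  by rewrite sqnormZ e1 expr1n mul1r.
- have g0 (w : Cn R n) : 0 <= K * expR (2^-1 * sqnorm w) by exact: mulr_ge0 K0 (expR_ge0 _).
  by apply: (intR_prod _ g0 i1 i2).
- exact: (intR_Z (\1_(`[- pi, pi[%classic) t) i2).
- have := intR_Z (K * expR (2^-1 * sqnorm w)) i1.
  by congr intR; apply/funext => t; rewrite mulrC.
(* Integrating over the angle first, the circle means give 2 pi F 0. Integrating over w first,
   rotation invariance makes the inner integral independent of the angle. *)
rewrite [RHS](_ : _ = F 0 * (pi + pi)%:C); last first.
  by rewrite -[RHS](cint_cst _ (@gauss_setT R n)); apply: eq_cint => w; rewrite -(mean w).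
have iF := Symp_cintble sF.
rewrite (_ : (fun x => cint _ _) = icut (- pi) pi (fun=> cint (@gauss R n) F)); last first.
  apply/funext => t; rewrite /Q /icut /= cintZ.
    by rewrite -(cint_gauss_scale (e1 t) iF).
  have [mH pH] := mpres_gauss_scale (n := n) (e1 t).
  by apply: (cintble_pushforward mH _ iF) => A mA; rewrite pH.
rewrite -[LHS]/(cintI (- pi) pi (fun=> cint (@gauss R n) F)) cintI_cst// opprK.
apply: mulIf; rewrite eq_complex /= negb_and; apply/orP; left.
by apply/lt0r_neq0; have := pi_gt0 R; lra.
Qed.

(** After the translation by z the density factor and the kernel combine to e^{- w . conj z}, which
    is holomorphic in w and equals 1 at the origin, so that [gauss_mean] applies to the whole
    integrand. *)
Lemma reproducing F z : Symp F -> lholo F ->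
  cint (@gauss R n) (fun w => F w * cexp (dotc z (conjv w))) = F z.
Proof.
move=> sF hF.
rewrite (cint_gauss_shift z); last by apply: Symp_cintble; apply: SympM => //; exact: Symp_conj_cexp.
rewrite (_ : (fun w => _) = (fun w => F (w + z) * cexp (dotc w (- conjv z)))).
  rewrite gauss_mean.
  - by rewrite dotc0l cexp0 mulr1 add0r.
  - by apply: SympM; [exact: Symp_shift|exact: Symp_cexp].
  - by apply: lholoM; [exact: lholo_shift|exact: lholo_cexp].
apply/funext => w; rewrite -mulrA -cexp_real -cexpD; congr (_ * cexp _).
rewrite conjvD dotcDr dotcNr dotcJ.
apply: cplx_eq; rewrite !cplxE /=.
  by rewrite (Re_dotcC z w); ring.
have : Im (dotc z (conjv w)) = - Im (dotc w (conjv z)).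
  by rewrite -Im_conjc conj_dotc conjvK dotcC.
by move=> ->; ring.
Qed.
End symp.

(** * Power series over multi-indices *)

Section ccvg_prod.
Context {R : realType}.

Lemma ccvg_cst (c : Cplx R) : ccvg (fun=> c) c.
Proof. by apply: (@ccvg_squeeze _ _ _ (cst 0)) => [k|]; [rewrite subrr nm0|exact: cvg_cst]. Qed.

Lemma ccvgD (u w : nat -> Cplx R) a b :
  ccvg u a -> ccvg w b -> ccvg (fun k => u k + w k) (a + b).
Proof.
move=> ua wb; apply: (ccvg_squeeze (b := fun k => nm (u k - a) + nm (w k - b))).
  by move=> k; rewrite opprD addrACA; exact: nmD.
by rewrite -[X in _ --> X](addr0 (0 : R)); exact: cvgD.
Qed.

Lemma ccvgM (u w : nat -> Cplx R) a b : ccvg u a -> ccvg w b -> ccvg (fun k => u k * w k) (a * b).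
Proof.
move=> ua wb; apply: (@ccvg_squeeze _ _ _
  (fun k => nm (u k - a) * nm (w k - b) + nm a * nm (w k - b) + nm b * nm (u k - a))).
  move=> k; rewrite (_ : _ - _ = (u k - a) * (w k - b) + a * (w k - b) + b * (u k - a)); last by ring.
  by rewrite (le_trans (nmD _ _))// -!nmM lerD2r nmD.
rewrite -[0 : R](_ : 0 * 0 + nm a * 0 + nm b * 0 = 0); last by ring.
by apply: cvgD; [apply: cvgD|]; apply: cvgM => //; exact: cvg_cst.
Qed.

Lemma ccvg_prod I (r : seq I) (u : I -> nat -> Cplx R) l : (forall i, ccvg (u i) (l i)) ->
  ccvg (fun k => \prod_(i <- r) u i k) (\prod_(i <- r) l i).
Proof.
move=> ul; elim: r => [|i r IH].
  by rewrite big_nil; under eq_fun do rewrite big_nil; exact: ccvg_cst.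
by rewrite big_cons; under eq_fun do rewrite big_cons; exact: ccvgM.
Qed.

Lemma ccvg_conj (u : nat -> Cplx R) l : ccvg u l -> ccvg (fun k => conjc (u k)) (conjc l).
Proof.
by rewrite /ccvg => ul; under eq_fun do rewrite -conjN -conjD nmJ.
Qed.
End ccvg_prod.

Section msum.
Context {R : realType} {n : nat}.
Implicit Types (x : multiindex n -> Cplx R) (s : Cplx R) (A B : {fset multiindex n}).
Local Open Scope fset_scope.

Definition mindex_of_ord N (l : {ffun 'I_n -> 'I_N}) : multiindex n := [ffun k => (l k : nat)].

(** Cubes are cofinal among the finite sets of multi-indices, and over a cube a sum of products
    factors into one-variable sums ([box_prod]). *)
Definition box N : {fset multiindex n} :=
  [fset mindex_of_ord l | l in {: {ffun 'I_n -> 'I_N}}].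

Lemma in_box N (i : multiindex n) : (i \in box N) = [forall k, (i k < N)%N].
Proof.
apply/imfsetP/forallP => [[l _ ->] k|H]; first by rewrite ffunE ltn_ord.
exists [ffun k => Ordinal (H k)] => //.
by apply/ffunP => k; rewrite !ffunE.
Qed.

Lemma box_sum (V : zmodType) N (F : multiindex n -> V) :
  (\sum_(i <- box N) F i = \sum_(l : {ffun 'I_n -> 'I_N}) F (mindex_of_ord l))%R.
Proof.
rewrite big_imfset /=; first by rewrite big_enum.
move=> l m _ _ /ffunP H; apply/ffunP => k; apply/val_inj.
by have := H k; rewrite !ffunE.
Qed.

Lemma box_large A : exists N0, forall N, (N0 <= N)%N -> A `<=` box N.
Proof.
exists (\sum_(i <- A) \sum_k i k).+1%N => N hN.
apply/fsubsetP => i iA; rewrite in_box; apply/forallP => k.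
apply: (leq_trans _ hN); rewrite ltnS (big_fsetD1 i)//= (bigD1 k)//=.
by rewrite -addnA leq_addr.
Qed.

Lemma partial_sumE x A : summability.partial_sum x A = (\sum_(i <- A) x i)%R.
Proof. by rewrite big_seq_fsetE. Qed.

Lemma fset_split (V : zmodType) A B (F : multiindex n -> V) : A `<=` B ->
  (\sum_(i <- B) F i = \sum_(i <- A) F i + \sum_(i <- B `\` A) F i)%R.
Proof.
move=> AB; rewrite (big_fsetID _ (mem A)) /=; congr (_ + _)%R; apply: eq_fbigl => i.
  by rewrite !inE /= andbC; case: (boolP (i \in A)) => //= iA; rewrite (fsubsetP AB).
by rewrite !inE /= andbC.
Qed.

Lemma has_msumP x s : (forall e : R, (0 < e)%R -> exists A, forall B, A `<=` B ->
    (nm ((\sum_(i <- B) x i) - s) < e)%R) <-> has_msum x s.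
Proof.
have PF := @summability.totally_filter (multiindex n).
split=> [H|].
  apply/cvgrPdist_lt => e e0.
  have e0' : (0 < Re e)%R by move: e0; rewrite ltcE => /andP[].
  have eE : e = (Re e)%:C by move: e0; rewrite ltcE => /andP[/eqP d1 _]; apply: cplx_eq.
  have [A hA] := H _ e0'.
  exists A => // B AB /=; rewrite norm_nm eE ltcR partial_sumE nmB; exact: hA.
move=> /cvgrPdist_lt H e e0.
have e0' : (0 < e%:C :> Cplx R)%R by rewrite ltcR.
have [A _ hA] := H _ e0'; exists A => B AB.
by have := hA B AB; rewrite /= norm_nm ltcR partial_sumE nmB.
Qed.

Lemma msum_box x s : has_msum x s -> ccvg (fun N => \sum_(i <- box N) x i)%R s.
Proof.
move=> /has_msumP H; apply/cvgrPdist_lt => e e0; have [A hA] := H _ e0.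
have [N0 hN] := box_large A; exists N0 => // N /= /hN /hA.
by rewrite sub0r normrN ger0_norm// nm_ge0.
Qed.

(** The bound on the absolute sums makes the net of all finite partial sums Cauchy; the cubes
    identify its limit. *)
Lemma box_msum x s (M : R) : (forall A, (\sum_(i <- A) nm (x i) <= M)%R) ->
  ccvg (fun N => \sum_(i <- box N) x i)%R s -> has_msum x s.
Proof.
move=> hM xs; apply/has_msumP => e e0.
have e3 : (0 < e / 3)%R by rewrite divr_gt0.
pose T := [set t : R | exists A, t = (\sum_(i <- A) nm (x i))%R]%classic.
have supT : has_sup T.
  split; first by exists (\sum_(i <- fset0) nm (x i))%R, fset0.
  by exists M => _ [A ->].
(* The absolute sum over [A0] is within e / 3 of the supremum, so disjoint finite sets add less than
   e / 3. *)
have [_ [A0 ->] hA0] := sup_adherent e3 supT.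
have tail B : A0 `<=` B -> (nm (\sum_(i <- B) x i - \sum_(i <- A0) x i) < e / 3)%R.
  move=> AB; rewrite (fset_split _ AB) addrAC subrr add0r (le_lt_trans (nm_sum _ _ _))//.
  have : (\sum_(i <- B) nm (x i) <= sup T)%R by apply: sup_upper_bound => //; exists B.
  by rewrite (fset_split _ AB); lra.
exists A0 => B AB.
have [N0 hN0] := box_large A0.
move/cvgrPdist_lt: xs => /(_ _ e3)[N1 _ hN1].
have := hN1 (maxn N0 N1) (leq_maxr _ _); rewrite /= sub0r normrN ger0_norm ?nm_ge0// => h1.
have h2 := tail _ (hN0 _ (leq_maxl N0 N1)).
have h3 := tail _ AB.
rewrite (_ : _ - s = (\sum_(i <- B) x i - \sum_(i <- A0) x i)
  - (\sum_(i <- box (maxn N0 N1)) x i - \sum_(i <- A0) x i)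
  + (\sum_(i <- box (maxn N0 N1)) x i - s))%R; last first.
  by move: (\sum_(i <- B) x i)%R (\sum_(i <- A0) x i)%R (\sum_(i <- box _) x i)%R => p q r; ring.
apply: (le_lt_trans (nmD _ _)); apply: (le_lt_trans (lerD (nmD _ _) (lexx _))).
by rewrite nmN; move: h1 h2 h3; lra.
Qed.

(** Termwise integration of an unordered series. The bound on the absolute sums of the integrals is
    returned as well: through [power_expansion_coef] it dominates the series in [star_op_sfun]. *)
Lemma msum_int (X : multiindex n -> Cn R n -> Cplx R) (Y : Cn R n -> Cplx R) (D : Cn R n -> R) :
  (forall i, cmeas (X i)) -> cmeas Y -> intR (@gauss R n) D ->
  (forall A w, (\sum_(i <- A) nm (X i w) <= D w)%R) ->
  (forall w, ccvg (fun N => \sum_(i <- box N) X i w)%R (Y w)) ->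
  (forall A, (\sum_(i <- A) nm (cint (@gauss R n) (X i)) <= 2 * \int[@gauss R n]_w D w)%R) /\
  has_msum (fun i => cint (@gauss R n) (X i)) (cint (@gauss R n) Y).
Proof.
move=> mX mY iD XD XY.
have iX i : cintble (@gauss R n) (X i).
  apply: (cintble_dom (mX i) _ iD) => w.
  by have := XD [fset i] w; rewrite big_seq_fset1.
have bnd A : (\sum_(i <- A) nm (cint (@gauss R n) (X i)) <= 2 * \int[@gauss R n]_w D w)%R.
  apply: (@le_trans _ _ (\sum_(i <- A) 2 * \int[@gauss R n]_w nm (X i w))%R).
    by apply: ler_sum => i _; exact: nm_cint.
  rewrite -mulr_sumr; apply: ler_wpM2l => //.
  have E (r : seq (multiindex n)) : intR (@gauss R n) (fun w => \sum_(i <- r) nm (X i w))%R /\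
      (\int[@gauss R n]_w (\sum_(i <- r) nm (X i w)) = \sum_(i <- r) \int[@gauss R n]_w nm (X i w))%R.
    elim: r => [|i r [IH1 IH2]].
      split; first by under eq_fun do rewrite big_nil; rewrite /intR /=; exact: integrable0.
      by rewrite big_nil; under eq_Rintegral do rewrite big_nil; rewrite Rintegral_cst// mul0r.
    have inX := cintble_nm (iX i).
    split; first by under eq_fun do rewrite big_cons; exact: intR_D.
    by rewrite big_cons -IH2; under eq_Rintegral do rewrite big_cons; rewrite RintegralD.
  have [E1 <-] := E (A : seq _); apply: le_Rintegral => // w _; exact: XD.
split=> //; apply: (box_msum bnd).
under eq_fun do rewrite -cint_sum//.
apply: (@cint_dct _ _ _ _ (fun N w => \sum_(i <- box N) X i w)%R Y D) => //.
  by move=> N; apply: cmeas_sum.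
by move=> N w; rewrite (le_trans (nm_sum _ _ _))//; exact: XD.
Qed.

End msum.

(** * Taylor coefficients as Gaussian integrals *)

Section power_series.
Context {R : realType} {n : nat}.
Implicit Types (v : Cn R n -> Cplx R) (z w : Cn R n).

Definition mfact (i : multiindex n) : Cplx R := \prod_k (i k)`!%:R.

(** The inner product with w^i divided by i!, which is the squared norm of w^i in the Fock space. *)
Definition coef v (i : multiindex n) : Cplx R :=
  (mfact i)^-1 * cint (@gauss R n) (fun w => v w * conjc (monomial i w)).

Lemma box_prod (V : comPzRingType) N (t : 'I_n -> nat -> V) :
  \sum_(i <- box N) \prod_k t k (i k) = \prod_k \sum_(j < N) t k j.
Proof.
rewrite box_sum bigA_distr_bigA /=.
by apply: eq_bigr => l _; apply: eq_bigr => k _; rewrite ffunE.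
Qed.

Lemma exp_sum_le (t : R) N : 0 <= t -> \sum_(j < N) t ^+ j / j`!%:R <= expR t.
Proof.
move=> t0; rewrite /expR -(big_mkord xpredT (fun j => t ^+ j / j`!%:R)).
apply: (@nondecreasing_cvgn_le _ (series (exp_coeff t))).
  apply/nondecreasing_seqP => k; rewrite -subr_ge0 /series /= big_nat_recr//= addrAC subrr add0r.
  exact: exp_coeff_ge0.
exact: is_cvg_series_exp_coeff.
Qed.

Definition exp_term z w (i : multiindex n) : Cplx R :=
  \prod_k ((z ord0 k * conjc (w ord0 k)) ^+ i k / (i k)`!%:R).

Lemma exp_termE z w i : exp_term z w i = monomial i z * ((mfact i)^-1 * conjc (monomial i w)).
Proof.
rewrite /exp_term /mfact /monomial conj_prod -prodfV -!big_split /=.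
by apply: eq_bigr => k _; rewrite exprMn conjX; ring.
Qed.

Lemma exp_term_le z w (A : {fset multiindex n}) :
  \sum_(i <- A) nm (exp_term z w i) <= \prod_k expR (nm (z ord0 k) * nm (w ord0 k)).
Proof.
have [N hN] := box_large A.
have t0 k : 0 <= nm (z ord0 k) * nm (w ord0 k) by rewrite mulr_ge0 ?nm_ge0.
have E i : nm (exp_term z w i) = \prod_k ((nm (z ord0 k) * nm (w ord0 k)) ^+ i k / (i k)`!%:R).
  rewrite /exp_term nm_prod; apply: eq_bigr => k _.
  by rewrite nmM nmV nm_nat nmX nmM nmJ.
apply: (@le_trans _ _ (\sum_(i <- box N) nm (exp_term z w i))).
  by rewrite (fset_split _ (hN N (leqnn N))) lerDl sumr_ge0// => i _; exact: nm_ge0.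
rewrite (eq_bigr _ (fun i _ => E i)).
rewrite (box_prod N (fun k j => (nm (z ord0 k) * nm (w ord0 k)) ^+ j / j`!%:R)).
apply: ler_prod => k _; rewrite exp_sum_le// andbT.
by apply: sumr_ge0 => j _; rewrite divr_ge0// exprn_ge0.
Qed.

Lemma exp_term_cvg z w : ccvg (fun N => \sum_(i <- box N) exp_term z w i) (cexp (dotc z (conjv w))).
Proof.
rewrite /exp_term; under eq_fun => N.
  rewrite (box_prod N (fun k j => (z ord0 k * conjc (w ord0 k)) ^+ j / j`!%:R)); over.
rewrite /dotc cexp_sum; apply: ccvg_prod => k; rewrite conjvE; exact: ccvg_cexp.
Qed.

(** Young's inequality for moduli of coordinates, as the absolute sums of the kernel series are
    bounded by this product; the difference of the exponents in coordinate k is (t |z_k| - |w_k|)^2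
    / (2 t). *)
Lemma prod_exp_le (t : R) z w : 0 < t -> \prod_k expR (nm (z ord0 k) * nm (w ord0 k)) <=
  expR (t / 2 * sqnorm z + t^-1 / 2 * sqnorm w).
Proof.
move=> t0; rewrite -expR_sum ler_expR !sqnorm_sum !mulr_sumr -big_split /=.
apply: ler_sum => k _.
have : 0 <= (t * nm (z ord0 k) - nm (w ord0 k)) ^+ 2 by rewrite sqr_ge0.
move: (nm (z ord0 k)) (nm (w ord0 k)) => a b h.
rewrite -subr_ge0 (_ : _ - _ = (2 * t)^-1 * (t * a - b) ^+ 2).
  by apply: mulr_ge0 h; rewrite invr_ge0 mulr_ge0// ltW.
by field; rewrite gt_eqF.
Qed.

(** The kernel series is integrated termwise in the reproducing formula. The coefficient 1/3 in the
    bound is below 1/2, so the bound stays integrable when z is replaced by w - a in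
    [star_op_sfun]. *)
Lemma power_expansion_coef v : Symp v -> lholo v ->
  power_expansion (coef v) v /\
  exists2 M : R, 0 <= M & forall z (A : {fset multiindex n}),
    \sum_(i <- A) nm (coef v i * monomial i z) <= M * expR (3^-1 * sqnorm z).
Proof.
move=> sv hv; have [mv gv] := sv.
have e8 : 0 < 8^-1 :> R by rewrite invr_gt0.
have [K K0 hK] := gv _ e8.
(* With weight 2/3 the kernel costs |z|^2 / 3 and 3 |w|^2 / 4; the growth |w|^2 / 8 of [v] brings
   the latter to 7/8. *)
pose D z w := K * expR (3^-1 * sqnorm z) * expR (7 / 8 * sqnorm w).
have i78 : intR (@gauss R n) (fun w => expR (7 / 8 * sqnorm w)).
  by apply: intR_exp; lra.
have iD z : intR (@gauss R n) (D z) by exact: intR_Z.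
have XE z i : cint (@gauss R n) (fun w => v w * exp_term z w i) = coef v i * monomial i z.
  rewrite /coef -mulrA [cint _ _ * _]mulrC mulrA -cintZ.
    by apply: eq_cint => w; rewrite exp_termE; ring.
  by apply: Symp_cintble; apply: SympM => //; apply: Symp_conj; exact: Symp_monomial.
have P z := @msum_int R n (fun i w => v w * exp_term z w i) (fun w => v w * cexp (dotc z (conjv w))) (D z).
have H z : (forall A : {fset multiindex n}, \sum_(i <- A) nm (coef v i * monomial i z) <= 2 * \int[@gauss R n]_w D z w)
   /\ has_msum (fun i => coef v i * monomial i z) (v z).
  have [||||| H1 H2] := P z.
  - move=> i; under eq_fun do rewrite exp_termE.
    apply: cmeasM => //; apply: cmeasM; first exact: cmeas_cst.
    apply: cmeasM; first exact: cmeas_cst.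
    by apply: cmeas_conj; have [] := Symp_monomial (R := R) i.
  - by apply: cmeasM => //; have [] := Symp_conj_cexp z.
  - exact: iD.
  - move=> A w; under eq_bigr do rewrite nmM; rewrite -mulr_sumr.
    have t23 : 0 < 2 / 3 :> R by rewrite divr_gt0.
    have := ler_pM (nm_ge0 _) (sumr_ge0 _ (fun i _ => nm_ge0 _)) (hK w)
      (le_trans (exp_term_le z w A) (prod_exp_le z w t23)).
    move=> /le_trans; apply; rewrite /D -!mulrA -!expRD le_eqVlt; apply/orP; left; apply/eqP.
    by congr (_ * expR _); field.
  - move=> w; under eq_fun do rewrite -mulr_sumr.
    by apply: ccvgM; [exact: ccvg_cst|exact: exp_term_cvg].
  split=> [A|]; first by have := H1 A; under eq_bigr do rewrite XE.
  by move: H2; rewrite reproducing//; under eq_fun do rewrite XE.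
split; first by move=> z; have [] := H z.
exists (2 * K * \int[@gauss R n]_w expR (7 / 8 * sqnorm w)).
  by rewrite !mulr_ge0// Rintegral_ge0// => w _; exact: expR_ge0.
move=> z A; apply: (le_trans ((H z).1 A)); rewrite /D RintegralZl//.
by rewrite le_eqVlt; apply/orP; left; apply/eqP; ring.
Qed.

End power_series.

(** * Integral form of the differential operator *)

Section mpartial.
Context {R : realType} {n : nat}.
Implicit Types (f F Phi : Cn R n -> Cplx R) (z w a : Cn R n) (k : 'I_n).

(** Dominates the exponential factors of the difference quotients in direction k, for increments of
    modulus below 1. *)
Lemma Symp_expnm k : Symp (fun w : Cn R n => (expR (nm (w ord0 k)))%:C).
Proof.
split.
  apply: cmeas_real; apply: (measurableT_comp (@measurable_expR R)).
  exact: cmeas_nm (cmeas_coord k).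
move=> c c0; exists (expR (c^-1)); first exact: expR_ge0.
move=> z; rewrite nmR ger0_norm ?expR_ge0// -expRD ler_expR.
have h : nm (z ord0 k) ^+ 2 <= sqnorm z.
  by rewrite sqnorm_sum (bigD1 k)//= lerDl sumr_ge0// => i _; rewrite sqr_ge0.
have h1 : c * nm (z ord0 k) ^+ 2 <= c * sqnorm z by apply: ler_wpM2l => //; exact: ltW.
apply: (le_trans _ (lerD (lexx _) h1)).
move: (nm _) (nm_ge0 (z ord0 k)) => t t0.
rewrite -subr_ge0 (_ : _ - t = c^-1 * (1 - c * t / 2) ^+ 2 + c * (3 / 4) * t ^+ 2); last first.
  by field; rewrite gt_eqF.
have c1 : 0 < c^-1 by rewrite invr_gt0.
have c2 : 0 <= c * (3 / 4) by lra.
by apply: addr_ge0; apply: mulr_ge0; rewrite ?sqr_ge0// ltW.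
Qed.

(** Differentiation under the integral sign: by [cexp_diff2] the second-order remainder of e^{h conj
    a_k} is quadratic in h, with an integrable factor. *)
Lemma partial_int Phi k z : Symp Phi ->
  partial k (fun x => cint (@gauss R n) (fun a => Phi a * cexp (dotc x (conjv a)))) z =
  cint (@gauss R n) (fun a => Phi a * conjc (a ord0 k) * cexp (dotc z (conjv a))).
Proof.
move=> sP; pose E x (a : Cn R n) := cexp (dotc x (conjv a)).
have sE x : Symp (E x) by exact: Symp_conj_cexp.
have sK : Symp (fun a : Cn R n => conjc (a ord0 k)) by apply: Symp_conj; exact: Symp_coord.
(* Up to the factor 2 |h|^2, [B] dominates the integrand of the remainder as soon as |h| < 1. *)
pose B a := Phi a * E z a * (conjc (a ord0 k) : Cplx R) ^+ 2 * (expR (nm (a ord0 k)))%:C.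
have sB : Symp B.
  apply: SympM; last exact: Symp_expnm.
  by apply: SympM; [exact: SympM|exact: SympX].
have iB := Symp_cintble sB.
set I0 := \int[@gauss R n]_a nm (B a).
have I00 : 0 <= I0 by apply: Rintegral_ge0 => a _; exact: nm_ge0.
set L := cint _ (fun a => Phi a * conjc (a ord0 k) * _).
rewrite /partial /derive; apply: cvg_lim => //.
apply/cvgrPdist_lt => e e0.
have e0' : 0 < Re e by move: e0; rewrite ltcE => /andP[].
have eE : e = (Re e)%:C by move: e0; rewrite ltcE => /andP[/eqP d1 _]; apply: cplx_eq.
(* The 4 is the product of the factors 2 of [nm_cint] and [cexp_diff2]; the summand 1 keeps the
   denominator positive. *)
pose d := Num.min 1 (Re e / (4 * I0 + 1)).
have I1 : 0 < 4 * I0 + 1 by rewrite ltr_wpDl// mulr_ge0.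
have d0 : 0 < d by rewrite lt_min ltr01 divr_gt0.
exists d%:C => /=; first by rewrite ltcR.
move=> h; rewrite /ball_ /= sub0r normrN norm_nm ltcR lt_min => /andP[h1 h2] h0.
rewrite norm_nm eE ltcR.
have hn0 : 0 < nm h.
  rewrite lt_neqAle nm_ge0 andbT eq_sym; apply: contra h0 => /eqP/nm0_eq0 ->//.
suff : nm h * nm (L - h^-1 *: (cint (@gauss R n) (fun a => Phi a * E (h *: delta_mx ord0 k + z) a)
    - cint (@gauss R n) (fun a => Phi a * E z a))) <= nm h * (nm h * (4 * I0)).
  rewrite ler_pM2l// => /le_lt_trans; apply.
  rewrite (le_lt_trans (y := nm h * (4 * I0 + 1)))//; last by rewrite -ltr_pdivlMr.
  by apply: ler_wpM2l; [exact: nm_ge0|rewrite lerDl].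
rewrite -nmM.
have Eh a : E (h *: delta_mx ord0 k + z) a = E z a * cexp (h * conjc (a ord0 k)).
  rewrite /E dotcDl addrC cexpD; congr (_ * cexp _).
  rewrite dotcZl; congr (_ * _); rewrite /dotc (bigD1 k)//= big1 ?addr0.
    by rewrite mxE !eqxx mul1r conjvE.
  by move=> i ik; rewrite mxE (negbTE ik) andbF mul0r.
have -> : h * (L - h^-1 *: (cint (@gauss R n) (fun a => Phi a * E (h *: delta_mx ord0 k + z) a)
    - cint (@gauss R n) (fun a => Phi a * E z a))) =
   cint (@gauss R n) (fun a => Phi a * E z a * - (cexp (h * conjc (a ord0 k)) - 1 - h * conjc (a ord0 k))).
  rewrite mulrBr /GRing.scale /= mulrA divff ?mul1r//.
  rewrite -cintB; [|by apply: Symp_cintble; exact: SympM..].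
  rewrite -cintZ; last by apply: Symp_cintble; apply: SympM; [exact: SympM|exact: sE].
  rewrite -cintB; first last.
  - apply: Symp_cintble; apply: SympD; first exact: SympM.
    by apply: SympN; exact: SympM.
  - by apply: Symp_cintble; apply: SympM; [exact: Symp_cst|apply: SympM; [exact: SympM|exact: sE]].
  by apply: eq_cint => a; rewrite Eh -/(E z a); ring.
have iI : cintble (@gauss R n) (fun a => Phi a * E z a * - (cexp (h * conjc (a ord0 k)) - 1 - h * conjc (a ord0 k))).
  have -> : (fun a => Phi a * E z a * - (cexp (h * conjc (a ord0 k)) - 1 - h * conjc (a ord0 k))) =
    (fun a => Phi a * E z a * (1 + h * conjc (a ord0 k)) - Phi a * E (h *: delta_mx ord0 k + z) a).
    by apply/funext => a; rewrite Eh; ring.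
  apply: Symp_cintble; apply: SympD.
    apply: SympM; first exact: SympM.
    apply: SympD; first exact: Symp_cst.
    by apply: SympM => //; exact: Symp_cst.
  by apply: SympN; exact: SympM.
apply: (le_trans (nm_cint iI)).
have -> : nm h * (nm h * (4 * I0)) = 2 * (2 * nm h ^+ 2 * I0) by ring.
apply: ler_wpM2l => //; rewrite -RintegralZl//; last exact: cintble_nm.
apply: le_Rintegral => //; first exact: cintble_nm.
  by apply: intR_Z; exact: cintble_nm.
move=> a _.
have -> : nm (B a) = nm (Phi a) * nm (E z a) * nm (a ord0 k) ^+ 2 * expR (nm (a ord0 k)).
  rewrite /B (nmM (_ * _ * _)) nmR (ger0_norm (expR_ge0 _)).
  by rewrite (nmM (Phi a * _)) (nmM (Phi a)) nmX nmJ.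
rewrite (nmM (Phi a * E z a)) (nmM (Phi a)) nmN.
have := cexp_diff2 (h * conjc (a ord0 k)); rewrite nmM nmJ => hb.
have pq := mulr_ge0 (nm_ge0 (Phi a)) (nm_ge0 (E z a)).
apply: (le_trans (ler_wpM2l pq hb)).
have hm : expR (nm h * nm (a ord0 k)) <= expR (nm (a ord0 k)).
  by rewrite ler_expR ler_piMl ?nm_ge0// ltW.
move: (nm (Phi a)) (nm_ge0 (Phi a)) (nm (E z a)) (nm_ge0 (E z a)) => p p0 q q0.
move: (expR (nm h * nm (a ord0 k))) (expR (nm (a ord0 k))) hm => x y xy.
move: (nm h) => t.
rewrite (_ : p * q * (2 * x * (t * nm (a ord0 k)) ^+ 2) = (2 * p * q * (t * nm (a ord0 k)) ^+ 2) * x); last by ring.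
rewrite (_ : 2 * t ^+ 2 * _ = (2 * p * q * (t * nm (a ord0 k)) ^+ 2) * y); last by ring.
apply: ler_wpM2l => //; apply: mulr_ge0; last exact: sqr_ge0.
by rewrite !mulr_ge0.
Qed.

Lemma iter_partial Phi k m : Symp Phi ->
  iter m (partial k) (fun x => cint (@gauss R n) (fun a => Phi a * cexp (dotc x (conjv a)))) =
  fun x => cint (@gauss R n) (fun a => Phi a * (conjc (a ord0 k) : Cplx R) ^+ m * cexp (dotc x (conjv a))).
Proof.
move=> sP; elim: m => [|m IH] /=.
  by apply/funext => x; apply: eq_cint => a; rewrite expr0 mulr1.
rewrite IH; apply/funext => x; rewrite partial_int.
  by apply: eq_cint => a; rewrite exprSr mulrA.
by apply: SympM => //; apply: SympX; apply: Symp_conj; exact: Symp_coord.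
Qed.

(** Starting from the reproducing formula for [f], each derivative in direction k brings down a
    factor conj a_k. *)
Lemma mpartial_int f (j : multiindex n) : Symp f -> lholo f ->
  mpartial j f = fun z => cint (@gauss R n) (fun a =>
    f a * conjc (monomial j a) * cexp (dotc z (conjv a))).
Proof.
move=> sf hf; rewrite /mpartial.
have H (s : seq 'I_n) : foldr (fun k => iter (j k) (partial k)) f s =
   fun z => cint (@gauss R n) (fun a => f a * (\prod_(k <- s) (conjc (a ord0 k) : Cplx R) ^+ j k)
     * cexp (dotc z (conjv a))).
  elim: s => [|k s IH] /=.
    apply/funext => z; rewrite -{1}(reproducing z sf hf); apply: eq_cint => a.
    by rewrite big_nil mulr1.
  rewrite IH iter_partial.
    by apply/funext => z; apply: eq_cint => a; rewrite big_cons; ring.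
  apply: SympM => //; apply: Symp_prod => i; apply: SympX; apply: Symp_conj; exact: Symp_coord.
rewrite H; apply/funext => z; apply: eq_cint => a; rewrite /monomial conj_prod big_enum /=.
by congr (_ * _ * _); apply: eq_bigr => k _; rewrite conjX.
Qed.

(** The range is padded up to [N] with vanishing binomial coefficients, because [conj_sub_partial]
    uses one index type, bounded by |i|, for all coordinates. *)
Lemma exprD_binN (x y : Cplx R) m N : (m <= N)%N ->
  (x - y) ^+ m = \sum_(l < N.+1) ('C(m, l)%:R * (-1) ^+ (m - l) * x ^+ l * y ^+ (m - l)).
Proof.
move=> mN; rewrite addrC exprDn.
rewrite (big_ord_widen N.+1 (fun l => (- y) ^+ (m - l) * x ^+ l *+ 'C(m, l)))//.
rewrite big_mkcond; apply: eq_bigr => l _; case: ifPn => [_|]; last first.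
  by rewrite -leqNgt => ml; rewrite bin_small// !mul0r.
by rewrite -mulr_natl (exprNn y) !mulrA mulrAC.
Qed.

(** Since each derivative becomes multiplication by conj a_k under the integral, the binomial
    formula in every coordinate reassembles conj ((z - a)^i). *)
Lemma conj_sub_partial_int f (i : multiindex n) z : Symp f -> lholo f ->
  conj_sub_partial i f z = cint (@gauss R n) (fun a =>
    f a * conjc (monomial i (z - a)) * cexp (dotc z (conjv a))).
Proof.
move=> sf hf.
have mdeg k : (i k <= mdegree i)%N by rewrite /mdegree (bigD1 k)//= leq_addr.
pose c (l : {ffun 'I_n -> 'I_(mdegree i).+1}) : Cplx R :=
  (\prod_k 'C(i k, l k))%:R * (-1) ^+ (\sum_k (i k - l k))%N * monomial [ffun k => l k : nat] (conjv z).
pose X l a := c l * (f a * conjc (monomial [ffun k => (i k - l k)%N] a) * cexp (dotc z (conjv a))).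
have sX l : Symp (fun a => f a * conjc (monomial [ffun k => (i k - nat_of_ord ((l : {ffun 'I_n -> 'I_(mdegree i).+1}) k))%N] a) * cexp (dotc z (conjv a))).
  apply: SympM; last exact: Symp_conj_cexp.
  by apply: SympM => //; apply: Symp_conj; exact: Symp_monomial.
transitivity (\sum_(l : {ffun 'I_n -> 'I_(mdegree i).+1}) cint (@gauss R n) (X l)).
  rewrite /conj_sub_partial big_mkcond; apply: eq_bigr => l _.
  rewrite /X cintZ; last exact: Symp_cintble.
  case: ifPn => [_|]; first by rewrite mpartial_int.
  rewrite negb_forall => /existsP[k]; rewrite -ltnNge => hk.
  by rewrite /c (bigD1 k)//= bin_small// mul0n !mul0r.
rewrite -cint_sum; last first.
  by move=> l; apply: Symp_cintble; apply: SympM => //; exact: Symp_cst.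
apply: eq_cint => a; rewrite /X.
transitivity (f a * (\sum_(l : {ffun 'I_n -> 'I_(mdegree i).+1})
    c l * conjc (monomial [ffun k => (i k - l k)%N] a)) * cexp (dotc z (conjv a))).
  by rewrite mulr_sumr mulr_suml; apply: eq_bigr => l _; ring.
congr (_ * _ * _); rewrite /monomial conj_prod.
under [RHS]eq_bigr => k _ do rewrite conjX !mxE conjD conjN (exprD_binN _ _ (mdeg k)).
rewrite bigA_distr_bigA /=; apply: eq_bigr => l _.
rewrite /c natr_prod expr_sum /monomial conj_prod -!big_split /=.
by apply: eq_bigr => k _; rewrite !ffunE conjvE conjX.
Qed.
End mpartial.

Lemma ccvg_ccont {R : realType} (h : Cplx R -> Cplx R) (u : nat -> Cplx R) l :
  ccont h l -> ccvg u l -> ccvg (h \o u) (h l).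
Proof.
move=> hl ul; apply/cvgrPdist_lt => e e0; have [d d0 hd] := hl _ e0.
have H : \forall m \near \oo, nm (u m - l) < d by apply: (cvgr_lt _ ul _ d0).
apply: filterS H => m md; rewrite sub0r normrN ger0_norm ?nm_ge0//.
exact: hd.
Qed.

(** The rate in the hypothesis is that of points chosen by [ae_dense] with radii 1 / (m + 1). *)
Lemma entire_ccvg {R : realType} {n : nat} (F : Cn R n -> Cplx R) (x : nat -> Cn R n) (w : Cn R n) :
  entire F -> (forall m k, nm (x m ord0 k - w ord0 k) < m.+1%:R^-1) ->
  ccvg (F \o x) (F w).
Proof.
move=> eF xw; apply/cvgrPdist_lt => e e0.
have [r r0 hr] := entire_poly_cont w eF e0.
have H : \forall m \near \oo, (m.+1%:R : R)^-1 < r.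
  by apply: (cvgr_lt _ (@cvg_harmonic R) _ r0).
apply: filterS H => m mr; rewrite sub0r normrN ger0_norm ?nm_ge0//.
by apply: hr => k; exact: (lt_trans (xw m k)).
Qed.

Section star_symbol.
Context {R : realType} {n : nat}.
Variables (f v : Cn R n -> Cplx R).
Hypotheses (sf : Symp f) (hf : lholo f) (sv : Symp v) (hv : lholo v).
Implicit Types (z w a b : Cn R n).

Let Q (p : Cn R n * Cn R n) : Cplx R :=
  f p.2 * conjc (v (p.1 - p.2)) * cexp (dotc p.1 (conjv p.2)).

(* The value of [v^*(conj w - d) f (w)]: under the integral sign, [conj w - d]
   acts on [cexp (dotc w (conjv a))] as multiplication by [conj (w - a)]. *)
Definition sfun w : Cplx R := cint (@gauss R n) (fun a => Q (w, a)).

(** The power series of [v] at w - a is conjugated and integrated termwise against f(a) e^{w . conj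
    a}; [conj_sub_partial_int] identifies the terms. *)
Lemma star_op_sfun w : star_op_value v f w (sfun w).
Proof.
have [pe [M M0 hM]] := power_expansion_coef sv hv.
exists (coef v) => //.
pose E a := cexp (dotc w (conjv a)).
have sfE : Symp (fun a => f a * E a) by apply: SympM => //; exact: Symp_conj_cexp.
have e8 : 0 < 8^-1 :> R by rewrite invr_gt0.
have [K K0 hK] := sfE.2 _ e8.
pose X (i : multiindex n) a := (conjc (coef v i) : Cplx R) * (f a * conjc (monomial i (w - a)) * E a).
have mmon i : Symp (fun a => monomial i (w - a)).
  have := Symp_opp (Symp_shift w (Symp_monomial (R := R) i)).
  by under eq_fun do rewrite addrC.
have sX i : Symp (fun a => f a * conjc (monomial i (w - a)) * E a).
  by apply: SympM; [apply: SympM => //; exact: Symp_conj|exact: Symp_conj_cexp].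
have svw : Symp (fun a => v (w - a)).
  by have := Symp_opp (Symp_shift w sv); under eq_fun do rewrite addrC.
(* The bound e^{|w - a|^2 / 3} of the series costs 2/3 in each of |w|^2 and |a|^2; the growth 1/8 of
   f(a) e^{w . conj a} makes 19/24. *)
pose D a := K * (M * expR (2 / 3 * sqnorm w)) * expR (19 / 24 * sqnorm a).
have XE a i : X i a = f a * E a * conjc (coef v i * monomial i (w - a)).
  by rewrite /X conjM; ring.
have [||||| _] := @msum_int R n X (fun a => Q (w, a)) D.
- by move=> i; apply: cmeasM; [exact: cmeas_cst|exact: (sX i).1].
- by apply: cmeasM; [apply: cmeasM; [exact: sf.1|exact: (Symp_conj svw).1]|exact: (Symp_conj_cexp w).1].
- by apply: intR_Z; apply: intR_exp; lra.
- move=> A a.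
  have nE i : nm (X i a) = nm (f a * E a) * nm (coef v i * monomial i (w - a)).
    by rewrite XE nmM nmJ.
  rewrite (eq_bigr _ (fun i _ => nE i)) -mulr_sumr.
  apply: (le_trans (ler_pM (nm_ge0 _) (sumr_ge0 _ (fun i _ => nm_ge0 _)) (hK a) (hM (w - a) A))).
  rewrite /D mulrACA -!mulrA -!expRD; do 2 apply: ler_wpM2l => //.
  by rewrite ler_expR; have := sqnormB_le w a; lra.
- move=> a; under eq_fun do under eq_bigr do rewrite XE.
  under eq_fun do rewrite -mulr_sumr -conj_sum.
  rewrite /Q /= mulrAC; apply: ccvgM; first exact: ccvg_cst.
  by apply: ccvg_conj; apply: msum_box; exact: pe.
have -> : (fun i => cint (@gauss R n) (X i)) = (fun i => conjc (coef v i) * conj_sub_partial i f w).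
  apply/funext => i; rewrite conj_sub_partial_int// -cintZ//.
  exact: Symp_cintble (sX i).
exact.
Qed.

(** Growth 1/24 for [f] and [v] and weight 2/3 for the kernel give 1/3 + 1/12 = 5/12 for w and 3/4 +
    1/24 + 1/12 = 7/8 for a. As 5/12 < 1/2, [sfun] is square integrable; as 7/8 < 1, its integral
    converges. *)
Let Q_bound : exists2 C : R, 0 <= C & forall w a,
  nm (Q (w, a)) <= C * (expR (5 / 12 * sqnorm w) * expR (7 / 8 * sqnorm a)).
Proof.
have e24 : 0 < 24^-1 :> R by rewrite invr_gt0.
have [K K0 hK] := sf.2 _ e24; have [L L0 hL] := sv.2 _ e24.
exists (K * L); first exact: mulr_ge0.
move=> w a; rewrite /Q /= 2!nmM nmJ nm_cexp.
have h1 := ler_pM (nm_ge0 _) (nm_ge0 _) (hK a) (hL (w - a)).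
apply: (le_trans (ler_wpM2r (expR_ge0 _) h1)).
rewrite mulrACA -(mulrA (K * L)) -!expRD; apply: ler_wpM2l; first exact: mulr_ge0.
have t23 : 0 < 2 / 3 :> R by rewrite divr_gt0.
have := Re_dotc_le w (conjv a) t23; rewrite sqnormJ invf_div ler_expR.
by have := sqnormB_le w a; lra.
Qed.

Let cmeas_Q : cmeas Q.
Proof.
apply: cmeasM; first apply: cmeasM.
- exact: (cmeas_comp sf.1 measurable_snd).
- apply: cmeas_conj; apply: (cmeas_comp sv.1); apply: measurable_Cn => k.
  under eq_fun do rewrite !mxE.
  by apply: cmeasB; [exact: (cmeas_comp (cmeas_coord k) measurable_fst)|
    exact: (cmeas_comp (cmeas_coord k) measurable_snd)].
- apply: cmeas_cexp; apply: cmeas_dotc => k.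
    exact: (cmeas_comp (cmeas_coord k) measurable_fst).
  apply: cmeas_conjv; exact: (cmeas_comp (cmeas_coord k) measurable_snd).
Qed.

Let cintble_Q w : cintble (@gauss R n) (fun a => Q (w, a)).
Proof.
have [C C0 hC] := Q_bound.
apply: (@cintble_dom _ _ _ _ _ (fun a => C * expR (5 / 12 * sqnorm w) * expR (7 / 8 * sqnorm a))).
- exact: (cmeas_comp cmeas_Q (pair1_measurable w)).
- by move=> a; rewrite -mulrA; exact: hC.
- by apply: intR_Z; apply: intR_exp; lra.
Qed.

Lemma sfun_bound : exists2 C : R, 0 <= C & forall w, nm (sfun w) <= C * expR (5 / 12 * sqnorm w).
Proof.
have [C C0 hC] := Q_bound.
have i78 : intR (@gauss R n) (fun a => expR (7 / 8 * sqnorm a)) by apply: intR_exp; lra.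
exists (2 * (C * \int[@gauss R n]_a expR (7 / 8 * sqnorm a))).
  by rewrite !mulr_ge0// Rintegral_ge0// => a _; exact: expR_ge0.
move=> w; apply: (le_trans (nm_cint (cintble_Q w))).
rewrite -mulrA; apply: ler_wpM2l => //.
rewrite mulrAC -RintegralZl//; apply: le_Rintegral => //.
- exact: cintble_nm.
- exact: intR_Z.
- by move=> a _; have := hC w a; rewrite (mulrA C).
Qed.

Lemma cintble_gauss_prod (G : Cn R n * Cn R n -> Cplx R) (C s t : R) : s < 1 -> t < 1 ->
  cmeas G -> (forall p, nm (G p) <= C * (expR (s * sqnorm p.1) * expR (t * sqnorm p.2))) ->
  cintble (@gauss R n) (fun w => cint (@gauss R n) (fun a => G (w, a))) /\
  cint (@gauss R n) (fun w => cint (@gauss R n) (fun a => G (w, a))) =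
  cint (@gauss R n) (fun a => cint (@gauss R n) (fun w => G (w, a))).
Proof.
move=> s1 t1 mG hG; have is1 := intR_exp (n := n) s1; have it1 := intR_exp (n := n) t1.
apply: (cfubini mG hG).
- apply: intR_Z; exact: (intR_prod (fun w => expR_ge0 _) (fun w => expR_ge0 _) is1 it1).
- by move=> w; exact: (intR_Z C (intR_Z (expR (s * sqnorm w)) it1)).
- move=> a; apply: intR_Z; have := intR_Z (expR (t * sqnorm a)) is1.
  by congr intR; apply/funext => w; rewrite mulrC.
Qed.

(** Measurability of this parameter integral is read off from the integrability that Fubini's
    theorem provides. *)
Lemma cmeas_sfun : cmeas sfun.
Proof.
have [C C0 hC] := Q_bound.
have [||||/cintble_meas//] := @cintble_gauss_prod Q C (5 / 12) (7 / 8).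
- by lra.
- by lra.
- exact: cmeas_Q.
- by move=> [w a]; exact: hC.
Qed.

(** With the integral over w inside, the inner integral is the conjugate of the reproducing formula
    for v(w - a) e^{w . conj z} at a + b. There v is evaluated at b, and the factor e^{z . conj a}
    that remains reproduces f at z. *)
Lemma toeplitz_sfun b z :
  cint (@gauss R n) (fun w => sfun w * cexp (dotc w (conjv b)) * cexp (dotc z (conjv w))) =
  f z * conjc (v b) * cexp (dotc z (conjv b)).
Proof.
pose T w := cexp (dotc w (conjv b)) * cexp (dotc z (conjv w)).
have sT : Symp T by apply: SympM; [exact: Symp_cexp|exact: Symp_conj_cexp].
have [C C0 hC] := Q_bound.
(* Together with the 5/12 of [Q_bound] this gives the coefficient 1/2 in w. *)
have e12 : 0 < 12^-1 :> R by rewrite invr_gt0.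
have [K K0 hK] := sT.2 _ e12.
pose G (p : Cn R n * Cn R n) := T p.1 * Q p.
have [|||p|_ FE] := @cintble_gauss_prod G (K * C) (1 / 2) (7 / 8).
- by lra.
- by lra.
- by apply: cmeasM; [exact: (cmeas_comp sT.1 measurable_fst)|exact: cmeas_Q].
- case: p => w a; rewrite /G /= nmM.
  apply: (le_trans (ler_pM (nm_ge0 _) (nm_ge0 _) (hK w) (hC w a))).
  rewrite mulrACA; apply: ler_wpM2l; first exact: mulr_ge0.
  rewrite -!expRD ler_expR le_eqVlt; apply/orP; left; apply/eqP; by field.
transitivity (cint (@gauss R n) (fun w => cint (@gauss R n) (fun a => G (w, a)))).
  apply: eq_cint => w; rewrite -mulrA mulrC.
  by rewrite -[LHS](cintZ (T w) (cintble_Q w)).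
rewrite FE.
transitivity (cint (@gauss R n) (fun a => (conjc (v b) * cexp (dotc z (conjv b))) *
    (f a * cexp (dotc z (conjv a))))); last first.
  have iE : cintble (@gauss R n) (fun a => f a * cexp (dotc z (conjv a))).
    by apply: Symp_cintble; apply: SympM; [exact: sf|exact: Symp_conj_cexp].
  by rewrite (cintZ _ iE) (reproducing z sf hf) mulrC mulrA.
apply: eq_cint => a; rewrite /G /Q /T /=.
have sva : Symp (fun w => v (w - a) * cexp (dotc w (conjv z))).
  by apply: SympM; [exact: Symp_shift|exact: Symp_cexp].
have hva : lholo (fun w => v (w - a) * cexp (dotc w (conjv z))).
  by apply: lholoM; [exact: lholo_shift|exact: lholo_cexp].
transitivity (cint (@gauss R n) (fun w => f a *
   conjc (v (w - a) * cexp (dotc w (conjv z)) * cexp (dotc (a + b) (conjv w))))).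
  apply: eq_cint => w; rewrite (conjM (v (w - a) * _)) (conjM (v (w - a))) !conj_cexp !conj_dotc.
  rewrite !conjvK conjvD (dotcC _ w) dotcDr cexpD (dotcC (conjv w) z).
  move: (cexp (dotc w (conjv b))) (cexp (dotc z (conjv w))) (cexp (dotc w (conjv a))) => x1 x2 x3.
  by move: (f a) (v (w - a)) => y1 y2; ring.
have sI : Symp (fun w => v (w - a) * cexp (dotc w (conjv z)) * cexp (dotc (a + b) (conjv w))).
  by apply: SympM; [exact: sva|exact: Symp_conj_cexp].
rewrite cintZ; last by apply: Symp_cintble; exact: Symp_conj.
rewrite cint_conj; last exact: Symp_cintble.
rewrite (reproducing (a + b) sva hva) addrAC subrr add0r (conjM (v b)) conj_cexp conj_dotc conjvK conjvD.
rewrite dotcDl cexpD (dotcC (conjv a)) (dotcC (conjv b)).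
move: (cexp (dotc z (conjv a))) (cexp (dotc z (conjv b))) => x1 x2.
by move: (f a) (v b) => y1 y2; ring.
Qed.

(** Sequential continuity, by dominated convergence under the integral defining [sfun]. *)
Lemma ccvg_sfun (x : nat -> Cn R n) (w : Cn R n) : entire v ->
  (forall m k, nm (x m ord0 k - w ord0 k) < m.+1%:R^-1) -> ccvg (sfun \o x) (sfun w).
Proof.
move=> ev xw; have [C C0 hC] := Q_bound.
(* The points x m lie in the unit polydisc around w, where |x m|^2 <= 2 n + 2 |w|^2; this makes
   [Q_bound] uniform in m. *)
pose g a := C * expR (5 / 12 * (2 * n%:R + 2 * sqnorm w)) * expR (7 / 8 * sqnorm a).
apply: (@cint_dct _ _ _ _ (fun m a => Q (x m, a)) (fun a => Q (w, a)) g).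
- by move=> m; exact: (cintble_meas (cintble_Q _)).
- exact: (cintble_meas (cintble_Q _)).
- move=> a; rewrite /Q /=; apply: ccvgM; first apply: ccvgM.
  + exact: ccvg_cst.
  + apply: ccvg_conj; apply: (entire_ccvg ev) => m k; rewrite !mxE opprB.
    by rewrite addrA subrK; exact: xw.
  + have E y : cexp (dotc y (conjv a)) = \prod_k cexp (y ord0 k * conjv a ord0 k).
      exact: cexp_sum.
    rewrite E; under eq_fun do rewrite E; apply: ccvg_prod => k.
    apply: (ccvg_ccont (cdiff_ccont (cdiff_cexp _))); apply: ccvgM; last exact: ccvg_cst.
    apply: (ccvg_squeeze (b := fun m => m.+1%:R^-1)); last exact: cvg_harmonic.
    by move=> m; exact: ltW.
- move=> m a; apply: (le_trans (hC _ _)); rewrite /g -(mulrA C); apply: ler_wpM2l => //.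
  apply: ler_wpM2r; first exact: expR_ge0.
  rewrite ler_expR; apply: ler_wpM2l; first by lra.
  have h1 : sqnorm (x m - w) <= n%:R.
    rewrite sqnorm_sum (le_trans (y := \sum_(k < n) 1))//; last by rewrite sumr_const card_ord.
    apply: ler_sum => k _; rewrite exprn_ile1 ?nm_ge0// !mxE.
    by rewrite (le_trans (ltW (xw m k)))// invf_le1 ?ltr0n// ler1n.
  by have := sqnormD_le (x m - w) w; rewrite subrK; lra.
- by apply: intR_Z; apply: intR_exp; lra.
Qed.

End star_symbol.

(** * Uniqueness of symbols *)

Section multipliers.
Context {R : realType} {n : nat}.
Implicit Types (p q F : Cn R n -> Cplx R) (w a b : Cn R n) (t s : Cn R n -> R).

(* At [z = - a] the kernel [K_a(w) e^{z . conj w}] of the Toeplitz integrals has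
   modulus one and is a character of the additive group of C^n. *)
Definition unichar a w : Cplx R := cexp (dotc w (conjv a)) * cexp (dotc (- a) (conjv w)).

Definition phase a w : R := 2 * Im (dotc w (conjv a)).

Lemma unicharE a w : unichar a w = cos (phase a w) +i* sin (phase a w).
Proof.
rewrite /unichar -cexpD dotcNl (_ : dotc a (conjv w) = conjc (dotc w (conjv a))); last first.
  by rewrite conj_dotc conjvK dotcC.
rewrite /phase; case: (dotc w (conjv a)) => x y.
have -> : x +i* y + - conjc (x +i* y) = 0 +i* (2 * y) :> Cplx R.
  by apply: cplx_eq; rewrite /=; ring.
by rewrite /cexp /= expR0; apply: cplx_eq; rewrite !cplxE /=; ring.
Qed.

Lemma unichar0 w : unichar 0 w = 1.
Proof.
rewrite unicharE /phase (_ : dotc w (conjv 0) = 0).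
  by rewrite /= mulr0 cos0 sin0.
by rewrite (_ : conjv 0 = 0) ?dotc0r//; apply/rowP => k; rewrite conjvE mxE conj0.
Qed.

Lemma phaseD a b w : phase (a + b) w = phase a w + phase b w.
Proof. by rewrite /phase conjvD dotcDr ImD mulrDr. Qed.

Lemma phaseN a w : phase (- a) w = - phase a w.
Proof. by rewrite /phase conjvN dotcNr ImN mulrN. Qed.

Lemma phaseZ (r : R) a w : phase (r%:C *: a) w = r * phase a w.
Proof. by rewrite /phase conjvZ dotcZr conj_realc ImM /=; ring. Qed.

Lemma unicharD a b w : unichar (a + b) w = unichar a w * unichar b w.
Proof.
by rewrite !unicharE phaseD; apply: cplx_eq; rewrite !cplxE /= ?cosD ?sinD//; ring.
Qed.

Lemma nm_unichar a w : nm (unichar a w) = 1.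
Proof. by rewrite unicharE nmE /= cos2Dsin2 sqrtr1. Qed.

Lemma cmeas_unichar a : cmeas (unichar a).
Proof. apply: cmeasM; [exact: (Symp_cexp _).1|exact: (Symp_conj_cexp _).1]. Qed.

(** Up to the scaling of frequencies, the integrable functions whose product with the Gaussian
    density has zero Fourier transform. They form a module over the characters. *)
Definition annih p := cintble (@gauss R n) p /\
  forall a, cint (@gauss R n) (fun w => p w * unichar a w) = 0.

Lemma cintble_unichar p a : cintble (@gauss R n) p ->
  cintble (@gauss R n) (fun w => p w * unichar a w).
Proof.
move=> ip; apply: (cintble_dom _ _ (cintble_nm ip)).
  by apply: cmeasM; [exact: cintble_meas ip|exact: cmeas_unichar].
by move=> w; rewrite nmM nm_unichar mulr1.
Qed.

Lemma annihD p q : annih p -> annih q -> annih (fun w => p w + q w).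
Proof.
move=> [ip hp] [iq hq]; split; first exact: cintbleD.
move=> a; under eq_cint do rewrite mulrDl.
by rewrite cintD ?hp ?hq ?addr0//; exact: cintble_unichar.
Qed.

Lemma annihZ (x : Cplx R) p : annih p -> annih (fun w => x * p w).
Proof.
move=> [ip hp]; split; first exact: cintbleZ.
move=> a; under eq_cint do rewrite -mulrA.
by rewrite cintZ ?hp ?mulr0//; exact: cintble_unichar.
Qed.

Lemma annih_unichar b p : annih p -> annih (fun w => unichar b w * p w).
Proof.
move=> [ip hp]; split.
  by have := cintble_unichar b ip; under eq_fun do rewrite mulrC.
by move=> a; rewrite -[RHS](hp (b + a)); apply: eq_cint => w; rewrite unicharD; ring.
Qed.

(* Bounded multipliers preserving [annih] form an algebra that contains the sines
   of all phases and is closed under bounded pointwise limits; the indicators it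
   contains make up a sigma-algebra, which is all of the Borel sets. *)
Definition mult t := [/\ measurable_fun setT t, exists K : R, forall w, `|t w| <= K
  & forall p, annih p -> annih (fun w => (t w)%:C * p w)].

Lemma mult_cst (x : R) : mult (fun=> x).
Proof.
by split=> [||p]; [exact: measurable_cst|exists `|x|; move=> _|exact: annihZ].
Qed.

Lemma multD t s : mult t -> mult s -> mult (fun w => t w + s w).
Proof.
move=> [mt [K hK] ht] [ms [L hL] hs]; split; first exact: measurable_funD.
  by exists (K + L) => w; rewrite (le_trans (ler_normD _ _))// lerD.
move=> p ap; have := annihD (ht p ap) (hs p ap).
by under eq_fun do rewrite -mulrDl -realcD.
Qed.

Lemma multM t s : mult t -> mult s -> mult (fun w => t w * s w).
Proof.
move=> [mt [K hK] ht] [ms [L hL] hs]; split; first exact: measurable_funM.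
  by exists (K * L) => w; rewrite normrM ler_pM.
move=> p ap; have := ht _ (hs p ap).
by under eq_fun do rewrite mulrA -realcM.
Qed.

Lemma multZ (x : R) t : mult t -> mult (fun w => x * t w).
Proof. by move=> ht; apply: multM => //; exact: mult_cst. Qed.

Lemma multN t : mult t -> mult (fun w => - t w).
Proof. by move=> /(multZ (-1)); under eq_fun do rewrite mulN1r. Qed.

Lemma multX t m : mult t -> mult (fun w => t w ^+ m).
Proof.
move=> ht; elim: m => [|m IH].
  by under eq_fun do rewrite expr0; exact: mult_cst.
by under eq_fun do rewrite exprS; exact: multM.
Qed.

Lemma mult_sum (F : nat -> Cn R n -> R) m : (forall k, mult (F k)) ->
  mult (fun w => \sum_(0 <= k < m) F k w).
Proof.
move=> hF; elim: m => [|m IH].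
  by under eq_fun do rewrite big_nil; exact: mult_cst.
by under eq_fun do rewrite big_nat_recr//=; exact: multD.
Qed.

Lemma mult_prod (F : nat -> Cn R n -> R) m : (forall k, mult (F k)) ->
  mult (fun w => \prod_(0 <= k < m) F k w).
Proof.
move=> hF; elim: m => [|m IH].
  by under eq_fun do rewrite big_nil; exact: mult_cst.
by under eq_fun do rewrite big_nat_recr//=; exact: multM.
Qed.

(** A uniform bound on the multipliers gives the dominating function K |p|, as characters have
    modulus one. *)
Lemma mult_lim (F : nat -> Cn R n -> R) t (K : R) : (forall k, mult (F k)) ->
  (forall k w, `|F k w| <= K) -> (forall w, F ^~ w @ \oo --> t w) -> mult t.
Proof.
move=> hF hK Ft.
have mF k : measurable_fun setT (F k) by case: (hF k).
have mt : measurable_fun setT t by apply: (measurable_fun_cvg mF) => w _; exact: Ft.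
have tK w : `|t w| <= K.
  have H : (fun k => `|F k w|) @ \oo --> `|t w| by apply: cvg_norm; exact: Ft.
  by apply: (cvgr_to_le H); apply: nearW => k; exact: hK.
split=> //; first by exists K.
move=> p ap; have [ip hp] := ap; have mp := cintble_meas ip.
have iKp : intR (@gauss R n) (fun w => K * nm (p w)) by apply: intR_Z; exact: cintble_nm.
split.
  apply: (cintble_dom _ _ iKp).
    by apply: cmeasM => //; exact: cmeas_real.
  by move=> w; rewrite nmM nmR ler_wpM2r// nm_ge0.
move=> a.
apply: (@ccvg_uniq _ (fun k => cint (@gauss R n) (fun w => (F k w)%:C * p w * unichar a w))).
  apply: (cint_dct (g := fun w => K * nm (p w))) => //.
  - move=> k; apply: cmeasM; last exact: cmeas_unichar.
    by apply: cmeasM => //; exact: cmeas_real.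
  - apply: cmeasM; last exact: cmeas_unichar.
    by apply: cmeasM => //; exact: cmeas_real.
  - move=> w; apply: (@ccvg_squeeze _ _ _ (fun k => `|F k w - t w| * nm (p w))).
      move=> k; by rewrite -2!mulrBl -rmorphB (nmM _ (unichar a w)) nm_unichar mulr1 (nmM _ (p w)) nmR.
    rewrite -(mul0r (nm (p w))); apply: cvgM; last exact: cvg_cst.
    rewrite -(normr0 R); apply: cvg_norm; rewrite -(subrr (t w)).
    by apply: cvgB; [exact: Ft|exact: cvg_cst].
  - by move=> k w; rewrite (nmM _ (unichar a w)) nm_unichar mulr1 (nmM _ (p w)) nmR ler_wpM2r// nm_ge0.
rewrite (_ : (fun k => _) = (fun=> 0)); first exact: ccvg_cst.
by apply/funext => k; case: (hF k) => _ _ /(_ p ap) [].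
Qed.

(** The partial sums of the exponential series are multipliers bounded by [expR K]. Exponentials are
    the building blocks of the approximation in [mult_gt0]. *)
Lemma mult_exp t : mult t -> mult (fun w => expR (t w)).
Proof.
move=> ht; case: (ht) => mt [K hK] _.
apply: (@mult_lim (fun m w => series (exp_coeff (t w)) m) _ (expR K)).
- move=> m; apply: mult_sum => k; rewrite /exp_coeff /=.
  under eq_fun do rewrite mulrC; apply: multZ; exact: multX.
- move=> m w; rewrite /series /=.
  apply: (le_trans (ler_norm_sum _ _ _)).
  apply: (@le_trans _ _ (series (exp_coeff K) m)).
    apply: ler_sum => k _; rewrite /exp_coeff /= normrM normrX.
    rewrite (ger0_norm (x := _^-1)) ?invr_ge0//; apply: ler_wpM2r; first by rewrite invr_ge0.
    by apply: lerXn2r; rewrite ?nnegrE//; exact: le_trans (hK w).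
  apply: nondecreasing_cvgn_le; last exact: is_cvg_series_exp_coeff.
  apply/nondecreasing_seqP => k; rewrite /series /= big_nat_recr//= lerDl.
  rewrite /exp_coeff /= divr_ge0// exprn_ge0//; exact: le_trans (hK 0).
- by move=> w; exact: is_cvg_series_exp_coeff.
Qed.

Lemma mult_sin a (c : R) : mult (fun w => sin (phase a w - c)).
Proof.
have mth : measurable_fun setT (phase a).
  apply: measurable_funM; first exact: measurable_cst.
  by apply: (cmeas_dotc (a := fun w => w) (b := fun=> conjv a) _ _).2 => k;
    [exact: cmeas_coord|exact: cmeas_cst].
have ms : measurable_fun setT (fun w => sin (phase a w - c)).
  apply: (@measurableT_comp _ _ _ _ _ _ (@sin R) _ (fun w => phase a w - c)).
    by apply: continuous_measurable_fun; exact: continuous_sin.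
  by apply: measurable_funB => //; exact: measurable_cst.
split=> //; first by exists 1 => w; rewrite ler_norml sin_geN1 sin_le1.
move=> p ap.
(* x = e^{- i c} / (2 i), so that sin (theta - c) = x e^{i theta} + conj x e^{- i theta}. *)
pose x : Cplx R := 2^-1 * sin c * -1 +i* (2^-1 * cos c * -1).
have := annihD (annihZ x (annih_unichar a ap)) (annihZ (conjc x) (annih_unichar (- a) ap)).
congr annih; apply/funext => w; rewrite 2!mulrA -mulrDl; congr (_ * _).
rewrite !unicharE phaseN cosN sinN sinB /x.
by apply: cplx_eq; rewrite !cplxE /=; field.
Qed.

(* exp (- k exp (- k x)) tends to 1 if x > 0 and to 0 otherwise *)
Lemma mult_gt0 t : mult t -> mult (fun w => (0 < t w)%R%:R).
Proof.
move=> ht.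
apply: (@mult_lim (fun k w => expR (- (k%:R * expR (- (k%:R * t w))))) _ 1).
- by move=> k; apply: mult_exp; apply: multN; apply: multZ; apply: mult_exp; apply: multN; exact: multZ.
- by move=> k w; rewrite ger0_norm ?expR_ge0// -expR0 ler_expR oppr_le0 mulr_ge0// expR_ge0.
move=> w; move: (t w) => {ht t w} x.
have inv0 : (fun k : nat => (k.+1%:R : R)^-1) @ \oo --> (0 : R) by exact: cvg_harmonic.
(* The shift by one keeps the inverses of the indices, used as bounds below, away from 1 / 0. *)
suff H : (fun k => expR (- (k.+1%:R * expR (- (k.+1%:R * x))))) @ \oo --> ((0 < x)%R%:R : R).
  by rewrite -cvg_shiftS.
case: ltP => x0.
  suff H : (fun k => - (k.+1%:R * expR (- (k.+1%:R * x)))) @ \oo --> (- 0 : R).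
    have := continuous_cvg _ (@continuous_expR R (- 0)) H.
    by rewrite oppr0 expR0 => H'; exact: H'.
  apply: cvgN.
  (* From exp (m x) >= (m x / 2)^2 one gets m exp (- m x) <= 4 / (x^2 m). *)
  apply: (@squeeze_cvgr _ _ _ _ (cst 0) (fun k => 4 / x ^+ 2 * k.+1%:R^-1)).
  - apply: nearW => k; rewrite mulr_ge0 ?expR_ge0//=.
    set m : R := k.+1%:R; have m0 : 0 < m by rewrite ltr0n.
    have mx : 0 < m * x / 2 by rewrite !mulr_gt0.
    have e1 : m * x / 2 <= expR (m * x / 2) by have := expR_ge1Dx (m * x / 2); lra.
    have e2 : (m * x / 2) ^+ 2 <= expR (m * x).
      have -> : expR (m * x) = expR (m * x / 2) ^+ 2.
        by rewrite expr2 -expRD; congr expR; field.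
      by rewrite ler_pXn2r ?nnegrE ?expR_ge0//; exact: ltW.
    have e3 : 0 < (m * x / 2) ^+ 2 by rewrite exprn_gt0.
    rewrite expRN; apply: (@le_trans _ _ (m * ((m * x / 2) ^+ 2)^-1)).
      by rewrite ler_pM2l// lef_pV2 ?posrE ?expR_gt0.
    rewrite le_eqVlt; apply/orP; left; apply/eqP; field.
    by rewrite !lt0r_neq0.
  - exact: cvg_cst.
  - by rewrite -[X in _ --> X](mulr0 (4 / x ^+ 2)); apply: cvgM; [exact: cvg_cst|exact: inv0].
apply: (@squeeze_cvgr _ _ _ _ (cst 0) (fun k => k.+1%:R^-1)) => //; last exact: cvg_cst.
apply: nearW => k; rewrite expR_ge0/= expRN.
rewrite lef_pV2 ?posrE ?expR_gt0 ?ltr0n//.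
apply: (@le_trans _ _ (k.+1%:R * expR (- (k.+1%:R * x)))).
  rewrite ler_peMr// -expR0 ler_expR oppr_ge0; exact: mulr_ge0_le0.
by have := expR_ge1Dx (k.+1%:R * expR (- (k.+1%:R * x))); lra.
Qed.

(** The sine sees a phase only modulo 2 pi. Dividing phase minus c by a large integer brings it into
    ]- pi, pi[, where the sine is positive exactly when its argument is. *)
Lemma mult_phase_gt a (c : R) : mult (fun w => (c < phase a w)%R%:R).
Proof.
apply: (@mult_lim (fun m w => (0 < sin (phase ((m.+1%:R^-1)%:C *: a) w - c * m.+1%:R^-1))%R%:R) _ 1).
- by move=> m; apply: mult_gt0; exact: mult_sin.
- by move=> m w; case: (_ < _); rewrite ?normr1 ?normr0.
move=> w; under eq_fun do rewrite phaseZ (mulrC c) -mulrBr.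
rewrite -subr_gt0; move: (_ - c) => x.
apply: cvg_near_cst.
have inv0 : (fun k : nat => `|(k.+1%:R : R)^-1 * x|) @ \oo --> (0 : R).
  rewrite -[X in _ --> X](normr0 R); apply: cvg_norm.
  by rewrite -[X in _ --> X](mul0r x); apply: cvgM; [exact: cvg_harmonic|exact: cvg_cst].
have H : \forall k \near \oo, `|(k.+1%:R : R)^-1 * x| < pi := cvgr_lt _ inv0 _ (pi_gt0 R).
apply: filterS (H _) => k hk.
have k0 : 0 < (k.+1%:R : R)^-1 by rewrite invr_gt0 ltr0n.
have yx : (0 < k.+1%:R^-1 * x) = (0 < x) by rewrite pmulr_rgt0.
rewrite -yx; move: (_ * x) hk {yx} => y; rewrite ltr_norml => /andP[h1 h2].
case: (ltP 0 y) => y0; first by rewrite sin_gt0_pi ?y0.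
rewrite ltNge -oppr_ge0 -sinN sin_ge0_pi//; lra.
Qed.

Definition mset (B : set (Cn R n)) := mult \1_B.

Lemma mset_gt a (c : R) : mset (phase a @^-1` `]c, +oo[%classic).
Proof.
have := mult_phase_gt a c; congr mult; apply/funext => w.
rewrite indicE; congr (_%:R); congr nat_of_bool.
by apply/idP/idP => [h|/set_mem]; [apply/mem_set|]; rewrite /= in_itv/= andbT.
Qed.

(** The indicator of a complement is 1 minus the indicator, and that of a countable intersection is
    the limit of finite products; unions follow by complementation. *)
Lemma mset_sigma_algebra : sigma_algebra setT mset.
Proof.
have msetC B : mset B -> mset (~` B).
  move=> hB; have := multD (mult_cst 1) (multN hB); congr mult; apply/funext => w.
  by rewrite !indicE in_setC; case: (_ \in _); rewrite /= ?subrr ?subr0.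
split.
- by rewrite /mset indic0; exact: mult_cst.
- by move=> B hB; rewrite setTD; exact: msetC.
move=> F hF; rewrite -[X in mset X]setCK; apply: (msetC).
rewrite setC_bigcup.
apply: (@mult_lim (fun m w => \prod_(0 <= k < m) \1_(~` F k) w) _ 1).
- by move=> m; apply: mult_prod => k; exact: msetC.
- move=> m w; rewrite normr_prod; apply: prodr_ile1 => k _.
  by rewrite normr_ge0 /= indicE; case: (_ \in _); rewrite ?normr1 ?normr0.
move=> w; apply: cvg_near_cst; rewrite indicE.
have [h|h] := pselect ((\bigcap_i ~` F i) w).
  apply: nearW => m; rewrite (mem_set h) big1// => k _.
  by rewrite indicE mem_set//; exact: h.
have [k hk] : exists k, F k w.
  by apply: contrapT => H; apply: h => k _ Fk; apply: H; exists k.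
exists k.+1 => // m /= km; rewrite (memNset h) (bigD1_seq k) ?mem_index_iota ?iota_uniq//=.
by rewrite indicE in_setC mem_set// mul0r.
Qed.

Lemma sigma_algebra_preimage (T T' : Type) (h : T -> T') (G : set (set T)) :
  sigma_algebra setT G -> sigma_algebra setT [set B | G (h @^-1` B)].
Proof.
move=> [G0 GC GU]; split=> /=.
- by rewrite preimage_set0.
- by move=> A hA; rewrite setTD preimage_setC -setTD; exact: GC.
- by move=> F hF; rewrite preimage_bigcup; exact: GU.
Qed.

Lemma mset_setI A B : mset A -> mset B -> mset (A `&` B).
Proof. by move=> hA hB; rewrite /mset indicI; exact: multM. Qed.

Lemma dotc_delta w k : dotc w (conjv (delta_mx ord0 k : Cn R n)) = w ord0 k.
Proof.
rewrite /dotc (bigD1 k)//= big1 => [|i ik]; rewrite conjvE mxE eqxx /=.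
  by rewrite eqxx conj1 mulr1 addr0.
by rewrite (negbTE ik) conj0 mulr0.
Qed.

Lemma mset_coord k (A B : set R) : measurable A -> measurable B ->
  mset [set w | A (Re (w ord0 k)) /\ B (Im (w ord0 k))].
Proof.
have mset_phase a (C : set R) : measurable C -> mset (phase a @^-1` C).
  rewrite [X in X C -> _](_ : _ = <<s RGenOInfty.G (R := R) >>); last first.
    exact: RGenOInfty.measurableE.
  move: C; apply: smallest_sub.
    exact: (sigma_algebra_preimage (phase a) mset_sigma_algebra).
  by move=> _ [c ->]; exact: mset_gt.
(* The phase of a is 2 Im (w . conj a), so - i/2 and 1/2 times the k-th unit vector give the real
   and the imaginary part of w_k. *)
have phR w : phase ((0 +i* (- 2^-1)) *: delta_mx ord0 k) w = Re (w ord0 k).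
  by rewrite /phase conjvZ dotcZr dotc_delta !cplxE /=; field.
have phI w : phase ((2^-1)%:C *: delta_mx ord0 k) w = Im (w ord0 k).
  by rewrite phaseZ /phase dotc_delta; field.
move=> mA mB.
have := mset_setI (mset_phase ((0 +i* (- 2^-1)) *: delta_mx ord0 k) _ mA)
  (mset_phase ((2^-1)%:C *: delta_mx ord0 k) _ mB).
by congr mset; apply/funext => w; rewrite /setI /= phR phI.
Qed.

Lemma measurable_mset (B : set (Cn R n)) : measurable B -> mset B.
Proof.
case=> C mC <-; rewrite setTI; move: C mC.
apply: (@smallest_sub _ _ _ [set C | mset (@Cn_coords R n @^-1` C)]).
  exact: (sigma_algebra_preimage (@Cn_coords R n) mset_sigma_algebra).
(* The sigma-algebra on tuples is generated by a finite union of preimages under the projections;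
   this extracts the projection concerned. *)
have sub (G : 'I_n -> set (set (n.-tuple (plane R)))) C :
    (\big[setU/set0]_(i < n) G i) C -> exists i, G i C.
  by elim/big_ind: _ => // [S S' hS hS' [/hS|/hS']//|i _]; exists i.
move=> C /sub[k [A mA <-]] {C}.
suff : mset [set w | A (Re (w ord0 k), Im (w ord0 k))].
  rewrite setTI /=; congr mset; apply/funext => w.
  by rewrite /preimage /= tnth_mktuple.
move: A mA.
have -> : (measurable : set (set (plane R))) =
    <<s [set A `*` B | A in measurable & B in measurable] >> by exact: measurable_prod_measurableType.
apply: (@smallest_sub _ _ _ [set C | mset ((fun w => (Re (w ord0 k), Im (w ord0 k)) : plane R) @^-1` C)]).
  exact: (sigma_algebra_preimage _ mset_sigma_algebra).
by move=> _ [A mA [B' mB' <-]]; exact: mset_coord.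
Qed.

(** As Borel indicators are multipliers and the character of 0 is 1, the integral of q over each
    Borel set vanishes. *)
Lemma annih_eq0 q : annih q -> \forall w \ae (@gauss R n), q w = 0.
Proof.
move=> aq; have [[iR iI] hq] := aq.
have key B : measurable B -> cint (@gauss R n) (fun w => (\1_B w)%:C * q w) = 0.
  move=> /measurable_mset[_ _ /(_ q aq)[_ /(_ 0)]].
  by under eq_cint do rewrite unichar0 mulr1.
have ae0 (g : Cn R n -> R) : intR (@gauss R n) g ->
    (forall B, measurable B -> \int[@gauss R n]_w (\1_B w * g w) = 0) ->
    \forall w \ae (@gauss R n), g w = 0.
  move=> ig hg.
  have [|||] := @integral_ae_eq _ _ _ (@gauss R n) setT measurableT (cst 0%E) (EFin \o g).
  - exact: ig.
  - exact: measurable_cst.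
  - move=> E _ mE; rewrite integral0 integral_mkcond.
    have -> : ((EFin \o g) \_ E) = EFin \o (fun w => \1_E w * g w).
      apply/funext => w; rewrite /patch /= indicE; case: (w \in E); rewrite ?mul1r//.
      by rewrite mul0r.
    have iE : intR (@gauss R n) (fun w => \1_E w * g w).
      apply: (intR_le (g' := fun w => `|g w|)); last exact: integrable_norm.
        by apply: measurable_funM; [exact: measurable_indic|exact: intR_meas ig].
      move=> w; rewrite normrM indicE; case: (w \in E); rewrite ?normr1 ?mul1r//.
      by rewrite normr0 mul0r.
    by rewrite -[LHS]fineK ?(integrable_fin_num measurableT iE)//; congr EFin; exact: hg.
  - move=> N [mN N0 sN]; exists N; split=> // w nw; apply: sN => /= K.
    by apply: nw; exact: (EFin_inj (K I)).
have cR B : measurable B -> \int[@gauss R n]_w (\1_B w * Re (q w)) = 0.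
  move=> /key /(congr1 (@complex.Re R)) /= H; rewrite -[RHS]H.
  by apply: eq_Rintegral => w _; rewrite !cplxE /= mul0r subr0.
have cI B : measurable B -> \int[@gauss R n]_w (\1_B w * Im (q w)) = 0.
  move=> /key /(congr1 (@complex.Im R)) /= H; rewrite -[RHS]H.
  by apply: eq_Rintegral => w _; rewrite !cplxE /= mul0r addr0.
have HR := ae0 _ iR cR; have HI := ae0 _ iI cI.
by apply: filterS2 HR HI => w hr hi; apply: cplx_eq; rewrite ?hr ?hi.
Qed.

End multipliers.

(** * The product of two Toeplitz operators *)

Lemma mul_le_sqrD {R : realFieldType} (x y : R) : x * y <= x ^+ 2 + y ^+ 2.
Proof.
have := sqr_ge0 (x - y); have := sqr_ge0 (x + y); rewrite sqrrB sqrrD.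
move: (x ^+ 2) (y ^+ 2) (x * y) => *; lra.
Qed.

Lemma sqr_le_sqrD {R : realFieldType} (s x y : R) :
  0 <= s -> s <= x + y -> s ^+ 2 <= 2 * (x ^+ 2 + y ^+ 2).
Proof.
move=> s0 sxy; apply: (@le_trans _ _ ((x + y) ^+ 2)).
  by rewrite ler_pXn2r ?nnegrE// (le_trans s0).
have := sqr_ge0 (x - y); rewrite sqrrB sqrrD.
move: (x ^+ 2) (y ^+ 2) (x * y) => *; lra.
Qed.

(** * Square integrability against the Gaussian measure *)

Section L2.
Context {R : realType} {n : nat}.
Implicit Types (h F : Cn R n -> Cplx R) (z w a b : Cn R n).

Lemma L2gaussP h : L2gauss h <-> cmeas h /\ intR (@gauss R n) (fun w => nm (h w) ^+ 2).
Proof.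
split=> -[mh ih]; split=> //.
  apply/integrableP; split.
    by apply/measurable_EFinP; apply: measurable_funX; exact: cmeas_nm.
  by under eq_integral do rewrite /= ger0_norm ?sqr_ge0//.
case/integrableP : ih => _.
by under eq_integral do rewrite /= ger0_norm ?sqr_ge0//.
Qed.

Lemma L2_cintbleM h F : L2gauss h -> L2gauss F -> cintble (@gauss R n) (fun w => h w * F w).
Proof.
move=> /L2gaussP[mh ih] /L2gaussP[mF iF].
apply: (cintble_dom _ _ (intR_D ih iF)); first exact: cmeasM.
by move=> w; rewrite nmM; exact: mul_le_sqrD.
Qed.

Lemma L2D h F : L2gauss h -> L2gauss F -> L2gauss (fun w => h w + F w).
Proof.
move=> /L2gaussP[mh ih] /L2gaussP[mF iF]; apply/L2gaussP; split; first exact: cmeasD.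
have mhF := cmeasD mh mF.
apply: (@intR_le _ _ _ _ _ (fun w => 2 * (nm (h w) ^+ 2 + nm (F w) ^+ 2))).
- by apply: measurable_funX; exact: cmeas_nm.
- move=> w; rewrite ger0_norm ?sqr_ge0//.
  exact: sqr_le_sqrD (nm_ge0 _) (nmD _ _).
- by apply: intR_Z; exact: intR_D.
Qed.

Lemma L2N h : L2gauss h -> L2gauss (fun w => - h w).
Proof.
move=> /L2gaussP[mh ih]; apply/L2gaussP; split; first exact: cmeasN.
by under eq_fun do rewrite nmN.
Qed.

Lemma bound_L2 h (C c : R) : c < 1 -> cmeas h ->
  (forall w, nm (h w) <= C * expR (c / 2 * sqnorm w)) -> L2gauss h.
Proof.
move=> c1 mh hb; apply/L2gaussP; split => //.
apply: (@intR_le _ _ _ _ _ (fun w => C ^+ 2 * expR (c * sqnorm w))).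
- by apply: measurable_funX; exact: cmeas_nm.
- move=> w; rewrite ger0_norm ?sqr_ge0//.
  have -> : expR (c * sqnorm w) = expR (c / 2 * sqnorm w) ^+ 2.
    by rewrite expr2 -expRD; congr expR; field.
  rewrite -exprMn ler_pXn2r ?nnegrE ?nm_ge0//.
  exact: le_trans (nm_ge0 (h w)) (hb w).
- by apply: intR_Z; exact: intR_exp.
Qed.

Lemma Symp_L2 F : Symp F -> L2gauss F.
Proof.
move=> [mF hF]; have e4 : 0 < 2^-1 / 2 :> R by lra.
have [K _ hK] := hF _ e4; apply: (bound_L2 _ mF hK); lra.
Qed.

End L2.

Section product.
Context {R : realType} {n : nat}.
Variables f g u v : Cn R n -> Cplx R.
Hypotheses (sf : Symp f) (hf : lholo f) (sg : Symp g) (hg : lholo g).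
Hypotheses (su : Symp u) (hu : lholo u) (sv : Symp v) (hv : lholo v).
Implicit Types (h F : Cn R n -> Cplx R) (z w a b : Cn R n).

(** Conjugating the reproducing formula for F(w) e^{w . conj z} exchanges the roles of a and z: an
    antiholomorphic factor is evaluated at the index a of the kernel. *)
Lemma reproducing_conj F a z : Symp F -> lholo F ->
  cint (@gauss R n) (fun w => conjc (F w) * (cexp (dotc w (conjv a)) * cexp (dotc z (conjv w)))) =
  conjc (F a) * cexp (dotc z (conjv a)).
Proof.
move=> sF hF.
have sE : Symp (fun w => F w * cexp (dotc w (conjv z))).
  by apply: SympM => //; exact: Symp_cexp.
have hE : lholo (fun w => F w * cexp (dotc w (conjv z))).
  by apply: lholoM => //; exact: lholo_cexp.
have := reproducing a sE hE => /(congr1 (fun x : Cplx R => conjc x : Cplx R)).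
rewrite (conjM (F a)) conj_cexp conj_dotc conjvK (dotcC (conjv a)) => <-.
rewrite -cint_conj; last first.
  by apply: Symp_cintble; apply: SympM; [exact: sE|exact: Symp_conj_cexp].
apply: eq_cint => w; rewrite (conjM (F w * _)) (conjM (F w)) !conj_cexp !conj_dotc !conjvK.
by rewrite (dotcC (conjv a)) (dotcC z) [LHS]mulrA [RHS]mulrAC.
Qed.

Definition product_symbol w : Cplx R :=
  u w * conjc (g w) + f w * u w + conjc (g w) * conjc (v w) + sfun f v w.

Lemma sfun_L2 : L2gauss (sfun f v).
Proof.
have [C _ hC] := sfun_bound sf sv.
apply: (@bound_L2 _ _ _ C (5 / 6)); first by lra.
  exact: cmeas_sfun.
by move=> w; rewrite (_ : 5 / 6 / 2 = 5 / 12)//; field.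
Qed.

Lemma product_symbol_L2 : L2gauss product_symbol.
Proof.
have sgc := Symp_conj sg; have svc := Symp_conj sv.
apply: L2D; first apply: L2D; first apply: L2D; try exact: Symp_L2 (SympM _ _).
exact: sfun_L2.
Qed.

(** The holomorphic part acts by multiplication, and the kernel at a is an eigenvector for the
    antiholomorphic part, with eigenvalue conj (v a). *)
Lemma toeplitz_kernel a : toeplitz (fun z => u z + conjc (v z)) (fock_kernel a) =
  fun z => (u z + conjc (v a)) * fock_kernel a z.
Proof.
apply/funext => z; rewrite /fock_kernel.
pose E w := cexp (dotc w (conjv a)) * cexp (dotc z (conjv w)).
have sE : Symp E by apply: SympM; [exact: Symp_cexp|exact: Symp_conj_cexp].
have suE : Symp (fun w => u w * cexp (dotc w (conjv a))).
  by apply: SympM; [exact: su|exact: Symp_cexp].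
have huE : lholo (fun w => u w * cexp (dotc w (conjv a))).
  by apply: lholoM; [exact: hu|exact: lholo_cexp].
transitivity (cint (@gauss R n) (fun w => u w * cexp (dotc w (conjv a)) * cexp (dotc z (conjv w)) +
    conjc (v w) * E w)).
  apply: eq_cint => w; rewrite /E -mulrA.
  by rewrite -(mulrA (u w)) -mulrDl.
rewrite cintD.
- by rewrite (reproducing z suE huE) (reproducing_conj a z sv hv) -mulrDl.
- by apply: Symp_cintble; apply: SympM; [exact: suE|exact: Symp_conj_cexp].
- by apply: Symp_cintble; apply: SympM; [exact: Symp_conj|exact: sE].
Qed.

(** With c = conj (v a), the left side has the terms f u, u conj g, c conj g and c f. The first two
    occur verbatim in [product_symbol]; c conj g comes from conj g conj v by [reproducing_conj], and
    c f from [sfun] by [toeplitz_sfun]. *)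
Lemma toeplitz_product a z :
  toeplitz (fun z => f z + conjc (g z))
    (toeplitz (fun z => u z + conjc (v z)) (fock_kernel a)) z =
  toeplitz product_symbol (fock_kernel a) z.
Proof.
rewrite toeplitz_kernel /toeplitz /fock_kernel.
rewrite -[LHS]/(cint (@gauss R n) _) -[RHS]/(cint (@gauss R n) _).
pose K w := cexp (dotc w (conjv a)); pose e w := cexp (dotc z (conjv w)).
pose E w := K w * e w.
have sK : Symp K by exact: Symp_cexp.
have hK : lholo K by exact: lholo_cexp.
have sE : Symp E by apply: SympM; [exact: sK|exact: Symp_conj_cexp].
have sgc := Symp_conj sg; have svc := Symp_conj sv.
set c : Cplx R := conjc (v a).
have rep F : Symp F -> lholo F -> cint (@gauss R n) (fun w => F w * E w) = F z * K z.
  move=> sF hF; rewrite -(reproducing z (SympM sF sK) (lholoM hF hK)).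
  by apply: eq_cint => w; rewrite /E mulrA.
have iF F : Symp F -> cintble (@gauss R n) (fun w => F w * E w).
  by move=> sF; apply: Symp_cintble; exact: SympM.
have sfu := SympM sf su; have sug := SympM su sgc; have sgv := SympM sgc svc.
have iS : cintble (@gauss R n) (fun w => sfun f v w * E w).
  by apply: L2_cintbleM; [exact: sfun_L2|exact: Symp_L2].
transitivity (cint (@gauss R n) (fun w => (f w * u w) * E w + c * (f w * E w) +
    (u w * conjc (g w)) * E w + c * (conjc (g w) * E w))).
  apply: eq_cint => w; rewrite /E /K /e.
  move: (f w) (u w) (conjc (g w)) (cexp _) (cexp _) => x1 x2 x3 x4 x5; rewrite -/c.
  by move: c => c'; ring.
transitivity (cint (@gauss R n) (fun w => (u w * conjc (g w)) * E w + (f w * u w) * E w +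
    (conjc (g w) * conjc (v w)) * E w + sfun f v w * E w)); last first.
  apply: eq_cint => w; rewrite /product_symbol /E /K /e !mulrDl.
  by rewrite -!mulrA.
have i1 := iF _ sfu; have i2 := iF _ sug; have i3 := iF _ sgv.
have i4 := cintbleZ c (iF _ sf); have i5 := cintbleZ c (iF _ sgc).
rewrite (cintD (cintbleD (cintbleD i1 i4) i2) i5) (cintD (cintbleD i1 i4) i2) (cintD i1 i4).
rewrite (cintD (cintbleD (cintbleD i2 i1) i3) iS) (cintD (cintbleD i2 i1) i3) (cintD i2 i1).
rewrite (cintZ c (iF _ sf)) (cintZ c (iF _ sgc)).
have -> : cint (@gauss R n) (fun w => sfun f v w * E w) = f z * c * K z.
  by rewrite -(toeplitz_sfun sf hf sv hv a z); apply: eq_cint => w; rewrite mulrA.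
have -> : cint (@gauss R n) (fun w => conjc (g w) * E w) = conjc (g a) * K z.
  exact: reproducing_conj.
have -> : cint (@gauss R n) (fun w => conjc (g w) * conjc (v w) * E w) = conjc (g a) * c * K z.
  rewrite /c -conjM; have := reproducing_conj a z (SympM sg sv) (lholoM hg hv) => <-.
  by apply: eq_cint => w; rewrite conjM.
(* The integrals of the terms f u and u conj g are common to both sides and stay unevaluated. *)
rewrite (rep _ sf hf); move: (cint _ _) (cint _ _) => A B.
by move: (f z) (K z) (conjc (g a)) c {i4 i5} => y1 y2 y3 y4; ring.
Qed.

Lemma fock_kernel_span a : kernel_span (fock_kernel a).
Proof. by exists 1, (fun=> 1), (fun=> a) => w; rewrite big_ord1 mul1r. Qed.

Lemma product_symbol_ae h : L2gauss h ->
  (forall F, kernel_span F -> toeplitz (fun z => f z + conjc (g z))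
    (toeplitz (fun z => u z + conjc (v z)) F) = toeplitz h F) ->
  \forall z \ae (@lebesgue_Cn R n), h z = product_symbol z.
Proof.
move=> lh H; apply: ae_gauss_leb.
have lW := product_symbol_L2.
pose q w := h w + - product_symbol w.
have lq : L2gauss q by apply: L2D => //; exact: L2N.
have iE F b z : L2gauss F -> cintble (@gauss R n)
    (fun w => F w * (cexp (dotc w (conjv b)) * cexp (dotc z (conjv w)))).
  move=> lF; apply: L2_cintbleM => //; apply: Symp_L2.
  by apply: SympM; [exact: Symp_cexp|exact: Symp_conj_cexp].
have aq : annih q.
  split.
    by have := L2_cintbleM lq (Symp_L2 (Symp_cst 1)); under eq_fun do rewrite mulr1.
  move=> a; rewrite /unichar /q.
  under eq_cint do rewrite mulrDl mulNr.
  have iW := iE _ a (- a) lW.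
  rewrite (cintD (iE h a (- a) lh) (cintbleN iW)) (cintN iW).
  apply/eqP; rewrite subr_eq0; apply/eqP.
  (* At the point - a the integrands are [h] and [product_symbol] times the character
     [unichar a]. *)
  have := congr1 (@^~ (- a)) (H _ (fock_kernel_span a)).
  rewrite toeplitz_product /toeplitz => /esym.
  rewrite -[X in X = _]/(cint (@gauss R n) _) -[X in _ = X]/(cint (@gauss R n) _).
  by under eq_cint do rewrite -mulrA; under [X in _ = X -> _]eq_cint do rewrite -mulrA.
by apply: filterS (annih_eq0 aq) => w /eqP; rewrite /q subr_eq0 => /eqP.
Qed.

(** Every point is a limit of zeros supplied by [ae_dense]; along them the symbol converges to its
    value at the point, by continuity of the four functions and of [sfun]. *)
Lemma product_symbol_eq0 : entire f -> entire g -> entire u -> entire v ->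
  (\forall z \ae (@lebesgue_Cn R n), 0 = product_symbol z) -> forall z, product_symbol z = 0.
Proof.
move=> ef eg eu ev H z.
have ex (m : nat) : exists w : Cn R n, product_symbol w = 0 /\
    forall k, nm (w ord0 k - z ord0 k) < m.+1%:R^-1.
  have m0 : 0 < m.+1%:R^-1 :> R by rewrite invr_gt0.
  by have [w w0 wz] := ae_dense z m0 H; exists w.
have [x hx] := choice ex.
have xz m : forall k, nm (x m ord0 k - z ord0 k) < m.+1%:R^-1 by case: (hx m).
have cf := entire_ccvg ef xz; have cg := ccvg_conj (entire_ccvg eg xz).
have cu := entire_ccvg eu xz; have cv := ccvg_conj (entire_ccvg ev xz).
have cs := ccvg_sfun sf sv ev xz.
have := ccvgD (ccvgD (ccvgD (ccvgM cu cg) (ccvgM cf cu)) (ccvgM cg cv)) cs.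
move=> /ccvg_uniq; apply; rewrite (_ : (fun k => _) = (fun=> 0)); first exact: ccvg_cst.
by apply/funext => k; case: (hx k).
Qed.

End product.

Theorem theorem2 (R : realType) (n : nat) (n_gt0 : (1 <= n)%N)
    (f g u v : Cn R n -> Cplx R)
    (Sf : Sym f) (Hf : entire f) (Sg : Sym g) (Hg : entire g)
    (Su : Sym u) (Hu : entire u) (Sv : Sym v) (Hv : entire v) :
  let phi := fun z => f z + conjc (g z) in
  let psi := fun z => u z + conjc (v z) in
  (forall h : Cn R n -> Cplx R, L2gauss h ->
     (forall F, kernel_span F -> toeplitz phi (toeplitz psi F) = toeplitz h F) ->
     exists2 S : Cn R n -> Cplx R, forall z, star_op_value v f z (S z) &
       \forall z \ae (@lebesgue_Cn R n),
         h z = u z * conjc (g z) + f z * u z + conjc (g z) * conjc (v z) + S z) /\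
  ((forall F, kernel_span F -> toeplitz phi (toeplitz psi F) = fun=> 0) ->
     exists2 S : Cn R n -> Cplx R, forall z, star_op_value v f z (S z) &
       forall z, u z * conjc (g z) + f z * u z + conjc (g z) * conjc (v z) + S z = 0).
Proof.
move=> phi psi.
have [sf hf] := (Sym_Symp Sf Hf, entire_lholo Hf).
have [sg hg] := (Sym_Symp Sg Hg, entire_lholo Hg).
have [su hu] := (Sym_Symp Su Hu, entire_lholo Hu).
have [sv hv] := (Sym_Symp Sv Hv, entire_lholo Hv).
have star z : star_op_value v f z (sfun f v z) by exact: star_op_sfun.
split=> [h lh H|H]; exists (sfun f v) => //.
  exact: (product_symbol_ae sf hf sg hg su hu sv hv lh H).
apply: (product_symbol_eq0 sf sv Hf Hg Hu Hv).
apply: (product_symbol_ae sf hf sg hg su hu sv hv (h := fun=> 0)).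
  exact: Symp_L2 (Symp_cst 0).
move=> F /H -> ; apply/funext => z; rewrite /toeplitz.
by rewrite -[RHS]/(cint (@gauss R n) _) -[LHS](cint0 (@gauss R n)); apply: eq_cint => w; rewrite !mul0r.
Qed.
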